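(* Let $(G,H,\sigma)$ be a reduced $1$-dimensional Hecke triple, $N$ a normal subgroup of $G$ such that $H$ is normal in $N$, and suppose that $$\sigma(nhn^{-1})=\sigma(h)\quad\text{for all }n\in N,\ h\in H.$$ Let $(G_\sigma,H_\sigma,\sigma)$ be the Schlichting completion of $(G,H,\sigma)$. Then $C^*(\mathcal{H}_\sigma(G_\sigma,H_\sigma))=p_\sigma C^*(G_\sigma)p_\sigma$. If $B=\{x\in G\mid\sigma(h)=\sigma(x^{-1}hx)\text{ for all }h\in H\cap xHx^{-1}\}$ is a group, then $C^*(\mathcal{H}_\sigma(G_\sigma,H_\sigma))=p_\sigma C^*(B_\sigma)p_\sigma$, where $B_\sigma$ is the closure of $B$ in $G_\sigma$.
   Context: A Hecke pair $(G,H)$ is a group $G$ with a subgroup $H$ such that $[H:H\cap xHx^{-1}]<\infty$ for all $x\in G$. The Hecke topology from $(G,H)$ is the group topology on $G$ with $\{xHx^{-1}\mid x\in G\}$ as neighbourhood subbase at $e$; the pair is reduced if $\bigcap_{x\in G}xHx^{-1}=\{e\}$. The Schlichting completion of a reduced Hecke pair consists of the completion of $G$ in the Hecke topology (locally compact, totally disconnected) and the closure of the subgroup in it (compact open). A $1$-dimensional Hecke triple $(G,H,\sigma)$ is a Hecke pair $(G,H)$ with a unitary character $\sigma:H\to\mathbb{T}$ with finite range; $K=\ker\sigma$; it is reduced if the Hecke pair $(G,K)$ is. Its Schlichting completion $(G_\sigma,H_\sigma,\sigma)$: $(G_\sigma,K_\sigma)$ is the Schlichting completion of $(G,K)$, $H_\sigma$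 is the closure of $H$ in $G_\sigma$ (compact open), and $\sigma$ denotes also the unique continuous extension to $H_\sigma$. Haar measure on $G_\sigma$ is normalised so that $H_\sigma$ has measure $1$; $p_\sigma=\chi_{H_\sigma}\sigma$ is a projection in $C_c(G_\sigma)$. $\mathcal{H}_\sigma(G_\sigma,H_\sigma)$ is the $*$-algebra $\{f\in C_c(G_\sigma)\mid f(hxk)=\sigma(h)f(x)\sigma(k)\ \forall h,k\in H_\sigma,x\in G_\sigma\}=p_\sigma C_c(G_\sigma)p_\sigma$ with the convolution and involution $f^*(x)=\Delta(x^{-1})\overline{f(x^{-1})}$ of $C_c(G_\sigma)$. The set $B_\sigma$ equals $\{x\in G_\sigma\mid\sigma(h)=\sigma(x^{-1}hx)\ \forall h\in H_\sigma\cap xH_\sigma x^{-1}\}$, which is open and closed and contains $H_\sigma$; when $B$ is a group so is $B_\sigma$, and then $\mathcal{H}_\sigma(G_\sigma,H_\sigma)=p_\sigma C_c(B_\sigma)p_\sigma$. $C^*(\mathcal{A})$ denotes the enveloping (largest) $C^*$-completion of a $*$-algebra $\mathcal{A}$, when it exists; the asserted equalities include that it exists and mean that the inclusion of $\mathcal{H}_\sigma(G_\sigma,H_\sigma)$ in the stated corner realises it. *)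

(* Defs.v *)
From HB Require Import structures.
From mathcomp Require Import all_boot all_order all_algebra.
From mathcomp Require Import complex.
From mathcomp Require Import all_classical all_reals all_analysis.

Set Implicit Arguments.
Unset Strict Implicit.
Unset Printing Implicit Defensive.

Import Order.TTheory GRing.Theory Num.Theory.
Import numFieldNormedType.Exports.

Local Open Scope classical_set_scope.
Local Open Scope ring_scope.
Local Open Scope complex_scope.

(* Complex numbers are R[i] over R : realType; its library norm takes values
   in R[i] itself, whence this real-valued modulus. *)
Definition cabs (R : realType) (z : R[i]) : R := complex.Re `|z|.

(* The base point is only there because Borel measures need a pointedType. *)
HB.mixin Record isTopGroup G of PointedTopological G & Group G := {
  mulg_continuous : continuous (fun xy : G * G => (xy.1 * xy.2)%g) ;
  invg_continuous : continuous (fun x : G => (x^-1)%g) }.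

#[short(type="topGroupType")]
HB.structure Definition TopGroup :=
  {G of isTopGroup G & PointedTopological G & Group G}.

(* Complex C*-algebras, not necessarily unital: this is why the product is not
   that of an algType. *)
HB.mixin Record isCStarAlgebra (R : realType) A
    of CompleteNormedModule R[i] A := {
  cmul : A -> A -> A ;
  cstar : A -> A ;
  cmulA : associative cmul ;
  cmulDl : left_distributive cmul +%R ;
  cmulDr : right_distributive cmul +%R ;
  cmulZl : forall (a : R[i]) (x y : A), cmul (a *: x) y = a *: cmul x y ;
  cmulZr : forall (a : R[i]) (x y : A), cmul x (a *: y) = a *: cmul x y ;
  cstarK : involutive cstar ;
  cstarD : {morph cstar : x y / x + y} ;
  cstarZ : forall (a : R[i]) (x : A), cstar (a *: x) = a^* *: cstar x ;
  cstarM : forall x y : A, cstar (cmul x y) = cmul (cstar y) (cstar x) ;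
  cmul_norm : forall x y : A, `|cmul x y| <= `|x| * `|y| ;
  cstar_identity : forall x : A, `|cmul (cstar x) x| = `|x| ^+ 2 }.

#[short(type="cstarAlgType")]
HB.structure Definition CStarAlgebra (R : realType) :=
  {A of isCStarAlgebra R A & CompleteNormedModule R[i] A}.

Section StarAlgebras.
Context (R : realType).

Record cstar_subalgebra (A : cstarAlgType R) (S : set A) : Prop := {
  csub_closed : closed S ;
  csub0 : S 0 ;
  csubD : forall x y, S x -> S y -> S (x + y) ;
  csubZ : forall (a : R[i]) x, S x -> S (a *: x) ;
  csubM : forall x y, S x -> S y -> S (cmul x y) ;
  csub_star : forall x, S x -> S (cstar x) }.

Definition corner (A : cstarAlgType R) (p : A) : set A :=
  [set cmul p (cmul a p) | a in [set: A]].

(* A *-algebra is given as a subset F of a complex vector space V on which the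
   operations mul and star are those of a *-algebra; nothing is required of
   them outside F. *)
Context (V : lmodType R[i]).
Variables (F : set V) (mul : V -> V -> V) (star : V -> V).

Record star_hom (A : cstarAlgType R) (iota : V -> A) : Prop := {
  star_homD : forall f g, F f -> F g -> iota (f + g) = iota f + iota g ;
  star_homZ : forall (a : R[i]) f, F f -> iota (a *: f) = a *: iota f ;
  star_homM : forall f g, F f -> F g ->
    iota (mul f g) = cmul (iota f) (iota g) ;
  star_homS : forall f, F f -> iota (star f) = cstar (iota f) }.

Record cstar_seminorm (gam : V -> R) : Prop := {
  csemi_ge0 : forall f, F f -> 0 <= gam f ;
  csemiD : forall f g, F f -> F g -> gam (f + g) <= gam f + gam g ;
  csemiZ : forall (a : R[i]) f, F f -> gam (a *: f) = cabs a * gam f ;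
  csemiM : forall f g, F f -> F g -> gam (mul f g) <= gam f * gam g ;
  csemi_star : forall f, F f -> gam (mul (star f) f) = gam f ^+ 2 }.

(* The C*-subalgebra S of A is a C*-completion of F through iota. *)
Record cstar_completion (A : cstarAlgType R) (S : set A) (iota : V -> A)
    : Prop := {
  ccompl_subalgebra : cstar_subalgebra S ;
  ccompl_hom : star_hom iota ;
  ccompl_inj : {in F &, injective iota} ;
  ccompl_sub : iota @` F `<=` S ;
  ccompl_dense : S `<=` closure (iota @` F) }.

(* S is the enveloping C*-algebra of F: the norm of the completion is the
   largest C*-seminorm on F.  In particular that largest seminorm exists. *)
Definition enveloping_cstar (A : cstarAlgType R) (S : set A) (iota : V -> A)
    : Prop :=
  cstar_completion S iota /\
  forall gam, cstar_seminorm gam -> forall f, F f -> (gam f)%:C <= `|iota f|.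

End StarAlgebras.

Section GroupAlgebras.
Context (R : realType) (G : topGroupType).

Local Notation borel := (g_sigma_algebraType (@open G)).

Record haar_measure (mu : {measure set borel -> \bar R}) : Prop := {
  haar_left_invariant : forall (x : G) (E : set borel), measurable E ->
    mu [set (x * y)%g | y in E] = mu E ;
  haar_compact : forall K : set G, compact K -> (mu K < +oo)%E ;
  haar_outer_regular : forall E : set borel, measurable E ->
    mu E = ereal_inf [set mu U | U in [set U : set G | open U /\ E `<=` U]] ;
  haar_inner_regular : forall U : set G, open U ->
    mu U = ereal_sup [set mu K | K in [set K : set G | compact K /\ K `<=` U]] ;
  haar_nonzero : mu [set: G] <> 0%E }.

Definition modular_function (mu : {measure set borel -> \bar R}) (Delta : G -> R)
    : Prop :=
  (forall x, 0 < Delta x) /\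
  forall (x : G) (E : set borel), measurable E ->
    mu [set (y * x)%g | y in E] = ((Delta x)%:E * mu E)%E.

Variables (mu : {measure set borel -> \bar R}) (Delta : G -> R).

Definition cintegral (f : G -> R[i]) : R[i] :=
  Rintegral mu [set: borel] (fun x => complex.Re (f x)) +i*
  Rintegral mu [set: borel] (fun x => complex.Im (f x)).

Definition convolution (f g : G -> R[i]) : G -> R[i] :=
  fun x => cintegral (fun y => f y * g (y^-1 * x)%g).

Definition involution (f : G -> R[i]) : G -> R[i] :=
  fun x => (Delta (x^-1)%g)%:C * (f (x^-1)%g)^*.

Definition L1norm (f : G -> R[i]) : R :=
  Rintegral mu [set: borel] (fun x => cabs (f x)).

(* For a clopen subgroup D, this is C_c(D), embedded in C_c(G) by extending
   functions by zero; D = setT gives C_c(G). *)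
Definition Cc (D : set G) : set (G -> R[i]) :=
  [set f | [/\ continuous (f : G -> R[i]^o),
               compact (closure [set x | f x != 0]) &
               forall x, ~ D x -> f x = 0]].

(* For a clopen subgroup D, with the restriction of mu as Haar measure: A is
   the group C*-algebra C*(D), i.e. the enveloping C*-algebra of L^1(D).  Since
   C_c(D) is dense in L^1(D), and C*-seminorms on a Banach *-algebra are
   dominated by its norm, A is the completion of C_c(D) in the largest
   C*-seminorm dominated by the L^1-norm. *)
Definition group_cstar (D : set G) (A : cstarAlgType R)
    (iota : (G -> R[i]) -> A) : Prop :=
  [/\ cstar_completion (Cc D) convolution involution [set: A] iota,
      forall f, Cc D f -> `|iota f| <= (L1norm f)%:C &
      forall gam, cstar_seminorm (Cc D) convolution involution gam ->
        (forall f, Cc D f -> gam f <= L1norm f) ->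
        forall f, Cc D f -> (gam f)%:C <= `|iota f|].

(* In the two definitions below only the values of sigma on H matter. *)
Definition sigma_projection (H : set G) (sigma : G -> R[i]) : G -> R[i] :=
  fun x => if x \in H then sigma x else 0.

Definition hecke_algebra (H : set G) (sigma : G -> R[i]) : set (G -> R[i]) :=
  [set f | Cc [set: G] f /\
    forall h k x, H h -> H k -> f (h * x * k)%g = sigma h * f x * sigma k].

End GroupAlgebras.

Section HeckeTriples.
Context (G : groupType).

Definition is_subgroup (H : set G) : Prop := group_closed (mem H).

Definition normal_subgroup (N : set G) : Prop :=
  is_subgroup N /\ forall g n, N n -> N (g * n * g^-1)%g.

Definition normal_in (H N : set G) : Prop :=
  [/\ is_subgroup H, H `<=` N &
      forall n h, N n -> H h -> H (n * h * n^-1)%g].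

Definition conj_set (x : G) (H : set G) : set G :=
  [set (x * h * x^-1)%g | h in H].

Definition finite_index (H L : set G) : Prop :=
  finite_set [set [set (h * l)%g | l in L] | h in H].

Definition hecke_pair (H : set G) : Prop :=
  is_subgroup H /\ forall x, finite_index H (H `&` conj_set x H).

Definition reduced (H : set G) : Prop :=
  \bigcap_(x in [set: G]) conj_set x H = [set 1%g].

(* The open sets of the Hecke topology of (G, H): the sets conj_set x H form a
   subbase of neighbourhoods of 1, translated to any g. *)
Definition hecke_open (H : set G) (O : set G) : Prop :=
  forall g, O g -> exists xs : seq G,
    forall k, (forall x, x \in xs -> conj_set x H k) -> O (g * k)%g.

Context (R : realType).

Definition char_kernel (H : set G) (sigma : G -> R[i]) : set G :=
  [set h | H h /\ sigma h = 1].

(* sigma is a character of H; its values outside H are irrelevant. *)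
Record hecke_triple (H : set G) (sigma : G -> R[i]) : Prop := {
  htriple_pair : hecke_pair H ;
  htriple_mul : forall h k, H h -> H k -> sigma (h * k)%g = sigma h * sigma k ;
  htriple_unitary : forall h, H h -> `|sigma h| = 1 ;
  htriple_finite : finite_set (sigma @` H) }.

Definition reduced_hecke_triple (H : set G) (sigma : G -> R[i]) : Prop :=
  hecke_triple H sigma /\ reduced (char_kernel H sigma).

Definition B_set (H : set G) (sigma : G -> R[i]) : set G :=
  [set x | forall h, (H `&` conj_set x H) h -> sigma h = sigma (x^-1 * h * x)%g].

Variable Gs : topGroupType.

(* Completeness for the two-sided uniformity. *)
Definition complete_group : Prop :=
  forall Fi : set_system Gs, ProperFilter Fi ->
    (forall U : set Gs, nbhs 1%g U -> exists2 S, Fi S &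
       forall x y, S x -> S y -> U (x^-1 * y)%g /\ U (y * x^-1)%g) ->
    exists x : Gs, Fi --> x.

(* Gs is the Hausdorff completion, through j, of G with the Hecke topology of
   (G, K). *)
Record hecke_completion (K : set G) (j : G -> Gs) : Prop := {
  hcompl_hausdorff : hausdorff_space Gs ;
  hcompl_complete : complete_group ;
  hcompl_morph : {morph j : x y / (x * y)%g} ;
  hcompl_inj : injective j ;
  hcompl_embedding : forall O : set G,
    hecke_open K O <-> exists2 W : set Gs, open W & O = j @^-1` W ;
  hcompl_dense : dense (range j) }.

(* Hs is the closure of H in Gs, and sigmas on Hs is the continuous extension
   of sigma. *)
Record schlichting_completion (H : set G) (sigma : G -> R[i])
    (j : G -> Gs) (Hs : set Gs) (sigmas : Gs -> R[i]) : Prop := {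
  schl_group : hecke_completion (char_kernel H sigma) j ;
  schl_closure : Hs = closure (j @` H) ;
  schl_extends : forall h, H h -> sigmas (j h) = sigma h ;
  schl_continuous : {within Hs, continuous (sigmas : Gs -> R[i]^o)} }.

End HeckeTriples.

(* Main.v *)
Require Import Defs.
From HB Require Import structures.
From mathcomp Require Import all_boot all_order all_algebra.
From mathcomp Require Import finmap complex.
From mathcomp Require Import all_classical all_reals all_analysis.
From mathcomp Require Import measurable_realfun.
From mathcomp Require Import ring lra.
From Stdlib Require Ncring Ncring_tac.

(** Fix D, either the whole of Gs or the closure of B, and let X be the space of
    the functions in C_c(D) that are right (H, sigma)-equivariant, a right module
    over the Hecke algebra p C_c(D) p with the inner product xi^* * eta.
    A C*-seminorm gam on the Hecke algebra gives a norm on X, hence an operator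
    norm on C_c(D) acting on X by convolution.  This is a C*-seminorm dominated
    by the L^1-norm, as left translations are isometries of X, and at least gam
    on the Hecke algebra, whose unit p lies in X.  So the norm of C*(D)
    dominates gam.

    All this rests on the positivity of xi^* * xi with respect to gam.  Since H
    is normal in N, N is normal and sigma is N-invariant, the projections
    x p x^-1 commute.  As xi is a combination of translates x p, removing from
    xi, one after the other, its components in the submodules generated by these
    translates leaves 0, and so xi^* * xi is a sum of h^* * h with h in the
    Hecke algebra.  Finally h^* * h is positive for any C*-seminorm, by
    Fukamiya's argument, run with approximate square roots since the algebra
    need not be complete. *)

Set Implicit Arguments.
Unset Strict Implicit.
Unset Printing Implicit Defensive.

Import Order.TTheory GRing.Theory Num.Theory.
Import numFieldNormedType.Exports.

Local Open Scope classical_set_scope.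
Local Open Scope ring_scope.
Local Open Scope complex_scope.

(** The product xi^* * xi lies in the Hecke algebra but xi in general does not, so its positivity
    there is not formal; this is where N enters. The closure M of N is normal, and translation by
    any z in M commutes with p. Conjugating by x, it commutes with x p x^-1 too; and y p y^-1 is an
    average of translations by elements of y H y^-1, which is contained in M. Hence the projections
    commute. Two devices reduce the analysis. Elements of X are left invariant under some open
    subgroup, so convolving f with them gives a finite combination of left translates, whose
    coefficients are integrals of f over parts of cosets. And identities between convolutions are
    mostly proved after applying [iota], which is injective and multiplicative on C_c(D):
    associativity and the laws of the involution are inherited from the C*-algebra, without
    interchanging integrals. *)

Section Modulus.
Variable R : realType.

Lemma conjE (z : R[i]) : Num.conj z = conjc z.
Proof. by []. Qed.

Lemma cabs_ge0 (z : R[i]) : 0 <= cabs z.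
Proof. by rewrite /cabs normc_def /= sqrtr_ge0. Qed.

Lemma cabsE (z : R[i]) : (cabs z)%:C = `|z|.
Proof. by rewrite /cabs normc_def. Qed.

Lemma cabs_real (r : R) : cabs r%:C = `|r|.
Proof. by rewrite /cabs normc_def /= expr0n addr0 sqrtr_sqr. Qed.

Lemma cabsM (x y : R[i]) : cabs (x * y) = cabs x * cabs y.
Proof. by apply: complexI; rewrite rmorphM /= !cabsE normrM. Qed.

Lemma cabs_conj (x : R[i]) : cabs (Num.conj x) = cabs x.
Proof. by rewrite conjE; case: x => a b; rewrite /cabs !normc_def /= sqrrN. Qed.

End Modulus.

(** * Positivity in C*-seminormed algebras *)

Section CStarSeminormedAlgebra.
Variables (R : realType) (T : algType R[i]) (star : T -> T) (gam : T -> R).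

(** Identities in [T] are noncommutative; these instances let [ncring] normalise both sides of such
    an identity. *)
#[local] Instance ncring_ops :
  @Ncring.Ring_ops T 0 1 +%R *%R (fun x y => x - y) -%R eq := {}.

#[local] Instance ncring : Ncring.Ring (Ro := ncring_ops).
Proof.
split; try by [ move=> ? ? -> ? ? -> | move=> ? ? -> | exact: add0r
  | exact: addrC | exact: addrA | exact: mul1r | exact: mulr1 | exact: mulrA
  | exact: mulrDl | move=> x y z; exact: mulrDr | exact: subrr
  | move=> x y | exact: RelationClasses.eq_equivalence ].
Qed.

Ltac ncring := rewrite ?mulr2n; Ncring_tac.non_commutative_ring.

Hypothesis starK : involutive star.
Hypothesis starD : {morph star : x y / x + y}.
Hypothesis starZ : forall (a : R[i]) x, star (a *: x) = a^* *: star x.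
Hypothesis starM : forall x y, star (x * y) = star y * star x.
Hypothesis gam_ge0 : forall x, 0 <= gam x.
Hypothesis gamD : forall x y, gam (x + y) <= gam x + gam y.
Hypothesis gamZ : forall (a : R[i]) x, gam (a *: x) = cabs a * gam x.
Hypothesis gamM : forall x y, gam (x * y) <= gam x * gam y.
Hypothesis gam_star : forall x, gam (star x * x) = gam x ^+ 2.

Definition selfadj (x : T) := star x = x.
Definition rsc (r : R) : T := r%:C%:A.

Lemma star0 : star 0 = 0.
Proof. by apply: (@addrI _ (star 0)); rewrite -starD !addr0. Qed.

Lemma starN x : star (- x) = - star x.
Proof. by apply/eqP; rewrite -addr_eq0 -starD addNr star0. Qed.

Lemma star1 : star 1 = 1.
Proof. by rewrite -[LHS]mul1r -{1}[1]starK -starM mul1r starK. Qed.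

Lemma rscD r s : rsc (r + s) = rsc r + rsc s.
Proof. by rewrite /rsc rmorphD scalerDl. Qed.

Lemma rscN r : rsc (- r) = - rsc r.
Proof. by rewrite /rsc rmorphN scaleNr. Qed.

Lemma rscM r s : rsc (r * s) = rsc r * rsc s.
Proof. by rewrite /rsc rmorphM -scalerAl mul1r scalerA. Qed.

Lemma rsc1 : rsc 1 = 1. Proof. by rewrite /rsc scale1r. Qed.
Lemma rsc0 : rsc 0 = 0. Proof. by rewrite /rsc scale0r. Qed.
Lemma rsc_comm r x : rsc r * x = x * rsc r.
Proof. exact: comm_alg. Qed.
Lemma rscE r x : rsc r * x = r%:C *: x.
Proof. by rewrite /rsc -scalerAl mul1r. Qed.

Lemma selfadj_rsc r : selfadj (rsc r).
Proof. by rewrite /selfadj /rsc starZ conjE conjc_real star1. Qed.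
Lemma selfadjD x y : selfadj x -> selfadj y -> selfadj (x + y).
Proof. by rewrite /selfadj starD => -> ->. Qed.
Lemma selfadjN x : selfadj x -> selfadj (- x).
Proof. by rewrite /selfadj starN => ->. Qed.
Lemma selfadjB x y : selfadj x -> selfadj y -> selfadj (x - y).
Proof. by move=> ? ?; apply/selfadjD/selfadjN. Qed.
Lemma selfadjM x y : selfadj x -> selfadj y -> x * y = y * x -> selfadj (x * y).
Proof. by rewrite /selfadj starM => -> ->. Qed.
Lemma selfadj_starM x : selfadj (star x * x).
Proof. by rewrite /selfadj starM starK. Qed.

Lemma gam0 : gam 0 = 0.
Proof. by rewrite -(scale0r (0 : T)) gamZ (cabs_real 0) normr0 mul0r. Qed.

Lemma gamN x : gam (- x) = gam x.
Proof.
have -> : - x = (- 1)%:C *: x by rewrite rmorphN1 scaleN1r.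
by rewrite gamZ cabs_real normrN normr1 mul1r.
Qed.

Lemma gamB x y : gam (x - y) <= gam x + gam y.
Proof. by apply: le_trans (gamD _ _) _; rewrite gamN. Qed.

Lemma gam_distC x y : gam (x - y) = gam (y - x).
Proof. by rewrite -gamN opprB. Qed.

Lemma gam_leD x y a b : gam x <= a -> gam y <= b -> gam (x + y) <= a + b.
Proof. by move=> ? ?; apply: le_trans (gamD _ _) _; apply: lerD. Qed.

Lemma gam_leM x y a b : gam x <= a -> gam y <= b -> gam (x * y) <= a * b.
Proof. by move=> ? ?; apply: le_trans (gamM _ _) _; apply: ler_pM. Qed.

Lemma gam1 : gam 1 <= 1.
Proof.
have := gam_star 1; rewrite star1 mul1r => h; have := gam_ge0 1.
by case: (ltrP 1 (gam 1)) => // h1 _; have := h1; nra.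
Qed.

Lemma gam_rsc r : gam (rsc r) <= `|r|.
Proof. by rewrite /rsc gamZ cabs_real ler_piMr // gam1. Qed.

Lemma gam_sq x : selfadj x -> gam (x * x) = gam x ^+ 2.
Proof. by move=> h; rewrite -{1}h gam_star. Qed.

Lemma gam_starE x : gam (star x) = gam x.
Proof.
have le y : gam y <= gam (star y).
  case: (ltrP (gam (star y)) (gam y)) => // h.
  have := gamM (star y) y; rewrite gam_star expr2.
  have := gam_ge0 (star y); nra.
by apply/eqP; rewrite eq_le le -{2}[x]starK le.
Qed.

(** In a C*-algebra this says that the spectrum of x lies in [0, 2M]. It expresses positivity by the
    norm alone, which suits a seminorm on an algebra that need not be complete. *)
Definition pos (x : T) := selfadj x /\ exists M, gam (rsc M - x) <= M.

(** As v and w commute, u = v + i w satisfies u^* u = v^2 + w^2, and v is the real part of u, so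
    that gam v <= gam u. This stands in for the order on squares until positivity is available. *)
Lemma comm_sq_le v w : selfadj v -> selfadj w -> v * w = w * v ->
  gam (v * v) <= gam (v * v + w * w).
Proof.
move=> sv sw vw; pose u := v + 'i%C *: w.
have su : star u = v - 'i%C *: w.
  by rewrite /u starD sv starZ sw -scaleNr; congr (_ + _ *: _); rewrite conjE; simpc.
have ii : 'i%C * 'i%C = -1 :> R[i] by rewrite -expr2 sqr_i.
have uu : star u * u = v * v + w * w.
  rewrite su /u mulrDr !mulrDl !mulNr -!scalerAl -!scalerAr scalerA ii scaleN1r.
  by rewrite vw opprK addrACA addrA; congr (_ + _); rewrite addrAC subrK.
have h : gam v <= gam u.
  have -> : v = (2%:R^-1 : R)%:C *: (u + star u).
    have -> : u + star u = (1 + 1) *: v.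
      by rewrite su /u addrACA subrr addr0 scalerDl scale1r.
    by rewrite scalerA fmorphV rmorph_nat mulVf ?scale1r // pnatr_eq0.
  rewrite gamZ cabs_real ger0_norm ?invr_ge0 ?ler0n //.
  have := gamD u (star u); rewrite gam_starE; lra.
rewrite -uu gam_star gam_sq // !expr2; have := gam_ge0 v; nra.
Qed.

(* The limit y solves (1 - y)^2 = 1 - s. *)
Fixpoint sqrt_iter (s : T) n : T :=
  if n is m.+1 then rsc (2^-1) * (s + sqrt_iter s m * sqrt_iter s m) else 0.

Lemma sqrt_iter_comm s z n : s * z = z * s ->
  sqrt_iter s n * z = z * sqrt_iter s n.
Proof.
move=> sz; elim: n => [|n IH] /=; first by rewrite mul0r mulr0.
rewrite -mulrA [z * _]mulrA -rsc_comm -mulrA; congr (_ * _).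
by rewrite mulrDl mulrDr sz -mulrA IH !mulrA IH.
Qed.

Lemma selfadj_sqrt_iter s n : selfadj s -> selfadj (sqrt_iter s n).
Proof.
move=> hs; elim: n => [|n IH] /=; first exact: star0.
apply: selfadjM (rsc_comm _ _); first exact: selfadj_rsc.
by apply: selfadjD => //; apply: selfadjM.
Qed.

Lemma gam_sqrt_iter s n r : r <= 1 -> gam s <= r -> gam (sqrt_iter s n) <= r.
Proof.
move=> r1 hs; have := gam_ge0 s => g0; elim: n => [|n IH] /=.
  by rewrite gam0; lra.
rewrite rscE gamZ cabs_real ger0_norm ?invr_ge0 ?ler0n //.
have := gamD s (sqrt_iter s n * sqrt_iter s n).
have := gamM (sqrt_iter s n) (sqrt_iter s n).
have := gam_ge0 (sqrt_iter s n); nra.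
Qed.

(** Iterates commute, so the next difference is half of (y - x)(y + x), and gam (y + x) <= 2 r:
    differences contract by the factor r. *)
Lemma sqrt_iter_diff s n r : r <= 1 -> gam s <= r ->
  gam (sqrt_iter s n.+1 - sqrt_iter s n) <= r ^+ n.+1.
Proof.
move=> r1 hs; have g0 := gam_ge0 s; elim: n => [|n IH].
  rewrite /= mul0r addr0 subr0 rscE gamZ cabs_real.
  by rewrite ger0_norm ?invr_ge0 ?ler0n // expr1; lra.
set y := sqrt_iter s n.+1; set x := sqrt_iter s n in IH *.
have xy : x * y = y * x.
  have h m : sqrt_iter s m * s = s * sqrt_iter s m by apply: sqrt_iter_comm.
  by rewrite /x; apply: sqrt_iter_comm; rewrite /y h.
have -> : sqrt_iter s n.+2 - y = rsc (2^-1) * ((y - x) * (y + x)).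
  have -> : (y - x) * (y + x) = (s + y * y) - (s + x * x).
    by rewrite mulrDr !mulrBl xy; ncring.
  by rewrite mulrBr.
rewrite rscE gamZ cabs_real ger0_norm ?invr_ge0 ?ler0n //.
have hy : gam y <= r by apply: gam_sqrt_iter.
have hx : gam x <= r by apply: gam_sqrt_iter.
have h := gam_leM IH (le_trans (gamD y x) (lerD hy hx)).
rewrite exprSr; move: h; rewrite mulrDr; lra.
Qed.

(** Put s = (1 - d)(1 - x/M), of norm at most 1 - d < 1, so that the iteration converges
    geometrically. Then M(1 - s) = x + d(M - x) is close to x, and w is sqrt M times an approximate
    root of 1 - s. Being a polynomial in x, w commutes with whatever commutes with x. *)
Lemma pos_approx_sqrt x (e : R) : pos x -> 0 < e -> exists w, [/\ pos w,
  gam (x - w * w) <= e & forall z, x * z = z * x -> w * z = z * w].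
Proof.
case=> sx [M0 hM0] e0; have M00 := le_trans (gam_ge0 _) hM0.
(* [M0] may be 0, and M is a divisor below. *)
pose M := M0 + 1; have M_gt0 : 0 < M by rewrite /M; lra.
have hM : gam (rsc M - x) <= M.
  rewrite /M rscD addrAC; apply: gam_leD hM0 _.
  by apply: le_trans (gam_rsc _) _; rewrite normr1.
have [d d01 hd] : exists2 d : R, 0 < d < 1 & d * M <= e / 2.
  exists (Num.min (2^-1) (e / 2 / M)).
    by rewrite lt_min gt_min invf_lt1 ?ltr1n // invr_gt0 ltr0n /= !divr_gt0.
  by rewrite -ler_pdivlMr // ge_min lexx orbT.
have /andP[d0 d1] := d01.
pose s := rsc ((1 - d) / M) * (rsc M - x).
have s1 : gam s <= 1 - d.
  rewrite /s rscE gamZ cabs_real ger0_norm ?divr_ge0 //; [|lra..].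
  by rewrite mulrAC ler_pdivrMr // ler_pM2l //; lra.
have ss : selfadj s.
  apply: selfadjM (rsc_comm _ _); first exact: selfadj_rsc.
  by apply: selfadjB => //; exact: selfadj_rsc.
have [n hn] : exists n, (1 - d) ^+ n.+1 * (2 * M) <= e / 2.
  have : (1 - d) ^+ n @[n --> \oo] --> 0.
    by apply: cvg_expr; rewrite ger0_norm; lra.
  have e1 : 0 < e / 2 / (2 * M) by rewrite !divr_gt0 // mulr_gt0.
  move/cvgrPdist_lt => /(_ _ e1)[n _ hn]; exists n.
  have := hn n.+1 (leqnSn n).
  rewrite /= sub0r normrN ger0_norm ?exprn_ge0 //; last lra.
  by rewrite ltr_pdivlMr ?mulr_gt0 // => /ltW.
pose y := sqrt_iter s n; pose q := Num.sqrt M.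
have qq : q * q = M by rewrite -expr2 sqr_sqrtr // ltW.
have ys : selfadj y by apply: selfadj_sqrt_iter.
have y1 : gam y <= 1.
  by apply: gam_sqrt_iter; lra.
exists (rsc q * (1 - y)); split.
- split.
    apply: selfadjM (rsc_comm _ _); first exact: selfadj_rsc.
    by apply: selfadjB => //; rewrite -rsc1; exact: selfadj_rsc.
  exists q; rewrite -{1}[rsc q]mulr1 -mulrBr opprB addrCA subrr addr0.
  rewrite rscE gamZ cabs_real ger0_norm ?sqrtr_ge0 //.
  by rewrite ler_piMr // sqrtr_ge0.
(* (1 - y)^2 - (1 - s) is twice the next increment of the iteration; the term in d is the cost of
   shrinking s. *)
- have -> : x - rsc q * (1 - y) * (rsc q * (1 - y)) =
      rsc (2 * M) * (y - sqrt_iter s n.+1) - rsc d * (rsc M - x).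
    have Ms : rsc M * s = rsc M - x - rsc d * (rsc M - x).
      rewrite mulrA -rscM mulrCA divff ?gt_eqF // mulr1 rscD rscN rsc1.
      by rewrite mulrBl mul1r.
    have -> : rsc (2 * M) * (y - sqrt_iter s n.+1) =
        rsc M * (y + y) - rsc M * s - rsc M * (y * y).
      rewrite -[sqrt_iter s n.+1]/(rsc (2^-1) * (s + y * y)) mulrBr.
      rewrite [X in _ - X]mulrA -rscM mulrAC divff ?pnatr_eq0 // mul1r.
      by rewrite mulr_natl mulr2n rscD; ncring.
    have -> : rsc q * (1 - y) * (rsc q * (1 - y)) = rsc M * ((1 - y) * (1 - y)).
      by rewrite [RHS]mulrA -qq rscM -!mulrA [(1 - y) * _]mulrA -rsc_comm !mulrA.
    by rewrite Ms; ncring.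
  apply: le_trans (gamB _ _) _; rewrite !rscE !gamZ !cabs_real.
  rewrite !ger0_norm ?mulr_ge0 //; [|lra..].
  have h : gam (y - sqrt_iter s n.+1) <= (1 - d) ^+ n.+1.
    by rewrite gam_distC; apply: sqrt_iter_diff => //; lra.
  have := ler_wpM2l (ltW d0) hM; nra.
- move=> z xz; rewrite -mulrA [RHS]mulrA -[z * _]rsc_comm -[RHS]mulrA.
  congr (_ * _); rewrite mulrBl mulrBr mul1r mulr1; congr (_ - _).
  apply: sqrt_iter_comm; rewrite /s -mulrA [z * _]mulrA -rsc_comm -mulrA.
  by congr (_ * _); rewrite mulrBl mulrBr xz rsc_comm.
Qed.

(** M - s^2 has an approximate root w commuting with s, and w^2 + s^2 is nearly M, so [comm_sq_le]
    bounds w^2. This is what makes squares of selfadjoint elements positive. *)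
Lemma gam_rsc_sub_sq s M : selfadj s -> gam (s * s) <= M ->
  gam (rsc M - s * s) <= M.
Proof.
move=> ss hM; apply/ler_addgt0Pr => e e0.
have M0 := le_trans (gam_ge0 _) hM.
set x := rsc M - s * s.
have px : pos x.
  split; first by apply: selfadjB; [exact: selfadj_rsc | exact: selfadjM].
  by exists M; rewrite /x opprB addrCA subrr addr0.
have [|w [[sw _] hw cw]] := @pos_approx_sqrt x (e / 2) px; first lra.
have ws : w * s = s * w.
  by apply: cw; rewrite /x mulrBl mulrBr rsc_comm; ncring.
have h : gam (w * w) <= M + e / 2.
  apply: le_trans (comm_sq_le sw ss ws) _.
  have -> : w * w + s * s = rsc M - (x - w * w) by rewrite /x; ncring.
  apply: le_trans (gamB _ _) _; apply: lerD hw.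
  by apply: le_trans (gam_rsc _) _; rewrite ger0_norm.
have := gamD (x - w * w) (w * w); rewrite subrK; lra.
Qed.

(** Every bound of gam x can thus serve as the witness in [pos]: replace x by an approximate square
    and use the case of squares. *)
Lemma gam_rsc_sub_pos x M : pos x -> gam x <= M -> gam (rsc M - x) <= M.
Proof.
move=> px hM; apply/ler_addgt0Pr => e e0.
have [|w [[sw _] hw _]] := @pos_approx_sqrt x (e / 3) px; first lra.
have h : gam (w * w) <= M + e / 3.
  have -> : w * w = x - (x - w * w) by ncring.
  by apply: le_trans (gamB _ _) _; apply: lerD.
have -> : rsc M - x = (rsc (M + e / 3) - w * w) - rsc (e / 3) - (x - w * w).
  by rewrite rscD; ncring.
have h1 := gam_rsc_sub_sq sw h.
have h2 := gam_rsc (e / 3); rewrite ger0_norm in h2; last lra.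
apply: le_trans (gamB _ _) _; have := gamB (rsc (M + e / 3) - w * w) (rsc (e / 3)).
lra.
Qed.

Lemma pos_selfadj x : pos x -> selfadj x. Proof. by case. Qed.

Lemma pos_sq s : selfadj s -> pos (s * s).
Proof.
move=> ss; split; first exact: selfadjM.
by exists (gam (s * s)); apply: gam_rsc_sub_sq.
Qed.

Lemma posD x y : pos x -> pos y -> pos (x + y).
Proof.
case=> sx [M hM] [sy [M' hM']]; split; first exact: selfadjD.
exists (M + M'); rewrite rscD opprD addrACA; exact: gam_leD.
Qed.

Lemma pos_scale c x : 0 <= c -> pos x -> pos (rsc c * x).
Proof.
move=> c0 [sx [M hM]]; split.
  by apply: selfadjM (rsc_comm _ _); first exact: selfadj_rsc.
exists (c * M); rewrite rscM -mulrBr rscE gamZ cabs_real ger0_norm //.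
exact: ler_wpM2l.
Qed.

Lemma pos_rsc_sub x M : selfadj x -> gam x <= M -> pos (rsc M - x).
Proof.
move=> sx hM; split; first by apply: selfadjB; first exact: selfadj_rsc.
by exists M; rewrite opprB addrCA subrr addr0.
Qed.

(** Approximate roots v of x and w of M - x commute, and v^2 + w^2 is nearly M, so [comm_sq_le]
    applies to them. *)
Lemma gam_le_pos x M : 0 <= M -> pos x -> pos (rsc M - x) -> gam x <= M.
Proof.
move=> M0 px pMx; apply/ler_addgt0Pr => e e0.
have [|v [[sv _] hv cv]] := @pos_approx_sqrt x (e / 3) px; first lra.
have [|w [[sw _] hw cw]] := @pos_approx_sqrt _ (e / 3) pMx; first lra.
have xw : x * w = w * x.
  by rewrite [RHS]cw // mulrBl mulrBr rsc_comm.
have vw : v * w = w * v by apply: cv.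
have h : gam (v * v + w * w) <= M + e / 3 + e / 3.
  have -> : v * v + w * w = rsc M - (x - v * v) - (rsc M - x - w * w) by ncring.
  apply: le_trans (gamB _ _) _; apply: lerD hw.
  apply: le_trans (gamB _ _) _; apply: lerD hv.
  by apply: le_trans (gam_rsc _) _; rewrite ger0_norm.
have := comm_sq_le sv sw vw; have := gamD (x - v * v) (v * v); rewrite subrK; lra.
Qed.

Lemma gam_le_mono x y : pos x -> pos (y - x) -> gam x <= gam y.
Proof.
move=> px pyx; apply: gam_le_pos => //.
have -> : rsc (gam y) - x = (rsc (gam y) - y) + (y - x) by ncring.
apply: posD => //; apply: pos_rsc_sub => //.
have -> : y = x + (y - x) by ncring.
by apply: selfadjD; apply: pos_selfadj.
Qed.

Lemma pos_approx x : selfadj x ->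
  (forall e : R, 0 < e -> exists2 z, pos z & gam (x - z) <= e) -> pos x.
Proof.
move=> sx h; split => //; exists (gam x + 1); apply/ler_addgt0Pr => e e0.
have [|z pz hz] := h (Num.min e 1); first by rewrite lt_min e0 ltr01.
have [hz1 hz2] : gam (x - z) <= e /\ gam (x - z) <= 1.
  by move: hz; rewrite le_min => /andP[].
have g : gam z <= gam x + 1.
  have -> : z = x - (x - z) by ncring.
  by apply: le_trans (gamB _ _) _; apply: lerD.
have := gam_rsc_sub_pos pz g.
have -> : rsc (gam x + 1) - x = (rsc (gam x + 1) - z) - (x - z) by ncring.
have := gamB (rsc (gam x + 1) - z) (x - z); lra.
Qed.

(** With commuting approximate roots w of x and v of y, x y is close to (w v)^2. Each tolerance is
    divided by a bound on the other factor, increased by 1 so as not to vanish. *)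
Lemma pos_comm_mul x y : pos x -> pos y -> x * y = y * x -> pos (x * y).
Proof.
move=> px py xy; apply: pos_approx; first by apply: selfadjM => //; exact: pos_selfadj.
move=> e e0; pose B := gam y + 1; have B0 : 0 < B.
  by have := gam_ge0 y; rewrite /B; lra.
have [|w [[sw _] hw cw]] := @pos_approx_sqrt x (e / 2 / B) px.
  by rewrite divr_gt0 // divr_gt0.
pose C := gam (w * w) + 1; have C0 : 0 < C.
  by have := gam_ge0 (w * w); rewrite /C; lra.
have [|v [[sv _] hv cv]] := @pos_approx_sqrt y (e / 2 / C) py.
  by rewrite divr_gt0 // divr_gt0.
have wy := cw _ xy.
have vw : v * w = w * v by apply: cv.
exists ((w * v) * (w * v)); first by apply: pos_sq; apply: selfadjM.
have -> : w * v * (w * v) = w * w * (v * v).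
  by rewrite -mulrA [v * _]mulrA vw !mulrA.
have -> : x * y - w * w * (v * v) =
  (x - w * w) * y + w * w * (y - v * v) by ncring.
have h1 : gam y <= B by rewrite /B; lra.
have h2 : gam (w * w) <= C by rewrite /C; lra.
have := gam_leD (gam_leM hw h1) (gam_leM h2 hv).
rewrite mulfVK ?gt_eqF // mulrCA divff ?gt_eqF // mulr1; lra.
Qed.

(** Exponential growth beats linear growth. Only powers of 2 occur because norms of powers are
    computed by repeated squaring with the C*-identity. *)
Lemma exp_le_linear_le1 (t c : R) : 0 <= t ->
  (forall k, t ^+ (2 ^ k) <= 1 + (2 ^ k)%:R * c) -> t <= 1.
Proof.
move=> t0 h; case: (lerP t 1) => // t1; exfalso.
pose d := t - 1; have d0 : 0 < d by rewrite /d; lra.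
have c0 : 0 <= c.
  by have := h 0%N; rewrite expn0 expr1 mul1r; lra.
have [N hN] : exists N : nat, (1 + 2 * c) / d ^+ 2 < N%:R.
  exists (Num.truncn ((1 + 2 * c) / d ^+ 2)).+1; exact: truncnS_gt.
have {}hN : (1 + 2 * c) / d ^+ 2 < (2 ^ N)%:R.
  by apply: lt_le_trans hN _; rewrite ler_nat ltnW // ltn_expl.
set n := (2 ^ N)%N in hN.
have n1 : 1 <= n%:R :> R by rewrite ler1n expn_gt0.
have b : n%:R * d <= t ^+ n.
  have -> : t = 1 + d by rewrite /d addrC subrK.
  elim: (n) => [|m IH]; first by rewrite mul0r expr0.
  have : 1 <= (1 + d) ^+ m by apply: exprn_ege1; lra.
  by rewrite exprS -natr1; nra.
(* Bernoulli's inequality at n = 2^N, squared, contradicts the hypothesis at 2n. *)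
have := h N.+1; rewrite expnS mulnC exprM natrM -/n => hh.
move: hN; rewrite ltr_pdivrMr ?exprn_gt0 // => hN.
have nd0 : 0 <= n%:R * d by rewrite mulr_ge0 // ltW.
have : (n%:R * d) ^+ 2 <= (t ^+ n) ^+ 2 by rewrite lerXn2r // nnegrE exprn_ge0.
by move: hN hh; rewrite !expr2; nra.
Qed.

(* The spectra of y y^* and y^* y agree away from 0; the powers of
   m + y y^* are compared with those of m + y^* y. *)
Lemma gam_rsc_add_swap y m M : 0 <= m -> m <= M ->
  gam (rsc m + star y * y) <= M -> gam (rsc m + y * star y) <= M.
Proof.
move=> m0 mM h; have M0 := le_trans m0 mM.
set a := rsc m + star y * y in h; set b := rsc m + y * star y.
have sb : selfadj b.
  by apply: selfadjD; [exact: selfadj_rsc | rewrite -{1}[y]starK; exact: selfadj_starM].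
have ba n : b ^+ n * y = y * a ^+ n.
  elim: n => [|n IH]; first by rewrite !expr0 mulr1 mul1r.
  rewrite exprS -mulrA IH exprS !mulrA; congr (_ * _).
  by rewrite /a /b mulrDl mulrDr rsc_comm mulrA.
have bS n : b ^+ n.+1 = rsc m * b ^+ n + y * a ^+ n * star y.
  by rewrite exprSr {2}/b mulrDr -rsc_comm mulrA ba.
have ha n : gam (a ^+ n) <= M ^+ n.
  elim: n => [|n IH]; first by rewrite !expr0 gam1.
  by rewrite !exprS; apply: gam_leM.
have [M00|Mn0] := eqVneq M 0.
  have m00 : m = 0 by apply/eqP; rewrite eq_le m0 -M00 mM.
  have y0 : gam y = 0.
    move: h; rewrite /a m00 M00 rsc0 add0r gam_star.
    by have := sqr_ge0 (gam y) => h1 h2; apply/eqP; rewrite -sqrf_eq0 eq_le h2 h1.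
  apply: le_trans (_ : gam y * gam (star y) <= _).
    by rewrite /b m00 rsc0 add0r gamM.
  by rewrite y0 mul0r.
have Mp : 0 < M by rewrite lt_neqAle eq_sym Mn0.
(* By [bS], passing from b^n to b^(n+1) multiplies by at most M and adds at most gam y ^ 2 M^n = c
   M^(n+1). So b^n exceeds M^n by a factor at most linear in n, which [exp_le_linear_le1]
   removes. *)
pose c := gam y ^+ 2 / M.
have hb n : gam (b ^+ n) <= M ^+ n * (1 + n%:R * c).
  elim: n => [|n IH]; first by rewrite !expr0 mul0r addr0 mulr1 gam1.
  rewrite bS; apply: le_trans (gamD _ _) _.
  have h1 : gam (rsc m * b ^+ n) <= M * (M ^+ n * (1 + n%:R * c)).
    rewrite rscE gamZ cabs_real ger0_norm //.
    by apply: ler_pM.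
  have h2 : gam (y * a ^+ n * star y) <= gam y * M ^+ n * gam y.
    by apply: gam_leM; [apply: gam_leM | rewrite gam_starE].
  apply: le_trans (lerD h1 h2) _; rewrite exprS -natr1 /c.
  have -> : gam y * M ^+ n * gam y = M * M ^+ n * (gam y ^+ 2 / M) by field.
  by rewrite le_eqVlt; apply/orP; left; apply/eqP; ring.
suff : gam b / M <= 1 by rewrite ler_pdivrMr // mul1r.
apply: (@exp_le_linear_le1 _ c); first by rewrite divr_ge0.
move=> k; rewrite expr_div_n ler_pdivrMr ?exprn_gt0 // [X in _ <= X]mulrC.
apply: le_trans (hb _).
elim: k => [|k IH]; first by rewrite expn0 !expr1.
have sp n : selfadj (b ^+ n).
  elim: n => [|n IHn]; first by rewrite expr0; exact: star1.
  by rewrite exprS; apply: selfadjM => //; rewrite -exprS -exprSr.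
have -> : (2 ^ k.+1 = 2 ^ k + 2 ^ k)%N by rewrite expnS mul2n addnn.
by rewrite !exprD gam_sq // -expr2 lerXn2r // nnegrE ?exprn_ge0.
Qed.

(** The sum is twice the sum of the squares of the real and imaginary parts of y, which are
    selfadjoint. *)
Lemma pos_starM_add_Mstar y : pos (star y * y + y * star y).
Proof.
have -> : star y * y + y * star y = rsc (2^-1) *
  ((y + star y) * (y + star y) +
   ('i%C *: (y - star y)) * ('i%C *: (y - star y))).
  have ii : 'i%C * 'i%C = -1 :> R[i] by rewrite -expr2 sqr_i.
  have iz z : ('i%C *: z) * ('i%C *: z) = - (z * z) :> T.
    by rewrite -scalerAl -scalerAr scalerA ii scaleN1r.
  rewrite iz; set z := star y * y + _.
  have -> : (y + star y) * (y + star y) - (y - star y) * (y - star y) =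
    rsc (1 + 1) * z by rewrite rscD rsc1 /z; ncring.
  by rewrite mulrA -rscM mulVf ?pnatr_eq0 // rsc1 mul1r.
apply: pos_scale; first by rewrite invr_ge0 ler0n.
apply: posD; apply: pos_sq; rewrite /selfadj.
  by rewrite starD starK addrC.
rewrite starZ starD starN starK conjE -opprB scalerN -scaleNr.
by congr (_ *: _); simpc.
Qed.

(* Fukamiya's argument: if w is an approximate square root of (x^* x)^2, then
   y = x (w - x^* x) has both y^* y and y y^* almost negative, so that y, and
   hence w - x^* x, is almost 0. *)
Lemma pos_starM x : pos (star x * x).
Proof.
set s := star x * x; have ss : selfadj s by exact: selfadj_starM.
apply: pos_approx => // e e0.
(* The 7 anticipates gam (d^4) <= 7 eta gam d, where w d^2 contributes 4 eta and y^* y contributes 3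
   eta. *)
have [|w [pw hw cw]] := @pos_approx_sqrt (s * s) (e ^+ 2 / 7) (pos_sq ss).
  by rewrite divr_gt0 ?exprn_gt0.
have sw := pos_selfadj pw; exists w => //.
have ws : w * s = s * w by apply: cw; rewrite mulrA.
rewrite gam_distC; set d := w - s; have sd : selfadj d by apply: selfadjB.
have wd : w * d = d * w by rewrite /d mulrBl mulrBr ws.
have ds : d * s = s * d by rewrite /d mulrBl mulrBr ws.
pose f := (s * s - w * w) * d; pose eta := e ^+ 2 / 7 * gam d.
have eta0 : 0 <= eta by rewrite mulr_ge0 // divr_ge0 // exprn_ge0 // ltW.
have hf : gam f <= eta by apply: gam_leM.
have sf : selfadj f.
  apply: selfadjM => //; first by apply: selfadjB; apply: selfadjM.
  by apply/commr_sym/commrB; apply: commrM.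
pose y := x * d; have yy : star y * y = s * (d * d).
  rewrite /y starM sd /s !mulrA; congr (_ * _).
  by rewrite -[LHS]mulrA ds.
(* (w + s) d = w^2 - s^2 is almost 0, so y^* y = s d^2 is, up to the error f, the negative of w d^2,
   a product of commuting positive elements. *)
have wdd : - (star y * y) = w * (d * d) + f.
  rewrite yy /f.
  have -> : w * (d * d) = (w + s) * d * d - s * (d * d) by ncring.
  have -> : (w + s) * d = w * w - s * s.
    by rewrite /d mulrBr !mulrDl ws; ncring.
  ncring.
have pwdd : pos (w * (d * d)).
  by apply: pos_comm_mul => //; [exact: pos_sq | rewrite mulrA wd -mulrA wd mulrA].
have p1 : pos (rsc eta - star y * y).
  rewrite wdd addrCA; apply: posD => //; rewrite -[f]opprK.
  by apply: pos_rsc_sub; [exact: selfadjN | rewrite gamN].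
have p2 : pos (rsc eta - y * star y).
  (* The shift by m brings m + y^* y, of norm at most m + eta, into the scope of [gam_rsc_add_swap],
     which carries the bound over to m + y y^*. *)
  pose m := gam y ^+ 2; have m0 : 0 <= m by exact: sqr_ge0.
  have -> : rsc eta - y * star y = rsc (m + eta) - (rsc m + y * star y).
    by rewrite rscD; ncring.
  apply: pos_rsc_sub.
    by apply: selfadjD; [exact: selfadj_rsc | rewrite -{1}[y]starK; exact: selfadj_starM].
  apply: gam_rsc_add_swap => //; first by rewrite lerDl.
  have -> : rsc m + star y * y = rsc (m + eta) - (rsc eta - star y * y).
    by rewrite rscD; ncring.
  apply: gam_rsc_sub_pos => //; apply: le_trans (gamB _ _) _.
  rewrite gam_star -/m [X in _ <= X]addrC lerD2r.
  by apply: le_trans (gam_rsc _) _; rewrite ger0_norm.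
have hz : gam (rsc eta + star y * y) <= eta + eta.
  apply: gam_le_pos; first exact: addr_ge0.
    have -> : rsc eta + star y * y =
      (star y * y + y * star y) + (rsc eta - y * star y) by ncring.
    by apply: posD => //; exact: pos_starM_add_Mstar.
  by have -> : rsc (eta + eta) - (rsc eta + star y * y) = rsc eta - star y * y
    by rewrite rscD; ncring.
have hyy : gam (star y * y) <= 3 * eta.
  have -> : star y * y = (rsc eta + star y * y) - rsc eta by ncring.
  apply: le_trans (gamB _ _) _.
  by have := gam_rsc eta; rewrite ger0_norm //; lra.
have hd : gam ((d * d) * (d * d)) <= 7 * eta * gam d.
  have -> : d * d * (d * d) = (w * (d * d) - star y * y) * d.
    by rewrite yy -mulrBl -/d; ncring.
  apply: gam_leM => //; apply: le_trans (gamB _ _) _.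
  have -> : w * (d * d) = - (star y * y) - f by rewrite wdd addrK.
  by have := gamB (- (star y * y)) f; rewrite gamN; lra.
have {hd} : gam d ^+ 2 * gam d ^+ 2 <= e ^+ 2 * gam d ^+ 2.
  move: hd; rewrite gam_sq; last exact: selfadjM.
  rewrite gam_sq // -expr2 => /le_trans; apply.
  by rewrite /eta le_eqVlt; apply/orP; left; apply/eqP; field.
have [->|dn0] := eqVneq (gam d) 0; first by move=> _; exact: ltW.
have dp : 0 < gam d by rewrite lt_neqAle eq_sym dn0 gam_ge0.
rewrite ler_pM2r ?exprn_gt0 // => h.
by rewrite -(@ler_pXn2r _ 2) // nnegrE // ltW.
Qed.

(** For an approximate root w of b, the element a^* b a is close to (w a)^* (w a), positive by
    [pos_starM]. *)
Lemma pos_conj a b : pos b -> pos (star a * b * a).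
Proof.
move=> pb; apply: pos_approx.
  by rewrite /selfadj !starM starK (pos_selfadj pb) mulrA.
move=> e e0; pose B := gam a ^+ 2 + 1; have B0 : 0 < B.
  by have := sqr_ge0 (gam a); rewrite /B; lra.
have [|w [pw hw _]] := @pos_approx_sqrt b (e / B) pb; first by rewrite divr_gt0.
exists (star (w * a) * (w * a)); first exact: pos_starM.
rewrite starM (pos_selfadj pw).
have -> : star a * b * a - star a * w * (w * a) = star a * (b - w * w) * a.
  by ncring.
have h : gam (star a) <= gam a by rewrite gam_starE.
apply: le_trans (gam_leM (gam_leM h hw) (lexx _)) _.
by rewrite mulrAC -expr2 mulrA ler_pdivrMr // mulrC ler_pM2l // /B lerDl.
Qed.

(* Cauchy-Schwarz, for a = <h, k>, b = <h, h> and c = <k, k> in a pre-Hilbert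
   module: the hypothesis is the positivity of the inner square of
   t k - h a. *)
Lemma gam_cauchy_schwarz a b c : pos b ->
  (forall t : R, pos (rsc (t * t) * c - rsc (t + t) * (star a * a) +
     star a * b * a)) ->
  gam a ^+ 2 <= gam b * gam c.
Proof.
move=> pb hp; apply/ler_addgt0Pr => e e0.
(* gam b may be 0 while t must be invertible; d is small enough for d gam c <= e. *)
pose d := e / (gam c + 1); have d0 : 0 < d.
  by rewrite divr_gt0 //; have := gam_ge0 c; lra.
pose t := gam b + d; have t0 : 0 < t by rewrite ltr_wpDl.
have h1 : pos (star a * (rsc t - b) * a).
  apply/pos_conj/pos_rsc_sub; first exact: pos_selfadj.
  by rewrite /t lerDl ltW.
(* As b <= t, the term a^* b a is absorbed by one of the two copies of t a^* a; dividing by t then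
   leaves a^* a <= t c. *)
have h2 : pos (rsc (t * t) * c - rsc t * (star a * a)).
  have -> : rsc (t * t) * c - rsc t * (star a * a) =
     (rsc (t * t) * c - rsc (t + t) * (star a * a) + star a * b * a) +
     star a * (rsc t - b) * a.
    by rewrite rscD mulrBr -[star a * rsc t]rsc_comm; ncring.
  exact: posD.
have h3 : pos (rsc t * c - star a * a).
  have tn : t != 0 by rewrite gt_eqF.
  have -> : rsc t * c - star a * a =
    rsc t^-1 * (rsc (t * t) * c - rsc t * (star a * a)).
    by rewrite mulrBr !mulrA -!rscM mulrA mulVf // mul1r rsc1 mul1r.
  by apply: pos_scale => //; rewrite invr_ge0 ltW.
rewrite -gam_star; apply: le_trans (gam_le_mono (pos_starM a) h3) _.
rewrite rscE gamZ cabs_real gtr0_norm // mulrDl lerD2l /d mulrAC.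
rewrite ler_pdivrMr; last by have := gam_ge0 c; lra.
by rewrite ler_pM2l // lerDl.
Qed.

End CStarSeminormedAlgebra.

(** * Positivity in a *-subalgebra with its own unit *)

Section UnitalStarSubalgebra.
Variables (R : realType) (A : cstarAlgType R) (S : set A) (e : A).
Hypotheses (S0 : S 0) (SD : forall x y, S x -> S y -> S (x + y)).
Hypothesis SZ : forall (a : R[i]) x, S x -> S (a *: x).
Hypothesis SM : forall x y, S x -> S y -> S (cmul x y).
Hypothesis Sstar : forall x, S x -> S (cstar x).
Hypotheses (Se : S e) (e0 : e != 0).
Hypotheses (ex : forall x, S x -> cmul e x = x) (xe : forall x, S x -> cmul x e = x).

Definition subalg_pred : {pred A} := fun a => `[< S a >].

Lemma subalg_predP a : reflect (S a) (a \in subalg_pred).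
Proof. exact: asboolP. Qed.

Lemma subalg_submod : submod_closed subalg_pred.
Proof.
split; first exact/subalg_predP.
by move=> a x y /subalg_predP hx /subalg_predP hy; apply/subalg_predP/SD => //; exact: SZ.
Qed.

HB.instance Definition _ := GRing.isSubmodClosed.Build _ _ subalg_pred subalg_submod.

(** The type makes S an [algType] with unit e, as the positivity theory requires, although A need
    not have a unit and e need not be one for A. *)
Definition subalg := {a : A | a \in subalg_pred}.
HB.instance Definition _ := SubType.on subalg.
HB.instance Definition _ := Choice.on subalg.
HB.instance Definition _ := [SubChoice_isSubLmodule of subalg by <:].

Lemma subalgP (x : subalg) : S (val x).
Proof. by apply/subalg_predP; exact: valP. Qed.

Definition subalg_of a (Sa : S a) : subalg := exist _ a (introT (subalg_predP a) Sa).

Definition subalg_mul (x y : subalg) := subalg_of (SM (subalgP x) (subalgP y)).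
Definition subalg_star (x : subalg) := subalg_of (Sstar (subalgP x)).

Lemma subalg_mulA : associative subalg_mul.
Proof. by move=> x y z; apply: val_inj; exact: cmulA. Qed.
Lemma subalg_mul1 : left_id (subalg_of Se) subalg_mul.
Proof. by move=> x; apply: val_inj; apply: ex; exact: subalgP. Qed.
Lemma subalg_mulr1 : right_id (subalg_of Se) subalg_mul.
Proof. by move=> x; apply: val_inj; apply: xe; exact: subalgP. Qed.
Lemma subalg_mulDl : left_distributive subalg_mul +%R.
Proof. by move=> x y z; apply: val_inj; exact: cmulDl. Qed.
Lemma subalg_mulDr : right_distributive subalg_mul +%R.
Proof. by move=> x y z; apply: val_inj; exact: cmulDr. Qed.
Lemma subalg1_neq0 : subalg_of Se != 0.
Proof. by rewrite -(inj_eq val_inj). Qed.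

HB.instance Definition _ := GRing.Zmodule_isNzRing.Build subalg
  subalg_mulA subalg_mul1 subalg_mulr1 subalg_mulDl subalg_mulDr subalg1_neq0.

Lemma subalg_scalerAl (a : R[i]) (x y : subalg) : a *: (x * y) = a *: x * y.
Proof. by apply: val_inj; rewrite /= cmulZl. Qed.
Lemma subalg_scalerAr (a : R[i]) (x y : subalg) : a *: (x * y) = x * (a *: y).
Proof. by apply: val_inj; rewrite /= cmulZr. Qed.

HB.instance Definition _ := GRing.Lmodule_isLalgebra.Build R[i] subalg subalg_scalerAl.
HB.instance Definition _ := GRing.Lalgebra_isAlgebra.Build R[i] subalg subalg_scalerAr.

Variable gam : A -> R.
Hypothesis gam_ge0 : forall x, S x -> 0 <= gam x.
Hypothesis gamD : forall x y, S x -> S y -> gam (x + y) <= gam x + gam y.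
Hypothesis gamZ : forall (a : R[i]) x, S x -> gam (a *: x) = cabs a * gam x.
Hypothesis gamM : forall x y, S x -> S y -> gam (cmul x y) <= gam x * gam y.
Hypothesis gam_star : forall x, S x -> gam (cmul (cstar x) x) = gam x ^+ 2.

Definition subalg_gam (x : subalg) := gam (val x).

Let starK : involutive subalg_star.
Proof. by move=> x; apply: val_inj; exact: cstarK. Qed.
Let starD : {morph subalg_star : x y / x + y}.
Proof. by move=> x y; apply: val_inj; exact: cstarD. Qed.
Let starZ (a : R[i]) x : subalg_star (a *: x) = a^* *: subalg_star x.
Proof. by apply: val_inj; exact: cstarZ. Qed.
Let starM x y : subalg_star (x * y) = subalg_star y * subalg_star x.
Proof. by apply: val_inj; exact: cstarM. Qed.
Let g_ge0 x : 0 <= subalg_gam x. Proof. by apply/gam_ge0/subalgP. Qed.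
Let gD x y : subalg_gam (x + y) <= subalg_gam x + subalg_gam y.
Proof. by apply: gamD; exact: subalgP. Qed.
Let gZ (a : R[i]) x : subalg_gam (a *: x) = cabs a * subalg_gam x.
Proof. by apply: gamZ; exact: subalgP. Qed.
Let gM x y : subalg_gam (x * y) <= subalg_gam x * subalg_gam y.
Proof. by apply: gamM; exact: subalgP. Qed.
Let g_star x : subalg_gam (subalg_star x * x) = subalg_gam x ^+ 2.
Proof. by apply: gam_star; exact: subalgP. Qed.

Definition psd (a : A) := exists2 x : subalg, val x = a & pos subalg_star subalg_gam x.

Lemma psd_starM x : S x -> psd (cmul (cstar x) x).
Proof.
move=> Sx; exists (subalg_star (subalg_of Sx) * subalg_of Sx) => //.
exact: pos_starM.
Qed.

Lemma psdD a b : psd a -> psd b -> psd (a + b).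
Proof. by move=> [x <- px] [y <- py]; exists (x + y) => //; exact: posD. Qed.

Lemma psd_cauchy_schwarz a b c : S a -> psd b -> S c ->
  (forall t : R, psd ((t * t)%:C *: c - (t + t)%:C *: cmul (cstar a) a +
     cmul (cmul (cstar a) b) a)) ->
  gam a ^+ 2 <= gam b * gam c.
Proof.
move=> Sa [y <- py] Sc h; have := @gam_cauchy_schwarz R subalg subalg_star subalg_gam
  starK starD starZ starM g_ge0 gD gZ gM g_star (subalg_of Sa) y (subalg_of Sc) py.
apply => t; have [x ex' px] := h t.
set z := (z in pos _ _ z); suff -> : z = x by [].
apply: val_inj; by rewrite ex' /z !rscE.
Qed.

(** These three properties are all that the sequel uses of positivity; the predicate on A hides the
    subtype and its ring structure. *)
Lemma exists_psd : exists psd : A -> Prop,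
  [/\ forall x, S x -> psd (cmul (cstar x) x),
      forall a b, psd a -> psd b -> psd (a + b) &
      forall a b c, S a -> psd b -> S c ->
        (forall t : R, psd ((t * t)%:C *: c - (t + t)%:C *: cmul (cstar a) a +
           cmul (cmul (cstar a) b) a)) ->
        gam a ^+ 2 <= gam b * gam c].
Proof.
by exists psd; split; [exact: psd_starM | exact: psdD | exact: psd_cauchy_schwarz].
Qed.

End UnitalStarSubalgebra.

(** * Pre-Hilbert modules *)

Section PreHilbertModule.
Variables (R : realType) (A : cstarAlgType R) (S X : set A) (e : A) (gam : A -> R).

Lemma cmul0l (x : A) : cmul 0 x = 0.
Proof. by apply: (@addrI _ (cmul 0 x)); rewrite -cmulDl !addr0. Qed.
Lemma cmul0r (x : A) : cmul x 0 = 0.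
Proof. by apply: (@addrI _ (cmul x 0)); rewrite -cmulDr !addr0. Qed.
Lemma cmulNl (x y : A) : cmul (- x) y = - cmul x y.
Proof. by apply/eqP; rewrite -addr_eq0 -cmulDl addNr cmul0l. Qed.
Lemma cmulNr (x y : A) : cmul x (- y) = - cmul x y.
Proof. by apply/eqP; rewrite -addr_eq0 -cmulDr addNr cmul0r. Qed.
Lemma cstar0 : cstar (0 : A) = 0.
Proof. by apply: (@addrI _ (cstar (0 : A))); rewrite -cstarD !addr0. Qed.
Lemma cstarN (x : A) : cstar (- x) = - cstar x.
Proof. by apply/eqP; rewrite -addr_eq0 -cstarD addNr cstar0. Qed.

Hypotheses (Se : S e) (Xe : X e) (xe : forall x, S x -> cmul x e = x)
  (ex : forall x, S x -> cmul e x = x).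
Hypothesis Sstar : forall x, S x -> S (cstar x).
Hypothesis SD : forall x y, S x -> S y -> S (x + y).
Hypotheses (XD : forall x y, X x -> X y -> X (x + y))
  (XZ : forall (a : R[i]) x, X x -> X (a *: x)).
Hypothesis XS : forall x a, X x -> S a -> X (cmul x a).
Hypothesis inS : forall x y, X x -> X y -> S (cmul (cstar x) y).

Hypothesis gam_ge0 : forall x, S x -> 0 <= gam x.
Hypothesis gamD : forall x y, S x -> S y -> gam (x + y) <= gam x + gam y.
Hypothesis gamZ : forall (a : R[i]) x, S x -> gam (a *: x) = cabs a * gam x.
Hypothesis gam_star : forall x, S x -> gam (cmul (cstar x) x) = gam x ^+ 2.

Variable psd : A -> Prop.
Hypothesis psdX : forall x, X x -> psd (cmul (cstar x) x).
Hypothesis psd_cs : forall a b c, S a -> psd b -> S c ->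
  (forall t : R, psd ((t * t)%:C *: c - (t + t)%:C *: cmul (cstar a) a +
     cmul (cmul (cstar a) b) a)) ->
  gam a ^+ 2 <= gam b * gam c.

Lemma module_cauchy_schwarz x y : X x -> X y ->
  gam (cmul (cstar x) y) ^+ 2 <=
  gam (cmul (cstar x) x) * gam (cmul (cstar y) y).
Proof.
move=> Xx Xy; apply: psd_cs; [exact: inS | exact: psdX | exact: inS |].
move=> t; set a := cmul (cstar x) y.
have Sa : S a by exact: inS.
have aE : cmul (cstar y) x = cstar a by rewrite /a cstarM cstarK.
pose w := t%:C *: y - cmul x a.
have Xw : X w by apply: XD; [exact: XZ | rewrite -scaleN1r; apply/XZ/XS].
set r := (r in psd r); suff -> : r = cmul (cstar w) w by exact: psdX.
rewrite /w cstarD cstarN cstarZ cstarM conjE conjc_real.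
rewrite cmulDl !cmulDr !cmulNl !cmulNr opprK !cmulZl !cmulZr scalerA.
have -> : cmul (cstar y) (cmul x a) = cmul (cstar a) a by rewrite cmulA aE.
have -> : cmul (cmul (cstar a) (cstar x)) y = cmul (cstar a) a by rewrite -cmulA.
have -> : cmul (cmul (cstar a) (cstar x)) (cmul x a) =
  cmul (cmul (cstar a) (cmul (cstar x) x)) a by rewrite !cmulA.
by rewrite /r -rmorphM rmorphD scalerDl opprD !addrA.
Qed.

Definition nrm (x : A) : R := Num.sqrt (gam (cmul (cstar x) x)).

Lemma nrm_ge0 x : 0 <= nrm x. Proof. exact: sqrtr_ge0. Qed.

Lemma nrm_sq x : X x -> nrm x ^+ 2 = gam (cmul (cstar x) x).
Proof. by move=> Xx; rewrite sqr_sqrtr //; apply/gam_ge0/inS. Qed.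

Lemma gam_inner x y : X x -> X y -> gam (cmul (cstar x) y) <= nrm x * nrm y.
Proof.
move=> Xx Xy; rewrite -(@ler_pXn2r _ 2) // ?nnegrE ?mulr_ge0 ?nrm_ge0 //.
  by rewrite exprMn !nrm_sq //; exact: module_cauchy_schwarz.
by apply/gam_ge0/inS.
Qed.

Lemma nrmZ (a : R[i]) x : X x -> nrm (a *: x) = cabs a * nrm x.
Proof.
move=> Xx; rewrite /nrm cstarZ cmulZl cmulZr scalerA gamZ; last exact: inS.
by rewrite cabsM cabs_conj -expr2 sqrtrM ?sqr_ge0 // sqrtr_sqr ger0_norm ?cabs_ge0.
Qed.

Lemma nrmD x y : X x -> X y -> nrm (x + y) <= nrm x + nrm y.
Proof.
move=> Xx Xy; have s0 : 0 <= nrm x + nrm y by rewrite addr_ge0 ?nrm_ge0.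
rewrite -(@ler_pXn2r _ 2) ?nnegrE ?nrm_ge0 //.
rewrite nrm_sq; last exact: XD.
rewrite cstarD cmulDl !cmulDr.
have h1 := gam_inner Xx Xy; have h2 := gam_inner Xy Xx.
have S1 := inS Xx Xx; have S2 := inS Xx Xy; have S3 := inS Xy Xx; have S4 := inS Xy Xy.
have e1 := nrm_sq Xx; have e2 := nrm_sq Xy.
apply: le_trans (gamD (SD S1 S2) (SD S3 S4)) _.
have := gamD S1 S2; have := gamD S3 S4.
by rewrite sqrrD e1 e2 mulr2n; move: h1 h2; rewrite [nrm y * _]mulrC; lra.
Qed.

Definition bounded_by (a : A) (M : R) :=
  0 <= M /\ forall x, X x -> X (cmul a x) /\ nrm (cmul a x) <= M * nrm x.

(** An infimum of bounds rather than a supremum of quotients, since [nrm] may vanish on nonzero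
    elements of X. The value is meaningful only when a bound exists. *)
Definition opnorm (a : A) : R := inf [set M | bounded_by a M].

Lemma opnorm_ge0 a M : bounded_by a M -> 0 <= opnorm a.
Proof. by move=> h; apply: lb_le_inf; [exists M | move=> M' []]. Qed.

Lemma opnorm_le a M : bounded_by a M -> opnorm a <= M.
Proof. by move=> h; apply: ge_inf => //; exists 0 => M' []. Qed.

Lemma opnormP a M : bounded_by a M -> bounded_by a (opnorm a).
Proof.
move=> h; split; first exact: opnorm_ge0 h.
move=> x Xx; split; first by case: (h.2 x Xx).
have [x0|xn] := eqVneq (nrm x) 0.
  by case: (h.2 x Xx) => _; rewrite x0 !mulr0.
have xp : 0 < nrm x by rewrite lt_neqAle eq_sym xn nrm_ge0.
rewrite -ler_pdivrMr //; apply: lb_le_inf; first by exists M.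
by move=> M' [_ h']; rewrite ler_pdivrMr //; case: (h' x Xx).
Qed.

Lemma bounded_byD a b M M' : bounded_by a M -> bounded_by b M' ->
  bounded_by (a + b) (M + M').
Proof.
move=> [M0 ha] [M0' hb]; split; first exact: addr_ge0.
move=> x Xx; have [Xa na] := ha x Xx; have [Xb nb] := hb x Xx.
rewrite cmulDl; split; first exact: XD.
by rewrite mulrDl; apply: le_trans (nrmD Xa Xb) (lerD na nb).
Qed.

Lemma bounded_byM a b M M' : bounded_by a M -> bounded_by b M' ->
  bounded_by (cmul a b) (M * M').
Proof.
move=> [M0 ha] [M0' hb]; split; first exact: mulr_ge0.
move=> x Xx; have [Xb nb] := hb x Xx; have [Xa na] := ha _ Xb.
rewrite -cmulA; split => //; apply: le_trans na _; rewrite -mulrA; exact: ler_wpM2l.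
Qed.

Lemma bounded_byZ (c : R[i]) a M : bounded_by a M ->
  bounded_by (c *: a) (cabs c * M).
Proof.
move=> [M0 ha]; split; first by rewrite mulr_ge0 ?cabs_ge0.
move=> x Xx; have [Xa na] := ha x Xx; rewrite cmulZl; split; first exact: XZ.
by rewrite nrmZ // -mulrA ler_wpM2l ?cabs_ge0.
Qed.

Lemma opnormD a b M M' : bounded_by a M -> bounded_by b M' ->
  opnorm (a + b) <= opnorm a + opnorm b.
Proof. by move=> /opnormP ha /opnormP hb; apply/opnorm_le/bounded_byD. Qed.

Lemma opnormM a b M M' : bounded_by a M -> bounded_by b M' ->
  opnorm (cmul a b) <= opnorm a * opnorm b.
Proof. by move=> /opnormP ha /opnormP hb; apply/opnorm_le/bounded_byM. Qed.

Lemma opnormZ (c : R[i]) a M : bounded_by a M ->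
  opnorm (c *: a) = cabs c * opnorm a.
Proof.
move=> ha; have hP := opnormP ha.
have le1 : opnorm (c *: a) <= cabs c * opnorm a by apply/opnorm_le/bounded_byZ.
have h0 := opnorm_ge0 (bounded_byZ c ha).
apply/eqP; rewrite eq_le le1 /=.
have [c0|c0] := eqVneq c 0; first by rewrite {1}c0 (cabs_real 0) normr0 mul0r.
have cc : cabs c != 0 by rewrite -(inj_eq (@complexI R)) cabsE normr_eq0.
have cp : 0 < cabs c by rewrite lt_neqAle eq_sym cc cabs_ge0.
have h := opnorm_le (bounded_byZ c^-1 (opnormP (bounded_byZ c ha))).
move: h; rewrite scalerA mulVf // scale1r.
have -> : cabs c^-1 = (cabs c)^-1.
  by apply: (mulfI cc); rewrite -cabsM !mulfV // (cabs_real 1) normr1.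
by rewrite mulrC ler_pdivlMr // mulrC.
Qed.

(** The inner square of a x is the inner product of x with a^* a x, to which Cauchy-Schwarz applies.
    The adjoint of multiplication by a is multiplication by a^*, so no adjoint has to be
    constructed. *)
Lemma opnorm_sq_le a M M' : bounded_by a M -> bounded_by (cstar a) M' ->
  opnorm a ^+ 2 <= opnorm (cmul (cstar a) a).
Proof.
move=> ha hs; have [P0 hP] := opnormP (bounded_byM hs ha).
set N := opnorm (cmul (cstar a) a) in P0 hP *.
rewrite -[N]sqr_sqrtr // lerXn2r ?nnegrE ?sqrtr_ge0 ?(opnorm_ge0 ha) //.
apply: opnorm_le; split; first exact: sqrtr_ge0.
move=> x Xx; have [Xax _] := ha.2 x Xx; split=> //.
rewrite -(@ler_pXn2r _ 2) // ?nnegrE ?mulr_ge0 ?nrm_ge0 ?sqrtr_ge0 //.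
rewrite exprMn (nrm_sq Xax) (sqr_sqrtr P0) cstarM -cmulA [cmul (cstar a) _]cmulA.
have [Xaax naax] := hP x Xx.
apply: le_trans (gam_inner Xx Xaax) _.
by rewrite expr2 mulrC mulrA ler_wpM2r // nrm_ge0.
Qed.

Lemma opnorm_star a M M' : bounded_by a M -> bounded_by (cstar a) M' ->
  opnorm (cmul (cstar a) a) = opnorm a ^+ 2.
Proof.
move=> ha hs.
have le b B B' : bounded_by b B -> bounded_by (cstar b) B' ->
    opnorm b <= opnorm (cstar b).
  move=> hb hbs; have h1 := opnorm_sq_le hb hbs; have h2 := opnormM hbs hb.
  have b0 := opnorm_ge0 hb; have bs0 := opnorm_ge0 hbs.
  have := le_trans h1 h2; rewrite expr2.
  by case: (lerP (opnorm b) (opnorm (cstar b))) => // h; nra.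
have e1 : opnorm (cstar a) = opnorm a.
  by apply/eqP; rewrite eq_le (le _ _ _ ha hs) andbT -{2}[a]cstarK
    (le _ M' M) ?cstarK.
apply/eqP; rewrite eq_le (opnorm_sq_le ha hs) andbT.
by rewrite expr2 -{1}e1; exact: opnormM hs ha.
Qed.

Lemma gam_le_opnorm a M : S a -> bounded_by a M -> gam a <= opnorm a.
Proof.
move=> Sa ha; have [P0 hP] := opnormP ha.
have es : cstar e = e.
  have h : cmul e (cstar e) = cstar e by rewrite ex //; exact: Sstar.
  by rewrite -[RHS]cstarK -{2}h cstarM cstarK h.
have nS b : S b -> nrm b = gam b.
  by move=> Sb; rewrite /nrm gam_star // sqrtr_sqr ger0_norm // gam_ge0.
have ge1 : gam e <= 1.
  have := gam_star Se; rewrite es ex // => h; have := gam_ge0 Se.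
  by case: (ltrP 1 (gam e)) => // h1 _; have := h1; nra.
have [_] := hP e Xe; rewrite xe // nS // nS // => /le_trans; apply.
by rewrite ler_piMr.
Qed.

End PreHilbertModule.

(** * Subgroups of abstract groups *)

Lemma mem_set_eq (T S : Type) (A : set T) (B : set S) x y :
  A x = B y -> (x \in A) = (y \in B).
Proof.
by move=> e; apply/idP/idP => /set_mem h; apply/mem_set; [rewrite -e | rewrite e].
Qed.

Section Subgroups.
Variable G : groupType.
Implicit Types (H K : set G).

Lemma subgroupP H : is_subgroup H <->
  [/\ H 1%g, forall x y, H x -> H y -> H (x * y)%g & forall x, H x -> H x^-1%g].
Proof.
split=> [[h1 hV]|[h1 hM hV]].
  have {}h1 : H 1%g by move: h1; rewrite inE.
  have hd x y : H x -> H y -> H (x * y^-1)%g.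
    by move=> hx hy; have := hV x y; rewrite !inE => /(_ hx hy).
  have hI x : H x -> H x^-1%g by move=> hx; rewrite -[_^-1%g]mul1g; apply: hd.
  by split=> // x y hx /hI hy; rewrite -[y]invgK; apply: hd.
split; first by rewrite inE.
by move=> x y; rewrite !inE => hx hy; apply: hM => //; apply: hV.
Qed.

Lemma subgroup1 H : is_subgroup H -> H 1%g. Proof. by case/subgroupP. Qed.
Lemma subgroupM H x y : is_subgroup H -> H x -> H y -> H (x * y)%g.
Proof. by case/subgroupP => _ h _; exact: h. Qed.
Lemma subgroupV H x : is_subgroup H -> H x -> H x^-1%g.
Proof. by case/subgroupP => _ _; exact. Qed.
Lemma subgroupVE H x : is_subgroup H -> H x^-1%g = H x.
Proof.
move=> sH; apply/propext; split; last exact: subgroupV.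
by move=> /(subgroupV sH); rewrite invgK.
Qed.
Lemma subgroupMl H x y : is_subgroup H -> H x -> H (x * y)%g = H y.
Proof.
move=> sH hx; apply/propext; split; last exact: subgroupM.
by move=> /(subgroupM sH (subgroupV sH hx)); rewrite mulKg.
Qed.
Lemma subgroupMr H x y : is_subgroup H -> H y -> H (x * y)%g = H x.
Proof.
move=> sH hy; apply/propext; split; last by move=> hx; apply: subgroupM.
by move=> /(subgroupM sH)/(_ (subgroupV sH hy)); rewrite mulgK.
Qed.

Lemma subgroup_divC H x y : is_subgroup H -> H (x^-1 * y)%g -> H (y^-1 * x)%g.
Proof. by move=> sH /(subgroupV sH); rewrite invgM invgK. Qed.

Lemma subgroupI H K : is_subgroup H -> is_subgroup K -> is_subgroup (H `&` K).
Proof.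
move=> sH sK; apply/subgroupP; split.
- by split; apply: subgroup1.
- by move=> x y [? ?] [? ?]; split; apply: subgroupM.
- by move=> x [? ?]; split; apply: subgroupV.
Qed.

Lemma conj_setE x H y : conj_set x H y = H (x^-1 * y * x)%g.
Proof.
apply/propext; split=> [[h hh <-]|hh]; first by rewrite !mulgA mulVg mul1g mulgVK.
by exists (x^-1 * y * x)%g => //; rewrite !mulgA mulgV mul1g mulgK.
Qed.

Lemma subgroup_conj x H : is_subgroup H -> is_subgroup (conj_set x H).
Proof.
move=> sH; apply/subgroupP; split.
- by rewrite conj_setE mulg1 mulVg; apply: subgroup1.
- move=> y z; rewrite !conj_setE => hy hz.
  have -> : (x^-1 * (y * z) * x = (x^-1 * y * x) * (x^-1 * z * x))%g.
    by rewrite !mulgA mulgK.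
  exact: subgroupM.
- move=> y; rewrite !conj_setE => hy.
  have -> : (x^-1 * y^-1 * x = (x^-1 * y * x)^-1)%g by rewrite !invgM invgK mulgA.
  exact: subgroupV.
Qed.

End Subgroups.

(** * Topological groups *)

Section TopologicalGroups.
Variable G : topGroupType.
Implicit Types (H K A B C U : set G).

Lemma mulgl_continuous (x : G) : continuous (fun y : G => (x * y)%g).
Proof.
move=> y; apply: (@continuous_comp _ _ _ (fun y => (x, y)) (fun z : G * G => (z.1 * z.2)%g)).
  by apply: cvg_pair; [exact: cvg_cst | exact: cvg_id].
exact: mulg_continuous.
Qed.

Lemma mulgr_continuous (x : G) : continuous (fun y : G => (y * x)%g).
Proof.
move=> y; apply: (@continuous_comp _ _ _ (fun y => (y, x)) (fun z : G * G => (z.1 * z.2)%g)).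
  by apply: cvg_pair; [exact: cvg_id | exact: cvg_cst].
exact: mulg_continuous.
Qed.

Lemma lcosetE (x : G) A : [set (x * y)%g | y in A] = [set y | A (x^-1 * y)%g].
Proof.
apply/seteqP; split=> [_ [a ha <-]|y hy] /=; first by rewrite mulKg.
by exists (x^-1 * y)%g => //; rewrite mulVKg.
Qed.

Lemma rcosetE (x : G) A : [set (y * x)%g | y in A] = [set y | A (y * x^-1)%g].
Proof.
apply/seteqP; split=> [_ [a ha <-]|y hy] /=; first by rewrite mulgK.
by exists (y * x^-1)%g => //; rewrite mulgVK.
Qed.

Lemma open_preml (x : G) A : open A -> open [set y : G | A (x * y)%g].
Proof. by have /continuousP := @mulgl_continuous x; apply. Qed.

Lemma open_premr (x : G) A : open A -> open [set y : G | A (y * x)%g].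
Proof. by have /continuousP := @mulgr_continuous x; apply. Qed.

Lemma compact_lcoset (x : G) A : compact A -> compact [set (x * y)%g | y in A].
Proof. by apply/continuous_compact/continuous_subspaceT/(@mulgl_continuous x). Qed.

Lemma nbhs_preml (x y : G) A : nbhs (x * y)%g A -> nbhs y [set z : G | A (x * z)%g].
Proof. exact: (@mulgl_continuous x y). Qed.

Lemma nbhs_premr (x y : G) A : nbhs (y * x)%g A -> nbhs y [set z : G | A (z * x)%g].
Proof. exact: (@mulgr_continuous x y). Qed.

Lemma closure_mul A B C (x y : G) :
  (forall a b, A a -> B b -> C (a * b)%g) ->
  closure A x -> closure B y -> closure C (x * y)%g.
Proof.
move=> hC hx hy U hU.
have [[V W] /= [hV hW] hVW] := @mulg_continuous G (x, y) U hU.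
have [a [Aa Va]] := hx V hV; have [b [Bb Wb]] := hy W hW.
by exists (a * b)%g; split; [exact: hC | exact: (hVW (a, b))].
Qed.

Lemma closure_inv A C (x : G) :
  (forall a, A a -> C a^-1%g) -> closure A x -> closure C x^-1%g.
Proof.
move=> hC hx U hU; have [a [Aa Ua]] := hx _ (@invg_continuous G x U hU).
by exists a^-1%g; split => //; apply: hC.
Qed.

Lemma closure_conj A C (g x : G) :
  (forall a, A a -> C (g * a * g^-1)%g) -> closure A x ->
  closure C (g * x * g^-1)%g.
Proof.
move=> hC hx U hU.
have [a [Aa Ua]] := hx _ (nbhs_preml (nbhs_premr hU)).
by exists (g * a * g^-1)%g; split => //; apply: hC.
Qed.

Lemma subgroup_closure H : is_subgroup H -> is_subgroup (closure H).
Proof.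
move=> sH; apply/subgroupP; split.
- by apply: subset_closure; exact: subgroup1.
- move=> x y; apply: closure_mul => a b; exact: subgroupM.
- move=> x; apply: closure_inv => a; exact: subgroupV.
Qed.

Lemma open_subgroup H U : is_subgroup H -> open U -> U 1%g -> U `<=` H -> open H.
Proof.
move=> sH oU U1 UH; rewrite openE => x hx; rewrite /interior.
apply: filterS (_ : nbhs x [set y | U (x^-1 * y)%g]).
  by move=> y /UH; rewrite subgroupMl //; exact: subgroupV.
by apply: open_nbhs_nbhs; split; [exact: open_preml | rewrite /= mulVg].
Qed.

Lemma open_subgroup_closed H : is_subgroup H -> open H -> closed H.
Proof.
move=> sH oH x hx; have [|y [hy]] := hx [set y | H (x^-1 * y)%g].
  by apply: open_nbhs_nbhs; split; [exact: open_preml | rewrite /= mulVg; exact: subgroup1].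
by rewrite /= subgroupMr // subgroupVE.
Qed.

(** If z is in the closure of W', then z W' meets W', so that z lies in W' W'^-1, and W' is chosen
    with this product inside U. *)
Lemma nbhs1_closure U : nbhs (1%g : G) U ->
  exists V : set G, [/\ open V, V 1%g & closure V `<=` U].
Proof.
move=> hU; have hU' : nbhs (1 * 1^-1)%g U by rewrite invg1 mulg1.
have [[V W] /= [hV hW] hVW] := @mulg_continuous G (1%g, 1^-1%g) U hU'.
have {}hW := @invg_continuous G 1%g W hW.
have : nbhs (1%g : G) (V `&` [set x | W x^-1%g]) by apply: filterI.
rewrite nbhsE => -[W' [oW W1] hW']; exists W'; split => // z hz.
have [|y [Wy Wzy]] := hz [set y | W' (z^-1 * y)%g].
  by apply: open_nbhs_nbhs; split; [exact: open_preml | rewrite /= mulVg].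
have -> : z = (y * (z^-1 * y)^-1)%g by rewrite invgM invgK mulVKg.
by apply: (hVW (y, _)); split => /=; [case: (hW' _ Wy) | case: (hW' _ Wzy)].
Qed.

End TopologicalGroups.

(** * Schlichting completions *)

Section FiniteIndex.
Variable G : groupType.
Implicit Types (H K L A : set G).

(* For subgroups this says that L has finite index in A: f plays the role of
   the map onto left cosets, and need not be canonical. *)
Definition finitely_separated A L := exists (T : Type) (f : G -> T),
  finite_set (f @` A) /\ forall a b, A a -> A b -> f a = f b -> L (a^-1 * b)%g.

Lemma finitely_separatedT A : finitely_separated A [set: G].
Proof.
by exists unit, (fun=> tt).
Qed.

Lemma finitely_separatedI A L L' :
  finitely_separated A L -> finitely_separated A L' ->
  finitely_separated A (L `&` L').
Proof.
move=> [T [f [ff hf]]] [T' [f' [ff' hf']]].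
exists (T * T')%type, (fun x => (f x, f' x)); split.
  apply: sub_finite_set (finite_setX ff ff').
  by move=> _ [a ha <-]; split; exists a.
by move=> a b ha hb [/hf h /hf' h']; split; [apply: h | apply: h'].
Qed.

Lemma finitely_separated_bigI A (I : eqType) (F : I -> set G) (s : seq I) :
  (forall i, i \in s -> finitely_separated A (F i)) ->
  finitely_separated A [set g | forall i, i \in s -> F i g].
Proof.
elim: s => [|i s IH] h.
  by rewrite (_ : [set g | _] = setT); [exact: finitely_separatedT | apply/seteqP; split].
have [|T [f [ff hf]]] := finitely_separatedI (h i (mem_head _ _)) (IH _).
  by move=> k ks; apply: h; rewrite in_cons ks orbT.
exists T, f; split=> // a b ha hb /(hf _ _ ha hb)[h1 h2] k.
by rewrite in_cons => /predU1P[->|]; [exact: h1 | exact: h2].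
Qed.

Lemma finite_index_separated H L : is_subgroup L ->
  finite_index H L -> finitely_separated H L.
Proof.
move=> sL fHL; exists (set G), (fun h => [set (h * l)%g | l in L]); split => //.
move=> a b _ _ e; have : [set (a * l)%g | l in L] b.
  by rewrite e; exists 1%g; [exact: subgroup1 | rewrite mulg1].
by case=> l hl <-; rewrite mulKg.
Qed.

End FiniteIndex.

Section HeckeTriple.
Variables (R : realType) (G : groupType) (H : set G) (sigma : G -> R[i]).
Hypothesis hH : hecke_triple H sigma.
Local Notation K := (char_kernel H sigma).

Let sH : is_subgroup H. Proof. by case: hH => -[]. Qed.

Lemma htriple1 : sigma 1%g = 1.
Proof.
have h1 := subgroup1 sH; have := htriple_mul hH h1 h1; rewrite mulg1 => e.
have n0 : sigma 1%g != 0 by rewrite -normr_eq0 (htriple_unitary hH) // oner_eq0.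
by apply: (mulfI n0); rewrite -e mulr1.
Qed.

Lemma htripleV h : H h -> sigma h^-1%g = (sigma h)^-1.
Proof.
move=> hh; have n0 : sigma h != 0 by rewrite -normr_eq0 (htriple_unitary hH) // oner_eq0.
by apply: (mulfI n0); rewrite mulfV // -(htriple_mul hH hh (subgroupV sH hh)) mulgV htriple1.
Qed.

Lemma subgroup_char_kernel : is_subgroup K.
Proof.
apply/subgroupP; split.
- by split; [exact: subgroup1 | exact: htriple1].
- move=> x y [hx ex] [hy ey]; split; first exact: subgroupM.
  by rewrite (htriple_mul hH) // ex ey mulr1.
- move=> x [hx ex]; split; first exact: subgroupV.
  by rewrite htripleV // ex invr1.
Qed.

Lemma char_kernelP a b : H a -> H b -> sigma a = sigma b -> K (a^-1 * b)%g.
Proof.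
move=> ha hb e; have ha' := subgroupV sH ha; split; first exact: subgroupM.
rewrite (htriple_mul hH) // htripleV // e mulVf //.
by rewrite -normr_eq0 (htriple_unitary hH) // oner_eq0.
Qed.

(** The finite index of the intersection of H and x H x^-1 combines with the finite range of sigma:
    a is recorded by its class and by the value of sigma at x^-1 (r a)^-1 a x, with r a a
    representative of the class. *)
Lemma finitely_separated_conj_kernel x : finitely_separated H (conj_set x K).
Proof.
have sxH := subgroup_conj x sH.
have [T [f [ff hf]]] : finitely_separated H (H `&` conj_set x H).
  by apply: finite_index_separated; [exact: subgroupI | case: hH => -[]].
pose r a := xget 1%g [set b | H b /\ f b = f a].
have rP a : H a -> H (r a) /\ f (r a) = f a.
  by move=> ha; apply: (@xgetPex _ 1%g [set b | H b /\ f b = f a]); exists a.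
have rf a b : f a = f b -> r a = r b by rewrite /r => ->.
have hr a : H a -> H (x^-1 * ((r a)^-1 * a) * x)%g.
  move=> ha; have [h1 h2] := rP a ha.
  by have [_] := hf _ _ h1 ha h2; rewrite conj_setE.
exists (T * R[i])%type, (fun a => (f a, sigma (x^-1 * ((r a)^-1 * a) * x)%g)); split.
  apply: sub_finite_set (finite_setX ff (htriple_finite hH)).
  move=> _ [a ha <-]; split; first by exists a.
  by exists (x^-1 * ((r a)^-1 * a) * x)%g => //; apply: hr.
move=> a b ha hb [e1 e2]; rewrite conj_setE.
have := char_kernelP (hr _ ha) (hr _ hb) e2.
rewrite (rf _ _ e1); congr (K _).
by rewrite !invgM !invgK !mulgA !mulgK.
Qed.

End HeckeTriple.

Section Ultrafilters.
Variable T : Type.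

Lemma ultra_bigcup_finite (F : set_system T) (I : choiceType) (D : set I)
    (P : I -> set T) : UltraFilter F -> finite_set D ->
  F (\bigcup_(i in D) P i) -> exists2 i, D i & F (P i).
Proof.
move=> uF fD; have [X ->] := finite_fsetP.1 fD => FX.
apply: contrapT => no.
have nP i : i \in X -> F (~` P i).
  move=> iX; have [FP|//] := in_ultra_setVsetC (P i) uF.
  by exfalso; apply: no; exists i.
have : F (\bigcap_(i in [set` X]) ~` P i) by apply: filter_bigI => i; exact: nP.
rewrite -setC_bigcup => Fn.
have F0 : F set0 by rewrite -(setICr (\bigcup_(i in [set` X]) P i)); apply: filterI.
by have [] := filter_ex F0.
Qed.

End Ultrafilters.

Section Schlichting.
Variables (R : realType) (G : groupType) (H N : set G) (sigma : G -> R[i]).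
Hypothesis hH : hecke_triple H sigma.
Variables (Gs : topGroupType) (j : G -> Gs) (Hs : set Gs) (sigmas : Gs -> R[i]).
Hypothesis hGs : schlichting_completion H sigma j Hs sigmas.
Local Notation K := (char_kernel H sigma).
Local Notation Ks := (closure (j @` K)).

Let hG := schl_group hGs.
Let sH : is_subgroup H. Proof. by case: hH => -[]. Qed.
Let sK : is_subgroup K. Proof. exact: subgroup_char_kernel. Qed.
Let jM : {morph j : x y / (x * y)%g}. Proof. exact: hcompl_morph hG. Qed.

Lemma compl1 : j 1%g = 1%g.
Proof. by apply: (mulgI (j 1%g)); rewrite -jM !mulg1. Qed.

Lemma complV x : j x^-1%g = (j x)^-1%g.
Proof. by apply: (mulgI (j x)); rewrite -jM !mulgV compl1. Qed.

Lemma subgroup_image (A : set G) : is_subgroup A -> is_subgroup (j @` A).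
Proof.
move=> sA; apply/subgroupP; split.
- by exists 1%g; [exact: subgroup1 | exact: compl1].
- move=> _ _ [x hx <-] [y hy <-].
  by exists (x * y)%g; [exact: subgroupM | exact: jM].
- move=> _ [x hx <-].
  by exists x^-1%g; [exact: subgroupV | exact: complV].
Qed.

Lemma subgroup_closure_image (A : set G) : is_subgroup A ->
  is_subgroup (closure (j @` A)).
Proof. by move=> sA; apply/subgroup_closure/subgroup_image. Qed.

Lemma compl_meets (U : set Gs) : open U -> U !=set0 -> exists g, U (j g).
Proof.
move=> oU U0; have [y [Uy [g _ gy]]] := hcompl_dense hG U0 oU.
by exists g; rewrite gy.
Qed.

(** K is open in the Hecke topology, hence the trace of an open W of the completion. By density W
    lies in the closure of K, and a subgroup containing a neighbourhood of 1 is open. *)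
Lemma open_closure_image (A : set G) : is_subgroup A -> K `<=` A ->
  open (closure (j @` A)).
Proof.
move=> sA KA.
have /(hcompl_embedding hG)[W oW KW] : hecke_open K K.
  move=> g Kg; exists [:: 1%g] => k /(_ 1%g (mem_head _ _)).
  by rewrite conj_setE invg1 mul1g mulg1; apply: subgroupM.
apply: (@open_subgroup _ _ W) => //.
- exact: subgroup_closure_image.
- by have := subgroup1 sK; rewrite {1}KW /= compl1.
move=> w Ww B; rewrite nbhsE => -[B' [oB' B'w] hB'].
have [|g [Wg B'g]] := @compl_meets (W `&` B') (openI oW oB'); first by exists w.
exists (j g); split; last exact: hB'.
by exists g => //; apply: KA; rewrite KW.
Qed.

Lemma compl_preim_kernel g : Ks (j g) -> K g.
Proof.
have /(hcompl_embedding hG)[W oW KW] : hecke_open K K.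
  move=> k Kk; exists [:: 1%g] => k' /(_ 1%g (mem_head _ _)).
  by rewrite conj_setE invg1 mul1g mulg1; apply: subgroupM.
move=> /(_ [set y | W ((j g)^-1 * y)%g])[].
  apply: open_nbhs_nbhs; split; first exact: open_preml.
  by have := subgroup1 sK; rewrite /= mulVg {1}KW /= compl1.
move=> _ [[k Kk <-]] /=; rewrite -complV -jM => Wk.
by have : K (g^-1 * k)%g by [rewrite KW]; rewrite subgroupMr // subgroupVE.
Qed.

Lemma schl_subgroup : is_subgroup Hs.
Proof. by rewrite (schl_closure hGs); exact: subgroup_closure_image. Qed.

Lemma schl_open : open Hs.
Proof. by rewrite (schl_closure hGs); apply: open_closure_image => // x []. Qed.

Lemma schl_mem h : H h -> Hs (j h).
Proof. by move=> hh; rewrite (schl_closure hGs); apply: subset_closure; exists h. Qed.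

Lemma schl_kernel_subgroup : is_subgroup Ks.
Proof. exact: subgroup_closure_image. Qed.

Lemma schl_kernel_open : open Ks.
Proof. exact: open_closure_image. Qed.

Lemma schl_kernel_sub : Ks `<=` Hs.
Proof.
rewrite (schl_closure hGs); apply: closureS => _ [k [hk _] <-]; by exists k.
Qed.

Lemma compl_rep x : exists g k, Ks k /\ x = (j g * k)%g.
Proof.
have [||g hg] := @compl_meets [set y | Ks (x^-1 * y)%g].
- by apply: open_preml; exact: schl_kernel_open.
- by exists x => /=; rewrite mulVg; exact: subgroup1 schl_kernel_subgroup.
exists g, ((j g)^-1 * x)%g; split; last by rewrite mulVKg.
exact: subgroup_divC schl_kernel_subgroup hg.
Qed.

Lemma schl_rep x : Hs x -> exists h k, [/\ H h, Ks k & x = (j h * k)%g].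
Proof.
rewrite {1}(schl_closure hGs) => /(_ [set y | Ks (x^-1 * y)%g])[].
  apply: open_nbhs_nbhs; split; first by apply: open_preml; exact: schl_kernel_open.
  by rewrite /= mulVg; exact: subgroup1 schl_kernel_subgroup.
move=> _ [[h hh <-]] /= hk; exists h, ((j h)^-1 * x)%g; split=> //.
  exact: subgroup_divC schl_kernel_subgroup hk.
by rewrite mulVKg.
Qed.

(** Points j h' of x Ks close to x have [sigmas] close to its value at x, while sigma h' = sigma h
    because h^-1 h' is in K. The algebraic properties of [sigmas] all follow from this formula. *)
Lemma sigmas_rep h k : H h -> Ks k -> sigmas (j h * k)%g = sigma h.
Proof.
move=> hh hk; set x := (j h * k)%g.
have Hx : Hs x.
  by apply: subgroupM schl_subgroup _ _; [exact: schl_mem | exact: schl_kernel_sub].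
apply/eqP; rewrite -subr_eq0 -normr_eq0; apply: contrapT => /negP n0.
have e0 : 0 < `|sigmas x - sigma h| by rewrite lt_neqAle eq_sym n0 normr_ge0.
have := schl_continuous hGs.
rewrite (continuous_open_subspace _ schl_open) => /(_ x).
rewrite inE => /(_ Hx)/cvgrPdist_lt/(_ _ e0) hV.
have oxK : nbhs x [set y | Ks (x^-1 * y)%g].
  apply: open_nbhs_nbhs; split; first by apply: open_preml; exact: schl_kernel_open.
  by rewrite /= mulVg; exact: subgroup1 schl_kernel_subgroup.
move: (Hx); rewrite {1}(schl_closure hGs) => /(_ _ (filterI hV oxK)).
move=> [_ [[h' hh' <-]] [/= lt hk']]; move: lt; rewrite (schl_extends hGs) //.
suff -> : sigma h' = sigma h by rewrite ltxx.
have [hm] : K (h^-1 * h')%g.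
  apply: compl_preim_kernel; rewrite jM complV.
  have -> : ((j h)^-1 * j h' = k * (x^-1 * j h'))%g.
    by rewrite /x invgM !mulgA mulgV mul1g.
  exact: subgroupM schl_kernel_subgroup _ _.
move=> e; have : sigma (h * (h^-1 * h'))%g = sigma h.
  by rewrite (htriple_mul hH) // e mulr1.
by rewrite mulVKg.
Qed.

(** Moving k past j h' replaces it by a conjugate, still in Ks since K is normal in H. *)
Lemma sigmas_mul x y : Hs x -> Hs y -> sigmas (x * y)%g = sigmas x * sigmas y.
Proof.
move=> /schl_rep[h [k [hh hk ->]]] /schl_rep[h' [k' [hh' hk' ->]]].
have -> : (j h * k * (j h' * k') = j (h * h') * ((j h'^-1 * k * (j h'^-1)^-1) * k'))%g.
  by rewrite complV invgK jM !mulgA mulgK.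
rewrite !sigmas_rep ?(htriple_mul hH) //; first exact: subgroupM.
apply: subgroupM schl_kernel_subgroup _ _ => //.
move: hk; apply: closure_conj => _ [u [hu eu] <-].
have hi := subgroupV sH hh'.
exists (h'^-1 * u * h')%g; last by rewrite !jM complV invgK.
split; first by do ?apply: subgroupM.
rewrite !(htriple_mul hH) ?eu ?mulr1 //; last by apply: subgroupM.
by rewrite -(htriple_mul hH) // mulVg (htriple1 hH).
Qed.

Lemma sigmas_unitary x : Hs x -> `|sigmas x| = 1.
Proof.
by move=> /schl_rep[h [k [hh hk ->]]]; rewrite sigmas_rep // (htriple_unitary hH).
Qed.

Lemma sigmas_kernel k : Ks k -> sigmas k = 1.
Proof.
move=> hk; rewrite -[k]mul1g -compl1 sigmas_rep ?(htriple1 hH) //.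
exact: subgroup1.
Qed.

(** Writing g = j g0 k with k in Ks, which lies in the closure of A, reduces the claim to
    conjugation by an element of G. *)
Lemma normal_closure_image (A : set G) : normal_subgroup A -> K `<=` A ->
  forall g x, closure (j @` A) x -> closure (j @` A) (g * x * g^-1)%g.
Proof.
move=> [sA nA] KA g x hx; have sAs := subgroup_closure_image sA.
have [g0 [k [hk ->]]] := compl_rep g.
have hk' : closure (j @` A) k.
  by move: hk; apply: closureS => _ [u hu <-]; exists u => //; apply: KA.
have -> : (j g0 * k * x * (j g0 * k)^-1 = j g0 * (k * x * k^-1) * (j g0)^-1)%g.
  by rewrite invgM !mulgA.
apply: (@closure_conj _ (j @` A)) => [_ [a ha <-]|].
  by exists (g0 * a * g0^-1)%g; [exact: nA | rewrite !jM complV].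
by rewrite (subgroupMr _ sAs) ?subgroupVE // subgroupMl.
Qed.

Lemma schl_normal_in (hN : normal_in H N) :
  (forall n h, N n -> H h -> sigma (n * h * n^-1)%g = sigma h) ->
  forall n h, closure (j @` N) n -> Hs h ->
    Hs (n * h * n^-1)%g /\ sigmas (n * h * n^-1)%g = sigmas h.
Proof.
move: hN => [_ HN nHN] hs x h hx hh.
have [n [k [Nn hk ->]]] : exists n k, [/\ N n, Ks k & x = (j n * k)%g].
  move: hx => /(_ [set y | Ks (x^-1 * y)%g])[].
    apply: open_nbhs_nbhs; split; first by apply: open_preml; exact: schl_kernel_open.
    by rewrite /= mulVg; exact: subgroup1 schl_kernel_subgroup.
  move=> _ [[n Nn <-]] /= hk; exists n, ((j n)^-1 * x)%g; split=> //.
    exact: subgroup_divC schl_kernel_subgroup hk.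
  by rewrite mulVKg.
have Hk := schl_kernel_sub hk; have sHs := schl_subgroup.
have Hkh : Hs (k * h * k^-1)%g by rewrite subgroupMr ?subgroupVE // subgroupMl.
have -> : (j n * k * h * (j n * k)^-1 = j n * (k * h * k^-1) * (j n)^-1)%g.
  by rewrite invgM !mulgA.
have -> : sigmas h = sigmas (k * h * k^-1)%g.
  have kV := subgroupV schl_kernel_subgroup hk.
  rewrite (sigmas_mul (subgroupM sHs Hk hh) (schl_kernel_sub kV)).
  by rewrite (sigmas_mul Hk hh) (sigmas_kernel hk) (sigmas_kernel kV) mul1r mulr1.
move: (k * h * k^-1)%g Hkh => {hx hh}z /schl_rep[h0 [k0 [hh0 hk0 ->]]].
have hk1 : Ks (j n * k0 * (j n)^-1)%g.
  move: hk0; apply: closure_conj => _ [u [hu eu] <-].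
  exists (n * u * n^-1)%g; last by rewrite !jM complV.
  by split; [exact: nHN | rewrite hs].
have -> : (j n * (j h0 * k0) * (j n)^-1 =
    j (n * h0 * n^-1) * (j n * k0 * (j n)^-1))%g.
  by rewrite !jM complV !mulgA mulgVK.
have hh1 := nHN _ _ Nn hh0; split; last by rewrite !sigmas_rep // hs.
by rewrite subgroupMl //; [exact: schl_kernel_sub | exact: schl_mem].
Qed.

(** L is a finite intersection of conjugates of K. It is chosen inside a V whose closure lies in U,
    which leaves room for the closure of L. *)
Lemma compl_small_subgroup (U : set Gs) : nbhs 1%g U ->
  exists L : set G, [/\ is_subgroup L, finitely_separated H L &
    closure (j @` L) `<=` U].
Proof.
move=> /nbhs1_closure[V [oV V1 VU]].
have : hecke_open K (j @^-1` V) by apply/(hcompl_embedding hG); exists V.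
move=> /(_ 1%g); rewrite /= compl1 => /(_ V1)[xs hxs].
exists [set g | forall x, x \in xs -> conj_set x K g]; split.
- apply/subgroupP; split.
  + by move=> x _; apply: subgroup1; exact: subgroup_conj.
  + by move=> a b ha hb x hx; apply: subgroupM (ha x hx) (hb x hx); exact: subgroup_conj.
  + by move=> a ha x hx; apply: subgroupV (ha x hx); exact: subgroup_conj.
- by apply: finitely_separated_bigI => x _; exact: finitely_separated_conj_kernel.
- apply: subset_trans VU; apply: closureS => _ [g hg <-].
  by rewrite -[g]mul1g; apply: hxs.
Qed.

(* Complete and totally bounded: a finite partition of H into cosets of L cuts
   Hs into finitely many closed pieces, one of which belongs to a given
   ultrafilter. *)
Lemma schl_compact : compact Hs.
Proof.
rewrite compact_ultra => F uF FHs.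
have cover (T : Type) (f : G -> T) : finite_set (f @` H) -> exists t,
    F (closure (j @` (H `&` [set h | f h = t]))).
  move=> ff; pose T' := {classic T}.
  have [||t _ Ft] := @ultra_bigcup_finite _ F T' (f @` H)
      (fun t => closure (j @` (H `&` [set h | f h = t]))) => //; last by exists t.
  apply: filterS FHs; rewrite (schl_closure hGs).
  have cl : closed (\bigcup_(t in (f @` H : set T'))
      closure (j @` (H `&` [set h | f h = t]))).
    by apply: closed_bigcup => // t _; exact: closed_closure.
  rewrite [X in _ `<=` X](closure_id _).1 //; apply: closureS => _ [h hh <-].
  by exists (f h); [exists h | apply: subset_closure; exists h].
have cauchy (U : set Gs) : nbhs 1%g U -> exists2 S, F S &
    forall x y, S x -> S y -> U (x^-1 * y)%g /\ U (y * x^-1)%g.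
  move=> /compl_small_subgroup[L [sL [T [f [ff hf]]] LU]].
  have [t Ft] := cover _ _ ff.
  (* The Cauchy condition is two-sided: classes of h control x^-1 y, classes of h^-1 control y
     x^-1. *)
  have ff' : finite_set ((fun h => f h^-1%g) @` H).
    apply: sub_finite_set ff => _ [h hh <-].
    by exists h^-1%g => //; apply: subgroupV.
  have [t' Ft'] := cover _ _ ff'.
  eexists; first exact: filterI Ft Ft'.
  move=> x y [x1 x2] [y1 y2]; split; apply: LU.
    apply: (@closure_mul _ (j @` [set h^-1%g | h in H `&` [set h | f h = t]]) _ _ _ _ _ _ y1).
      move=> _ _ [_ [a [ha /= fa] <-] <-] [b [hb /= fb] <-].
      exists (a^-1 * b)%g; last exact: jM.
      by apply: hf => //; rewrite fa fb.
    move: x1; apply: closure_inv => _ [a ha <-].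
    by exists a^-1%g; [exists a | exact: complV].
  apply: (@closure_mul _ _ (j @` [set h^-1%g | h in H `&` [set h | f h^-1%g = t']]) _ _ _ _ y2).
    move=> _ _ [b [hb /= fb] <-] [_ [a [ha /= fa] <-] <-].
    exists (b * a^-1)%g; last exact: jM.
    have -> : (b * a^-1 = (b^-1)^-1 * a^-1)%g by rewrite invgK.
    by apply: hf; [exact: subgroupV.. | rewrite fa fb].
  move: x2; apply: closure_inv => _ [a ha <-].
  by exists a^-1%g; [exists a | exact: complV].
have [x Fx] := hcompl_complete hG (@ultra_proper _ _ uF) cauchy.
exists x; split => //; rewrite /= (schl_closure hGs); apply: closed_closure.
rewrite -(schl_closure hGs) => B hB; apply: (@filter_ex _ F).
by apply: filterI => //; apply: Fx.
Qed.

End Schlichting.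
(** * Haar integration *)

Section ComplexIntegral.
Context (R : realType) (G : topGroupType).
Local Notation borel := (g_sigma_algebraType (@open G)).
Variable mu : {measure set borel -> \bar R}.
Implicit Types (f g : G -> R[i]) (E : set G).

Definition cintegrable f :=
  mu.-integrable [set: borel] (EFin \o (fun x => complex.Re (f x))) /\
  mu.-integrable [set: borel] (EFin \o (fun x => complex.Im (f x))).

Definition restr E f : G -> R[i] := fun x => if x \in E then f x else 0.

Lemma open_borel E : open E -> measurable (E : set borel).
Proof. by move=> oE; apply: sub_sigma_algebra. Qed.

Lemma closed_borel E : closed E -> measurable (E : set borel).
Proof.
move=> cE; rewrite -[E]setCK; apply: measurableC; apply: open_borel.
exact: closed_openC.
Qed.

Lemma cintegrable0 : cintegrable (fun=> 0).
Proof. by split; exact: integrable0. Qed.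

Lemma cintegrableD f g : cintegrable f -> cintegrable g ->
  cintegrable (fun x => f x + g x).
Proof.
move=> [f1 f2] [g1 g2]; split.
  apply: eq_integrable (integrableD measurableT f1 g1) => // x _.
  by rewrite /= raddfD EFinD.
apply: eq_integrable (integrableD measurableT f2 g2) => // x _.
by rewrite /= raddfD EFinD.
Qed.

Lemma cintegralD f g : cintegrable f -> cintegrable g ->
  cintegral mu (fun x => f x + g x) = cintegral mu f + cintegral mu g.
Proof.
move=> [f1 f2] [g1 g2]; rewrite /cintegral.
have e1 : Rintegral mu [set: borel] (fun x => complex.Re (f x + g x)) =
    Rintegral mu setT (fun x => complex.Re (f x)) +
    Rintegral mu setT (fun x => complex.Re (g x)).
  by rewrite -RintegralD //; apply: eq_Rintegral => x _; rewrite raddfD.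
have e2 : Rintegral mu [set: borel] (fun x => complex.Im (f x + g x)) =
    Rintegral mu setT (fun x => complex.Im (f x)) +
    Rintegral mu setT (fun x => complex.Im (g x)).
  by rewrite -RintegralD //; apply: eq_Rintegral => x _; rewrite raddfD.
by rewrite e1 e2.
Qed.

Lemma ReM (a z : R[i]) : complex.Re (a * z) =
  complex.Re a * complex.Re z - complex.Im a * complex.Im z.
Proof. by case: a z => ? ? [? ?]. Qed.

Lemma ImM (a z : R[i]) : complex.Im (a * z) =
  complex.Re a * complex.Im z + complex.Im a * complex.Re z.
Proof. by case: a z => ? ? [? ?]. Qed.

Lemma integrableZE (a : R) (u : G -> R) :
  mu.-integrable [set: borel] (EFin \o u) ->
  mu.-integrable [set: borel] (EFin \o (fun x => a * u x)).
Proof.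
by move=> hu; apply: eq_integrable (integrableZl measurableT a hu) => // x _.
Qed.

Lemma cintegrableZ (a : R[i]) f : cintegrable f -> cintegrable (fun x => a * f x).
Proof.
move=> [f1 f2]; split.
  apply: eq_integrable (integrableB measurableT (integrableZE (complex.Re a) f1)
    (integrableZE (complex.Im a) f2)) => // x _.
  by rewrite /= -EFinB ReM.
apply: eq_integrable (integrableD measurableT (integrableZE (complex.Re a) f2)
    (integrableZE (complex.Im a) f1)) => // x _.
by rewrite /= -EFinD ImM.
Qed.

Lemma cintegralZ (a : R[i]) f : cintegrable f ->
  cintegral mu (fun x => a * f x) = a * cintegral mu f.
Proof.
move=> [f1 f2]; rewrite /cintegral; apply/eqP; rewrite eq_complex /= ReM ImM /=.
apply/andP; split; apply/eqP.
  rewrite -!RintegralZl // -RintegralB //; [|exact: integrableZE..].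
  by apply: eq_Rintegral => x _; rewrite ReM.
rewrite -!RintegralZl // -RintegralD //; [|exact: integrableZE..].
by apply: eq_Rintegral => x _; rewrite ImM.
Qed.

Lemma cintegral0 : cintegral mu (fun=> 0) = 0.
Proof.
rewrite /cintegral; apply/eqP; rewrite eq_complex /= /Rintegral.
by rewrite !integral0_eq //= eqxx.
Qed.

Lemma cintegrable_restr E f : measurable (E : set borel) -> cintegrable f ->
  cintegrable (restr E f).
Proof.
move=> mE [f1 f2]; split.
  have := (integrable_mkcond _ mE).1 (integrableS measurableT mE (@subsetT _ _) f1).
  apply: eq_integrable => // x _; rewrite /= /restr patchE /=.
  by case: ifP.
have := (integrable_mkcond _ mE).1 (integrableS measurableT mE (@subsetT _ _) f2).
apply: eq_integrable => // x _; rewrite /= /restr patchE /=.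
by case: ifP.
Qed.

Lemma cintegral_step E (c : R[i]) : measurable (E : set borel) ->
  (mu E < +oo)%E -> cintegral mu (restr E (fun=> c)) = (fine (mu E))%:C * c.
Proof.
move=> mE fE.
have int r : Rintegral mu [set: borel] (fun x => if x \in E then r else 0) =
    r * fine (mu E).
  by rewrite -Rintegral_cst // [RHS]Rintegral_mkcond.
rewrite /cintegral.
rewrite (_ : (fun x => complex.Re (restr E (fun=> c) x)) =
  (fun x => if x \in E then complex.Re c else 0)); last first.
  by apply/funext => x; rewrite /restr; case: ifP.
rewrite (_ : (fun x => complex.Im (restr E (fun=> c) x)) =
  (fun x => if x \in E then complex.Im c else 0)); last first.
  by apply/funext => x; rewrite /restr; case: ifP.
by rewrite !int; case: c => a b /=; simpc; rewrite ![_ * fine _]mulrC.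
Qed.

Lemma cabs_sqrt (z : R[i]) :
  cabs z = Num.sqrt (complex.Re z ^+ 2 + complex.Im z ^+ 2).
Proof. by rewrite /cabs normc_def. Qed.

Lemma Re_le_cabs (z : R[i]) : complex.Re z <= cabs z.
Proof.
rewrite cabs_sqrt; apply: le_trans (ler_norm _) _; rewrite -sqrtr_sqr.
by rewrite ler_wsqrtr // lerDl sqr_ge0.
Qed.

Lemma cabs_le_ReIm (z : R[i]) : cabs z <= `|complex.Re z| + `|complex.Im z|.
Proof.
rewrite cabs_sqrt -[leRHS]ger0_norm ?addr_ge0 // -sqrtr_sqr ler_wsqrtr //.
rewrite sqrrD !real_normK ?num_real // addrAC lerDl.
by rewrite mulrn_wge0 // mulr_ge0.
Qed.

Lemma integrable_cabs f : cintegrable f ->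
  mu.-integrable [set: borel] (EFin \o (fun x => cabs (f x))).
Proof.
move=> [f1 f2].
have h := integrableD measurableT (integrable_norm f1) (integrable_norm f2).
apply: le_integrable h => //.
  apply/measurable_EFinP.
  have m1 : measurable_fun [set: borel] (fun x => complex.Re (f x)).
    by apply/measurable_EFinP; exact: (measurable_int mu f1).
  have m2 : measurable_fun [set: borel] (fun x => complex.Im (f x)).
    by apply/measurable_EFinP; exact: (measurable_int mu f2).
  rewrite (_ : (fun x => cabs (f x)) = (@Num.sqrt R) \o
      (fun x => complex.Re (f x) ^+ 2 + complex.Im (f x) ^+ 2)).
    apply: measurableT_comp; last by apply: measurable_funD; exact: measurable_funX.
    by apply: continuous_measurable_fun; exact: sqrt_continuous.
  by apply/funext => x; exact: cabs_sqrt.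
move=> x _; rewrite /= lee_fin ger0_norm ?cabs_ge0 // ger0_norm ?addr_ge0 //.
exact: cabs_le_ReIm.
Qed.

Lemma le_cabs_cintegral f : cintegrable f ->
  cabs (cintegral mu f) <= L1norm mu f.
Proof.
move=> hf; set c := cintegral mu f.
have [->|c0] := eqVneq c 0.
  rewrite (cabs_real 0) normr0; apply: Rintegral_ge0 => x _; exact: cabs_ge0.
(* The phase with u c = |c|. *)
pose u := Num.conj c / (cabs c)%:C.
have cc : cabs c != 0 by rewrite -(inj_eq (@complexI R)) cabsE normr_eq0.
have cC0 : (cabs c)%:C != 0 :> R[i] by rewrite cabsE normr_eq0.
have uc : u * c = (cabs c)%:C.
  by rewrite /u mulrAC [_ * c]mulrC -normCK -cabsE expr2 mulfK.
have cu : cabs u = 1.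
  by rewrite /u cabsM cabs_conj -fmorphV cabs_real ger0_norm
    ?invr_ge0 ?cabs_ge0 // divff.
have -> : cabs c = complex.Re (u * c) by rewrite uc.
rewrite /c -cintegralZ //=; apply: le_Rintegral => //.
- by case: (cintegrableZ u hf).
- exact: integrable_cabs.
- by move=> x _; apply: le_trans (Re_le_cabs _) _; rewrite cabsM cu mul1r.
Qed.

Lemma L1norm_split E f : measurable (E : set borel) -> cintegrable f ->
  L1norm mu f = L1norm mu (restr E f) + L1norm mu (restr (~` E) f).
Proof.
move=> mE hf; rewrite /L1norm -RintegralD //.
- apply: eq_Rintegral => x _; rewrite /restr in_setC; case: (x \in E) => /=.
    by rewrite (cabs_real 0) normr0 addr0.
  by rewrite (cabs_real 0) normr0 add0r.
- by apply/integrable_cabs/cintegrable_restr.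
- by apply/integrable_cabs/cintegrable_restr => //; exact: measurableC.
Qed.

Lemma cintegrable_split E f : measurable (E : set borel) ->
  cintegrable (restr E f) -> cintegrable (restr (~` E) f) ->
  cintegrable f /\
  cintegral mu f = cintegral mu (restr E f) + cintegral mu (restr (~` E) f).
Proof.
move=> mE h1 h2; have e : f = (fun x => restr E f x + restr (~` E) f x).
  apply/funext => x; rewrite /restr in_setC; case: (x \in E) => /=.
    by rewrite addr0.
  by rewrite add0r.
by rewrite {1 2}e; split; [exact: cintegrableD | exact: cintegralD].
Qed.

End ComplexIntegral.

(** * Convolution with functions invariant under an open subgroup *)

Section FiniteConvolution.
Context (R : realType) (G : topGroupType).
Local Notation borel := (g_sigma_algebraType (@open G)).
Variable mu : {measure set borel -> \bar R}.
Implicit Types (f phi : G -> R[i]) (L : set G).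

Lemma L1norm_ge0 f : 0 <= L1norm mu f.
Proof. by apply: Rintegral_ge0 => x _; exact: cabs_ge0. Qed.

Definition ltrans (z : G) phi : G -> R[i] := fun y => phi (z^-1 * y)%g.

(** On a coset z L the factor phi (t^-1 y) has the constant value phi (z^-1 y), so the coset
    contributes the integral of f over it. The list does not depend on phi, and its coefficients are
    controlled by the L^1-norm: this is the source of all operator bounds. *)
Lemma convolution_finite L (s : seq G) f : is_subgroup L -> open L ->
  cintegrable mu f -> (forall x, f x != 0 -> exists2 z, z \in s & L (z^-1 * x)%g) ->
  exists s' : seq (R[i] * G), [/\ forall p, p \in s' -> p.2 \in s,
    \sum_(p <- s') cabs p.1 <= L1norm mu f &
    forall phi, (forall l x, L l -> phi (l * x)%g = phi x) -> forall y,
      cintegrable mu (fun t => f t * phi (t^-1 * y)%g) /\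
      convolution mu f phi y = \sum_(p <- s') p.1 * ltrans p.2 phi y].
Proof.
move=> sL oL; elim: s f => [|z s IH] f intf hf.
  have f0 x : f x = 0.
    by apply/eqP; apply: contrapT => /negP/hf[].
  exists [::]; split=> // [|phi _ y]; first by rewrite big_nil L1norm_ge0.
  rewrite /convolution (_ : (fun t => _) = fun=> 0); last first.
    by apply/funext => t; rewrite f0 mul0r.
  by rewrite cintegral0 big_nil; split => //; exact: cintegrable0.
pose E := [set t | L (z^-1 * t)%g]; have mE : measurable (E : set borel).
  by apply: open_borel; exact: open_preml.
have mEC : measurable (~` E : set borel) by apply: measurableC.
have intE := cintegrable_restr mE intf.
have intEC := cintegrable_restr mEC intf.
(* The induction goes on with f cut off outside z L, so that a coset listed twice is counted
   once. *)
have [||s' [s's le_s' hs']] := IH (restr (~` E) f) => //.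
  move=> x; rewrite /restr in_setC; case: ifP => [/negP|]; last by rewrite eqxx.
  rewrite inE => nE /hf[w]; rewrite in_cons => /predU1P[->//|ws] Lw.
  by exists w.
exists ((cintegral mu (restr E f), z) :: s'); split.
- by move=> p; rewrite !in_cons => /predU1P[->|/s's ->]; rewrite ?eqxx ?orbT.
- rewrite big_cons (L1norm_split mE intf) lerD //=.
  exact: le_cabs_cintegral.
move=> phi hphi y; have [int2 e2] := hs' phi hphi y.
pose F := fun t => f t * phi (t^-1 * y)%g.
have F1 : restr E F = fun t => phi (z^-1 * y)%g * restr E f t.
  apply/funext => t; rewrite /restr /F; case: ifP => [|_]; last by rewrite mulr0.
  rewrite inE /E /= => Lt; rewrite mulrC; congr (_ * _).
  by rewrite -(hphi (z^-1 * t)%g) // -!mulgA mulVKg.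
have F2 : restr (~` E) F = fun t => restr (~` E) f t * phi (t^-1 * y)%g.
  by apply/funext => t; rewrite /restr /F; case: ifP => // _; rewrite mul0r.
have [|| intF eF] := @cintegrable_split _ _ mu E F mE.
- by rewrite F1; exact: cintegrableZ.
- by rewrite F2.
split => //; rewrite /convolution -/F eF F1 F2 cintegralZ // big_cons /=.
by rewrite mulrC -e2.
Qed.

End FiniteConvolution.

Arguments ltrans {R G} z%_group_scope phi _.

(** * Integrability of C_c functions and the modular function *)

Section HaarModular.
Context (R : realType) (G : topGroupType).
Local Notation borel := (g_sigma_algebraType (@open G)).
Variables (mu : {measure set borel -> \bar R}) (hmu : haar_measure mu).
Variables (Delta : G -> R) (hDelta : modular_function mu Delta).

Lemma continuous_near_const (S : topologicalType) (f : G -> S) :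
  (forall x, \forall y \near x, f y = f x) -> continuous f.
Proof.
move=> h x A hA; have := h x; apply: filterS => y e.
by rewrite /= e; exact: nbhs_singleton.
Qed.

Lemma continuous_Re (f : G -> R[i]) :
  continuous (f : G -> R[i]^o) -> continuous (fun x => complex.Re (f x)).
Proof.
move=> cf x; apply/cvgrPdist_lt => e e0.
have /cvgrPdist_lt/(_ e%:C) := cf x; rewrite ltcR => /(_ e0).
apply: filterS => y; rewrite -cabsE ltcR; apply: le_lt_trans.
rewrite -raddfB cabs_sqrt -sqrtr_sqr ler_wsqrtr //= lerDl; exact: sqr_ge0.
Qed.

Lemma continuous_Im (f : G -> R[i]) :
  continuous (f : G -> R[i]^o) -> continuous (fun x => complex.Im (f x)).
Proof.
move=> cf x; apply/cvgrPdist_lt => e e0.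
have /cvgrPdist_lt/(_ e%:C) := cf x; rewrite ltcR => /(_ e0).
apply: filterS => y; rewrite -cabsE ltcR; apply: le_lt_trans.
rewrite -raddfB cabs_sqrt -sqrtr_sqr ler_wsqrtr //= lerDr; exact: sqr_ge0.
Qed.

Lemma integrable_compact_support (u : G -> R) (C : set G) :
  continuous u -> compact C -> closed C -> (forall x, ~ C x -> u x = 0) ->
  mu.-integrable [set: borel] (EFin \o u).
Proof.
move=> cu cC clC u0.
have mC : measurable (C : set borel) by exact: closed_borel.
have mu_u : measurable_fun [set: borel] u.
  apply: (measurability _ (RGenOpens.measurableE R)).
  move=> _ [_ [a [b ->] <-]]; rewrite setTI; apply: open_borel.
  by apply: open_comp => [x _|]; [exact: cu | exact: interval_open].
have h : mu.-integrable (C : set borel) (EFin \o u).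
  apply: measurable_bounded_integrable => //.
  - exact: haar_compact hmu _ cC.
  - exact: measurable_funTS.
  - have [M [Mr hM]] := compact_bounded
      (continuous_compact (continuous_subspaceT cu) cC).
    exists M; split => // r Mr' x Cx /=; apply: (hM r Mr'); by exists x.
apply: eq_integrable ((integrable_mkcond _ mC).1 h) => // x _.
rewrite patchE /=; case: ifPn => //; rewrite notin_setE => nC.
by rewrite u0.
Qed.

Lemma Cc_cintegrable (D : set G) f : Cc D f -> cintegrable mu f.
Proof.
move=> [cf cS _].
have f0 x : ~ closure [set x | f x != 0] x -> f x = 0.
  move=> nS; apply/eqP; apply: contrapT => /negP h; apply: nS.
  exact: subset_closure.
split; apply: (integrable_compact_support _ cS (@closed_closure _ _)).
- exact: continuous_Re.
- by move=> x /f0 ->.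
- exact: continuous_Im.
- by move=> x /f0 ->.
Qed.

Lemma Cc_cover (D L : set G) (f : G -> R[i]) : Cc D f -> is_subgroup L -> open L ->
  exists s : seq G, (forall z, z \in s -> f z != 0) /\
    forall x, f x != 0 -> exists2 z, z \in s & L (z^-1 * x)%g.
Proof.
move=> [_ cS _] sL oL; move: cS; rewrite compact_cover.
move=> /(_ G [set x | f x != 0] (fun z => [set x | L (z^-1 * x)%g]))[].
- by move=> z _; exact: open_preml.
- move=> x /(_ [set y | L (x^-1 * y)%g])[].
    apply: open_nbhs_nbhs; split; first exact: open_preml.
    by rewrite /= mulVg; exact: subgroup1.
  by move=> z [fz Lz]; exists z => //; exact: subgroup_divC.
move=> D' D'S hD'; exists (finmap.enum_fset D'); split.
  by move=> z /D'S; rewrite inE.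
move=> x fx; have [z zD' Lz] := hD' x (@subset_closure _ [set x | f x != 0] x fx).
by exists z.
Qed.

Lemma haar_lcoset x (E : set G) : measurable (E : set borel) ->
  mu [set t | E (x^-1 * t)%g] = mu E.
Proof. by move=> mE; rewrite -lcosetE; exact: haar_left_invariant. Qed.

Lemma haar_rcoset x (E : set G) : measurable (E : set borel) ->
  mu [set t | E (t * x^-1)%g] = ((Delta x)%:E * mu E)%E.
Proof. by move=> mE; rewrite -rcosetE; case: hDelta => _; apply. Qed.

Variable H : set G.
Hypotheses (sH : is_subgroup H) (oH : open H) (muH : mu H = 1%E).

(** Both sides are the measure of H x y, as H has measure 1. *)
Lemma modular_mul x y : Delta (x * y)%g = Delta x * Delta y.
Proof.
have mH := open_borel oH.
have oHx : open [set t | H (t * x^-1)%g] by exact: open_premr.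
have := haar_rcoset (x * y) mH; rewrite muH mule1.
rewrite (_ : [set t | _] = [set t | [set t | H (t * x^-1)%g] (t * y^-1)%g]); last first.
  by apply/seteqP; split=> t; rewrite /= invgM mulgA.
rewrite haar_rcoset ?haar_rcoset ?muH ?mule1 //; last exact: open_borel.
by rewrite -EFinM mulrC => -[].
Qed.

Lemma modular_on h : H h -> Delta h = 1.
Proof.
move=> hh; have := haar_rcoset h (open_borel oH); rewrite muH mule1.
rewrite (_ : [set t | _] = H) ?muH; first by move=> [].
apply/seteqP; split=> t; rewrite /= subgroupMr // ?subgroupVE //.
Qed.

Lemma modular_gt0 x : 0 < Delta x. Proof. by case: hDelta. Qed.

Lemma modularV x : Delta x^-1%g = (Delta x)^-1.
Proof.
have n0 : Delta x != 0 by rewrite gt_eqF // modular_gt0.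
apply: (mulfI n0); rewrite -modular_mul mulgV mulfV // modular_on //.
exact: subgroup1.
Qed.

End HaarModular.

(** * Commuting operators on a subspace *)

Section CommutingProjections.
Variables (K : comNzRingType) (V : lmodType K) (W : V -> Prop).
Hypotheses (W0 : W 0) (WD : forall u v, W u -> W v -> W (u + v)).
Hypothesis WZ : forall a u, W u -> W (a *: u).

(** Meant for T the left translations and P an operator that is known to be linear only on W. *)
Lemma linear_on_sum (I : eqType) (P : V -> V) (T : I -> V -> V) (s : seq (K * I)) u :
  (forall v w, W v -> W w -> P (v + w) = P v + P w) ->
  (forall a v, W v -> P (a *: v) = a *: P v) ->
  (forall q, q \in s -> W (T q.2 u) /\ P (T q.2 u) = T q.2 (P u)) ->
  P (\sum_(q <- s) q.1 *: T q.2 u) = \sum_(q <- s) q.1 *: T q.2 (P u).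
Proof.
move=> PD PZ; suff h : (forall q, q \in s -> W (T q.2 u) /\ P (T q.2 u) = T q.2 (P u)) ->
    W (\sum_(q <- s) q.1 *: T q.2 u) /\
    P (\sum_(q <- s) q.1 *: T q.2 u) = \sum_(q <- s) q.1 *: T q.2 (P u).
  by move=> /h[].
elim: s => [|q s IH] hs.
  by rewrite !big_nil; split=> //; rewrite -(scale0r (0 : V)) PZ // !scale0r.
have [Wq Pq] := hs q (mem_head _ _).
have [|W' P'] := IH; first by move=> r rs; apply: hs; rewrite in_cons rs orbT.
by rewrite !big_cons; split; [apply: WD => //; exact: WZ | rewrite PD ?PZ ?Pq ?P' //; exact: WZ].
Qed.

Variables (I : eqType) (D : I -> Prop) (P : I -> V -> V).
Hypothesis WP : forall x u, D x -> W u -> W (P x u).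
Hypothesis PD : forall x u v, D x -> W u -> W v -> P x (u + v) = P x u + P x v.
Hypothesis PZ : forall x a u, D x -> W u -> P x (a *: u) = a *: P x u.
Hypothesis PC : forall x y u, D x -> D y -> W u -> P x (P y u) = P y (P x u).

Definition resid x u := u - P x u.

Let P0 x : D x -> P x 0 = 0.
Proof. by move=> Dx; rewrite -(scale0r (0 : V)) PZ // !scale0r. Qed.

Let PN x u : D x -> W u -> P x (- u) = - P x u.
Proof. by move=> Dx Wu; rewrite -scaleN1r PZ // scaleN1r. Qed.

Let WN u : W u -> W (- u). Proof. by move=> Wu; rewrite -scaleN1r; exact: WZ. Qed.

Lemma resid_mem x u : D x -> W u -> W (resid x u).
Proof. by move=> Dx Wu; apply: WD => //; apply/WN/WP. Qed.

Lemma residD x u v : D x -> W u -> W v -> resid x (u + v) = resid x u + resid x v.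
Proof. by move=> Dx Wu Wv; rewrite /resid PD // opprD addrACA. Qed.

Lemma residZ x a u : D x -> W u -> resid x (a *: u) = a *: resid x u.
Proof. by move=> Dx Wu; rewrite /resid PZ // scalerBr. Qed.

Lemma resid_comm x y u : D x -> D y -> W u -> resid x (resid y u) = resid y (resid x u).
Proof.
move=> Dx Dy Wu; have Wx := WP Dx Wu; have Wy := WP Dy Wu.
rewrite /resid (PD Dx Wu (WN Wy)) (PD Dy Wu (WN Wx)) !PN // (PC Dx Dy Wu).
by rewrite !opprD !opprK !addrA; congr (_ + _); exact: addrAC.
Qed.

Fixpoint killed (s : seq I) u : Prop :=
  if s is x :: s' then killed s' (resid x u) else u = 0.

Let all_D (s : seq I) := forall x, x \in s -> D x.

Let all_D_cons x s : all_D (x :: s) -> D x /\ all_D s.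
Proof.
by move=> h; split=> [|y ys]; apply: h; rewrite in_cons ?eqxx // ys orbT.
Qed.

Let killed0 s : all_D s -> killed s 0.
Proof.
by elim: s => //= x s IH /all_D_cons[Dx hs]; rewrite /resid P0 // subr0; exact: IH.
Qed.

Let killedD s u v : all_D s -> W u -> W v -> killed s u -> killed s v -> killed s (u + v).
Proof.
elim: s u v => [|x s IH] u v /=; first by move=> _ _ _ -> ->; rewrite addr0.
move=> /all_D_cons[Dx hs] Wu Wv; rewrite residD // => h1 h2.
by apply: IH => //; exact: resid_mem.
Qed.

Let killedZ s a u : all_D s -> W u -> killed s u -> killed s (a *: u).
Proof.
elim: s u => [|x s IH] u /=; first by move=> _ _ ->; rewrite scaler0.
by move=> /all_D_cons[Dx hs] Wu; rewrite residZ // => h1; apply: IH => //; exact: resid_mem.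
Qed.

Let killed_resid s x u : all_D s -> x \in s -> W u -> resid x u = 0 -> killed s u.
Proof.
elim: s u => // y s IH u /all_D_cons[Dy hs]; rewrite in_cons.
move=> /predU1P[-> _ /= ->|xs Wu r0 /=]; first exact: killed0.
apply: IH => //; first exact: resid_mem.
by rewrite resid_comm // ?r0 ?/resid ?P0 ?subr0 //; exact: hs.
Qed.

(** The operator 1 - P x kills e x; since these operators commute, applying all of them kills each e
    x of the list, hence any combination. *)
Lemma killed_span (e : I -> V) (s : seq (K * I)) :
  (forall q, q \in s -> D q.2) -> (forall x, D x -> W (e x) /\ P x (e x) = e x) ->
  killed [seq q.2 | q <- s] (\sum_(q <- s) q.1 *: e q.2).
Proof.
move=> hs he; have ht : all_D [seq q.2 | q <- s] by move=> _ /mapP[q /hs Dq ->].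
have : forall q, q \in s -> q.2 \in [seq q.2 | q <- s] by move=> q; exact: map_f.
move: ht; set t := [seq q.2 | q <- s] => ht; have Wt x : x \in t -> W (e x).
  by move=> /ht/he[].
suff h r : (forall q, q \in r -> q.2 \in t) ->
    W (\sum_(q <- r) q.1 *: e q.2) /\ killed t (\sum_(q <- r) q.1 *: e q.2).
  by move=> /h[].
elim: r => [|q r IH] hr; first by rewrite big_nil; split => //; exact: killed0.
have qt := hr q (mem_head _ _); have Wq := Wt _ qt; have [_ Pq] := he _ (ht _ qt).
have [|W' k'] := IH; first by move=> w wr; apply: hr; rewrite in_cons wr orbT.
rewrite big_cons; split; first by apply: WD => //; exact: WZ.
apply: killedD => //; first exact: WZ.
by apply: killedZ => //; apply: killed_resid (ht) (qt) (Wq) _; rewrite /resid Pq subrr.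
Qed.

End CommutingProjections.

(** * Equivariant functions and the Hecke algebra *)

Section TwistedFunctions.
Context (R : realType) (G : topGroupType).
Local Notation borel := (g_sigma_algebraType (@open G)).
Variables (mu : {measure set borel -> \bar R}) (hmu : haar_measure mu).
Variables (Delta : G -> R) (hDelta : modular_function mu Delta).
Variables (H K D : set G) (sigma : G -> R[i]).
Hypotheses (sH : is_subgroup H) (oH : open H) (cH : compact H) (muH : mu H = 1%E).
Hypotheses (sK : is_subgroup K) (oK : open K) (KH : K `<=` H).
Hypotheses (sD : is_subgroup D) (HD : H `<=` D).
Hypothesis sigmaM : forall h k, H h -> H k -> sigma (h * k)%g = sigma h * sigma k.
Hypothesis sigma_unitary : forall h, H h -> `|sigma h| = 1.
Hypothesis sigmaK : forall k, K k -> sigma k = 1.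

Let clH : closed H. Proof. exact: open_subgroup_closed. Qed.

Definition supported (f : G -> R[i]) (s : seq G) :=
  forall x, f x != 0 -> exists2 z, z \in s & H (z^-1 * x)%g.

Lemma near_lcoset (L : set G) (x : G) : is_subgroup L -> open L ->
  \forall y \near x, L (x^-1 * y)%g.
Proof.
move=> sL oL; apply: open_nbhs_nbhs; split; first exact: open_preml.
by rewrite /= mulVg; exact: subgroup1.
Qed.

Lemma near_rcoset (L : set G) (x : G) : is_subgroup L -> open L ->
  \forall y \near x, L (y * x^-1)%g.
Proof.
move=> sL oL; apply: open_nbhs_nbhs; split; first exact: open_premr.
by rewrite /= mulgV; exact: subgroup1.
Qed.

Lemma compact_cosets (s : seq G) :
  compact [set x | exists2 z, z \in s & H (z^-1 * x)%g].
Proof.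
elim: s => [|z s IH].
  by rewrite (_ : [set x | _] = set0); [exact: compact0 | rewrite -subset0 => x []].
rewrite (_ : [set x | _] = [set (z * y)%g | y in H] `|`
    [set x | exists2 z, z \in s & H (z^-1 * x)%g]).
  by apply: compactU => //; exact: compact_lcoset.
rewrite lcosetE; apply/seteqP; split=> x /=.
  by move=> [w]; rewrite in_cons => /predU1P[->|ws] Hw; [left | right; exists w].
by move=> [Hz|[w ws Hw]]; [exists z => //; exact: mem_head |
  exists w => //; rewrite in_cons ws orbT].
Qed.

Lemma closed_cosets (s : seq G) :
  closed [set x | exists2 z, z \in s & H (z^-1 * x)%g].
Proof.
elim: s => [|z s IH].
  by rewrite (_ : [set x | _] = set0); [exact: closed0 | rewrite -subset0 => x []].
rewrite (_ : [set x | _] = [set x | H (z^-1 * x)%g] `|`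
    [set x | exists2 z, z \in s & H (z^-1 * x)%g]).
  apply: closedU => //; have /continuous_closedP := @mulgl_continuous _ (z^-1)%g.
  exact.
apply/seteqP; split=> x /=.
  by move=> [w]; rewrite in_cons => /predU1P[->|ws] Hw; [left | right; exists w].
by move=> [Hz|[w ws Hw]]; [exists z => //; exact: mem_head |
  exists w => //; rewrite in_cons ws orbT].
Qed.

Lemma Cc_supported (f : G -> R[i]) (s : seq G) :
  continuous (f : G -> R[i]^o) -> (forall z, z \in s -> D z) -> supported f s ->
  Cc D f.
Proof.
move=> cf sDs fs; split => //.
  apply: (subclosed_compact _ (@compact_cosets s)); first exact: closed_closure.
  by apply: subset_trans (closureS fs) _; rewrite -(closure_id _).1 //; exact: closed_cosets.
move=> x nDx; apply/eqP; apply: contrapT => /negP/fs[z /sDs Dz Hzx]; apply: nDx.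
by rewrite -[x](mulVKg z); apply: subgroupM => //; exact: HD.
Qed.

Lemma continuous_rinv (f : G -> R[i]) (L : set G) : is_subgroup L -> open L ->
  (forall x l, L l -> f (x * l)%g = f x) -> continuous (f : G -> R[i]^o).
Proof.
move=> sL oL fL; apply: continuous_near_const => x.
by apply: filterS (near_lcoset x sL oL) => y /(fL x); rewrite mulVKg.
Qed.

Lemma sigma1 : sigma 1%g = 1. Proof. by apply: sigmaK; exact: subgroup1. Qed.

Lemma sigmaV h : H h -> sigma h * sigma h^-1%g = 1.
Proof. by move=> hh; rewrite -sigmaM ?subgroupVE // mulgV sigma1. Qed.

(* These are the elements of C_c(D) p: see twisted_Cc and Cc_twisted. *)
Definition twisted (xi : G -> R[i]) :=
  (forall x h, H h -> xi (x * h)%g = xi x * sigma h) /\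
  exists s : seq G, (forall z, z \in s -> D z) /\ supported xi s.

Lemma twisted_Cc xi : twisted xi -> Cc D xi.
Proof.
move=> [xih [s [sDs xis]]]; apply: Cc_supported sDs xis.
apply: (continuous_rinv sK oK) => x k hk.
by rewrite xih ?sigmaK ?mulr1 //; exact: KH.
Qed.

Lemma Cc_twisted xi : Cc D xi ->
  (forall x h, H h -> xi (x * h)%g = xi x * sigma h) -> twisted xi.
Proof.
move=> cxi xih; split=> //; have [s [fs hs]] := Cc_cover cxi sH oH.
exists s; split=> // z /fs; case: cxi => _ _ xi0.
by move=> n0; apply: contrapT => /xi0 e; rewrite e eqxx in n0.
Qed.

Lemma twisted0 : twisted 0.
Proof.
split=> [x h _|]; first by rewrite /= mul0r.
by exists [::]; split=> // x; rewrite eqxx.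
Qed.

Lemma twistedD xi eta : twisted xi -> twisted eta -> twisted (xi + eta).
Proof.
move=> [h1 [s [d1 s1]]] [h2 [t [d2 s2]]]; split.
  by move=> x h hh; rewrite !fctE h1 // h2 // mulrDl.
exists (s ++ t); split=> [z|x]; first by rewrite mem_cat => /orP[/d1|/d2].
rewrite fctE; have [e|/s1[z zs Hz] _] := eqVneq (xi x) 0.
  by rewrite e add0r => /s2[z zt Hz]; exists z => //; rewrite mem_cat zt orbT.
by exists z => //; rewrite mem_cat zs.
Qed.

Lemma twistedZ (a : R[i]) xi : twisted xi -> twisted (a *: xi).
Proof.
move=> [h1 [s [d1 s1]]]; split.
  by move=> x h hh; rewrite !fctE h1 // scalerAl.
exists s; split=> // x; rewrite !fctE; have [->|/s1 //] := eqVneq (xi x) 0.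
by rewrite scaler0 eqxx.
Qed.

Lemma twisted_ltrans z xi : D z -> twisted xi -> twisted (ltrans z xi).
Proof.
move=> Dz [h1 [s [d1 s1]]]; split.
  by move=> x h hh; rewrite /ltrans mulgA h1.
exists [seq (z * y)%g | y <- s]; split=> [w /mapP[y /d1 Dy ->]|x].
  exact: subgroupM.
rewrite /ltrans => /s1[y ys Hy]; exists (z * y)%g; first exact: map_f.
by rewrite invgM -mulgA.
Qed.

(** On a coset z H, l z h = z (z^-1 l z) h, and sigma is trivial on K. So the intersection of H with
    the z K z^-1, for z in the finite list supporting xi, will do. *)
Lemma twisted_linv xi : twisted xi -> exists L : set G,
  [/\ is_subgroup L, open L, L `<=` H & forall l x, L l -> xi (l * x)%g = xi x].
Proof.
move=> [xih [s [_ xis]]].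
suff [L [sL oL LH hL]] : exists L : set G, [/\ is_subgroup L, open L, L `<=` H &
    forall z l, z \in s -> L l -> K (z^-1 * l * z)%g].
  exists L; split=> // l x Ll.
  have key z y : z \in s -> H (z^-1 * y)%g -> xi (l * y)%g = xi y.
    move=> zs Hzy; pose h := (z^-1 * y)%g; have -> : y = (z * h)%g by rewrite mulVKg.
    have Kl := hL _ _ zs Ll; rewrite (xih z h) //.
    have -> : (l * (z * h) = z * (z^-1 * l * z * h))%g by rewrite !mulgA mulgV mul1g.
    rewrite xih ?(sigmaM (KH Kl) Hzy) ?(sigmaK Kl) ?mul1r //.
    by apply: subgroupM => //; exact: KH.
  have [x0|/xis[z zs Hzx]] := eqVneq (xi x) 0; last exact: key zs Hzx.
  (* If xi (l x) were nonzero, l x would lie in a listed coset, and so would x, because l preserves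
     that coset. *)
  rewrite x0; apply/eqP; apply: contrapT => /negP lx0.
  have [z zs Hzx] := xis _ lx0; move: lx0; rewrite (key z x) // ?x0 ?eqxx //.
  have -> : (z^-1 * x = (z^-1 * l * z)^-1 * (z^-1 * (l * x)))%g.
    by rewrite !invgM invgK !mulgA mulgK mulgVK.
  have hl : H (z^-1 * l * z)%g by apply: KH; exact: hL.
  by apply: subgroupM (subgroupV sH hl) Hzx.
elim: s {xis} => [|z s [L [sL oL LH hL]]]; first by exists H; split.
exists (L `&` conj_set z K); split.
- by apply: subgroupI => //; exact: subgroup_conj.
- apply: openI => //; rewrite (_ : conj_set z K = [set x | K (z^-1 * x * z)%g]).
    exact: (@open_preml _ z^-1%g [set x | K (x * z)%g]) (open_premr z oK).
  by apply/funext => y; rewrite conj_setE.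
- by move=> x [/LH].
move=> w l; rewrite in_cons => /predU1P[-> [_]|ws [Ll _]]; last exact: hL.
by rewrite conj_setE.
Qed.

(** * Normalised characters of open subgroups *)

Section Bump.
Variable L : set G.
Hypotheses (sL : is_subgroup L) (oL : open L) (LH : L `<=` H).

Lemma haar_subgroup_lty : (mu L < +oo)%E.
Proof.
apply: (@le_lt_trans _ _ (mu H)); last by rewrite muH ltry.
by apply: le_measure => //; rewrite inE; apply: open_borel.
Qed.

Definition mass : R := fine (mu L).

Lemma massE : mu L = mass%:E.
Proof. by rewrite fineK // ge0_fin_numE //; exact: haar_subgroup_lty. Qed.

(** Finitely many translates of L cover the compact set H, which has measure 1. *)
Lemma mass_gt0 : 0 < mass.
Proof.
have mL : measurable (L : set borel) by exact: open_borel.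
rewrite -lte_fin -massE lt_neqAle measure_ge0 andbT eq_sym.
apply: contrapT => /negP; rewrite negbK => /eqP mu0.
have [s hs] : exists s : seq G,
    H `<=` [set x | exists2 z, z \in s & L (z^-1 * x)%g].
  move: cH; rewrite compact_cover => /(_ G H (fun z => [set x | L (z^-1 * x)%g]))[].
  - by move=> z _; exact: open_preml.
  - by move=> x hx; exists x => //=; rewrite mulVg; exact: subgroup1.
  move=> D' _ hD'; exists (finmap.enum_fset D') => x /hD'[z zD' Lz].
  by exists z.
suff h0 : measurable ([set x | exists2 z, z \in s & L (z^-1 * x)%g] : set borel) /\
    mu [set x | exists2 z, z \in s & L (z^-1 * x)%g] = 0%E.
  have : (mu H <= 0)%E.
    case: h0 => mS <-; apply: le_measure => //; rewrite inE //; exact: open_borel.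
  by rewrite muH lee_fin ler10.
elim: s {hs} => [|z s [mS S0]].
  rewrite (_ : [set x | _] = set0) ?measure0 //.
  by rewrite -subset0 => x [].
have mz : measurable ([set x | L (z^-1 * x)%g] : set borel).
  by apply: open_borel; exact: open_preml.
have -> : [set x | exists2 w, w \in z :: s & L (w^-1 * x)%g] =
    [set x | L (z^-1 * x)%g] `|` [set x | exists2 z, z \in s & L (z^-1 * x)%g].
  apply/seteqP; split=> x /=.
    by move=> [w]; rewrite in_cons => /predU1P[->|ws] Hw; [left | right; exists w].
  by move=> [Hz|[w ws Hw]]; [exists z => //; exact: mem_head |
  exists w => //; rewrite in_cons ws orbT].
split; first exact: measurableU.
apply/eqP; rewrite eq_le measure_ge0 andbT.
apply: le_trans (measureU2 _ mz mS) _.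
rewrite [X in (_ + X <= _)%E]S0 adde0 [X in (X <= _)%E](haar_lcoset hmu) ?mu0 //.
Qed.

Variable tau : G -> R[i].

(** With tau = 1 and L small this stands in for a point mass at 1; with tau = sigma and L = H it is
    p. *)
Definition bump : G -> R[i] := fun y => if y \in L then mass^-1%:C * tau y else 0.

Lemma convolution_bump z phi y :
  (forall l x, L l -> tau l * phi (l^-1 * x)%g = phi x) ->
  convolution mu (ltrans z bump) phi y = ltrans z phi y.
Proof.
move=> hphi; pose E := [set t | L (z^-1 * t)%g].
have mE : measurable (E : set borel) by apply: open_borel; exact: open_preml.
have muE : mu E = mass%:E by rewrite (haar_lcoset hmu) ?massE //; exact: open_borel.
rewrite /convolution (_ : (fun t => _) =
    restr E (fun=> mass^-1%:C * phi (z^-1 * y)%g)); last first.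
  apply/funext => t; rewrite /ltrans /bump /restr.
  have -> : ((z^-1 * t)%g \in L) = (t \in E) by apply/idP/idP; rewrite !inE.
  case: ifP => [|_]; last by rewrite mul0r.
  rewrite inE => Lt; rewrite -mulrA -(hphi _ (z^-1 * y)%g Lt); congr (_ * (_ * phi _)).
  by rewrite invgM invgK -!mulgA mulVKg.
rewrite cintegral_step ?muE ?ltry //= mulrA -rmorphM mulfV ?rmorph1 ?mul1r //.
by rewrite gt_eqF // mass_gt0.
Qed.

(** The integrand is constant on L z^-1, whose measure is that of L divided by Delta z; the factor
    Delta z from the involution cancels this, Delta being trivial on H. *)
Lemma convolution_involution_bump z :
  (forall l y, L l -> L y -> (tau l^-1%g)^* * tau (l^-1 * y)%g = tau y) ->
  convolution mu (involution Delta (ltrans z bump)) (ltrans z bump) = bump.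
Proof.
move=> htau; apply/funext => y; pose E := [set t | L (t * z)%g].
have mE : measurable (E : set borel) by apply: open_borel; exact: open_premr.
have muE : mu E = ((Delta z)^-1 * mass)%:E.
  rewrite (_ : E = [set t | L (t * (z^-1)^-1)%g]); last by rewrite /E invgK.
  rewrite (haar_rcoset hDelta) ?massE; last exact: open_borel.
  by rewrite (modularV hDelta sH oH muH).
have D0 : Delta z != 0 by rewrite gt_eqF // (modular_gt0 hDelta).
have m0 : mass != 0 by rewrite gt_eqF // mass_gt0.
rewrite /convolution (_ : (fun t => _) = restr E
   (fun=> (Delta z)%:C * mass^-1%:C * bump y)); last first.
  apply/funext => t; rewrite /involution /ltrans /restr.
  have e1 : ((z^-1 * t^-1)%g \in L) = (t \in E).
    by apply/idP/idP; rewrite !inE /E /= -invgM (subgroupVE _ sL).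
  rewrite /bump e1; case: ifP => [|_]; last by rewrite conjE conjc0 mulr0 mul0r.
  rewrite inE /E /= => Lt; have tz : (z^-1 * t^-1 = (t * z)^-1)%g by rewrite invgM.
  have e2 : ((z^-1 * (t^-1 * y))%g \in L) = (y \in L).
    by rewrite mulgA tz; apply/idP/idP; rewrite !inE (subgroupMl _ sL) // (subgroupVE _ sL).
  rewrite e2; case: ifP => [|_]; last by rewrite !mulr0.
  rewrite inE => Ly; rewrite mulgA tz -(htau _ _ Lt Ly).
  rewrite rmorphM /= conjE conjc_real.
  have -> : Delta t^-1%g = Delta z.
    have -> : t^-1%g = (z * (t * z)^-1)%g by rewrite invgM mulVKg.
    have Htz : H (t * z)^-1%g by apply: LH; exact: subgroupV.
    by rewrite (modular_mul hDelta oH muH) (modular_on hDelta sH oH muH Htz) mulr1.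
  ring.
rewrite cintegral_step ?muE ?ltry //= mulrA.
have -> : ((Delta z)^-1 * mass)%:C * ((Delta z)%:C * mass^-1%:C) = 1 :> R[i].
  by rewrite -!rmorphM mulrACA mulVf // mulfV // mulr1 rmorph1.
by rewrite mul1r.
Qed.

End Bump.

Lemma muH1 : mass H = 1. Proof. by rewrite /mass muH. Qed.

Lemma bumpH : bump H sigma = sigma_projection H sigma.
Proof. by apply/funext => x; rewrite /bump muH1 invr1 mul1r. Qed.

Local Notation p := (sigma_projection H sigma).

Lemma twisted_p : twisted p.
Proof.
split=> [x h hh|]; rewrite /sigma_projection.
  have -> : ((x * h)%g \in H) = (x \in H) by apply: mem_set_eq; exact: subgroupMr.
  by case: ifP => [|_]; [rewrite inE => Hx; exact: sigmaM | rewrite mul0r].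
exists [:: 1%g]; split=> [z|x]; first by rewrite inE => /eqP ->; exact: subgroup1.
case: ifP => [|_]; last by rewrite eqxx.
by rewrite inE => Hx _; exists 1%g; rewrite ?mem_head // invg1 mul1g.
Qed.

Lemma convolution_p xi : twisted xi -> convolution mu xi p = xi.
Proof.
move=> [xih _]; apply/funext => y; pose E := [set t | H (y^-1 * t)%g].
have mE : measurable (E : set borel) by apply: open_borel; exact: open_preml.
have muE : mu E = 1%E by rewrite (haar_lcoset hmu) //; exact: open_borel.
rewrite /convolution (_ : (fun t => _) = restr E (fun=> xi y)); last first.
  apply/funext => t; rewrite /sigma_projection /restr.
  have -> : ((t^-1 * y)%g \in H) = (t \in E).
    by apply/idP/idP; rewrite !inE /E /= => /(subgroup_divC sH).
  case: ifP => [|_]; last by rewrite mulr0.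
  rewrite inE /E /= => /(subgroup_divC sH) Ht.
  by rewrite -xih // mulVKg.
by rewrite cintegral_step ?muE ?ltry // mul1r.
Qed.

Lemma ltrans_p_convolution z phi :
  (forall h x, H h -> phi (h * x)%g = sigma h * phi x) ->
  convolution mu (ltrans z p) phi = ltrans z phi.
Proof.
move=> hphi; apply/funext => y; rewrite -bumpH; apply: convolution_bump => //.
by move=> h x hh; rewrite hphi ?subgroupVE // mulrA sigmaV // mul1r.
Qed.

Lemma convolution_involution_p z :
  convolution mu (involution Delta (ltrans z p)) (ltrans z p) = p.
Proof.
rewrite -bumpH; apply: convolution_involution_bump => //.
move=> l y hl hy; have hl' := subgroupV sH hl.
by rewrite sigmaM // mulrA [_^* * _]mulrC -normCK sigma_unitary // expr1n mul1r.
Qed.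

(** Both functions get the same list of translations, which is what makes operators comparable on
    them; P records where the translations come from. *)
Lemma convolution_twisted (P : G -> Prop) f xi eta :
  Cc D f -> (forall x, f x != 0 -> P x) -> twisted xi -> twisted eta ->
  exists s : seq (R[i] * G), [/\ forall q, q \in s -> P q.2,
    \sum_(q <- s) cabs q.1 <= L1norm mu f,
    convolution mu f xi = \sum_(q <- s) q.1 *: ltrans q.2 xi &
    convolution mu f eta = \sum_(q <- s) q.1 *: ltrans q.2 eta].
Proof.
move=> cf fP /twisted_linv[L1 [sL1 oL1 _ h1]] /twisted_linv[L2 [sL2 oL2 _ h2]].
have sL := subgroupI sL1 sL2; have oL := openI oL1 oL2.
have [s0 [fs0 hs0]] := Cc_cover cf sL oL.
have [s [ss0 les hs]] := convolution_finite sL oL (Cc_cintegrable hmu cf) hs0.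
exists s; split=> //.
- by move=> q /ss0/fs0/fP.
- have h l x : (L1 `&` L2) l -> xi (l * x)%g = xi x by move=> [? _]; exact: h1.
  by apply/funext => y; rewrite fct_sumE; have [_ ->] := hs xi h y.
- have h l x : (L1 `&` L2) l -> eta (l * x)%g = eta x by move=> [_ ?]; exact: h2.
  by apply/funext => y; rewrite fct_sumE; have [_ ->] := hs eta h y.
Qed.

Lemma twisted_sum (s : seq (R[i] * G)) xi : twisted xi ->
  (forall q, q \in s -> D q.2) -> twisted (\sum_(q <- s) q.1 *: ltrans q.2 xi).
Proof.
move=> txi; elim: s => [|q s IH] hs; first by rewrite big_nil; exact: twisted0.
rewrite big_cons; apply: twistedD.
  by apply: twistedZ; apply: twisted_ltrans => //; apply: hs; exact: mem_head.
by apply: IH => r rs; apply: hs; rewrite in_cons rs orbT.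
Qed.

Lemma twisted_convolution f xi : Cc D f -> twisted xi ->
  twisted (convolution mu f xi).
Proof.
move=> cf txi; have [|s [hs _ -> _]] := @convolution_twisted D f xi xi cf _ txi txi.
  by move=> x fx; apply: contrapT => nD; case: cf fx => _ _ /(_ _ nD) ->; rewrite eqxx.
exact: twisted_sum.
Qed.

Lemma twisted_span xi : twisted xi -> exists s : seq (R[i] * G),
  (forall q, q \in s -> D q.2) /\ xi = \sum_(q <- s) q.1 *: ltrans q.2 p.
Proof.
move=> [xih [s [sD' xis]]]; elim: s xi xih sD' xis => [|z s IH] xi xih sDs xis.
  exists [::]; split=> //; rewrite big_nil; apply/funext => x.
  by apply/eqP; apply: contrapT => /negP/xis[].
(* On z H the function xi is determined by its value at z, so this subtraction removes the whole
   coset from the support. *)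
pose eta := xi - xi z *: ltrans z p.
have Dz : D z by apply: sDs; exact: mem_head.
have tz : twisted (ltrans z p) by apply: twisted_ltrans => //; exact: twisted_p.
have [|||s' [sD' es']] := IH eta.
- move=> x h hh; rewrite /eta !fctE xih // (tz.1 x h hh) mulrBl.
  by rewrite -scalerAl.
- by move=> w ws; apply: sDs; rewrite in_cons ws orbT.
- move=> x; rewrite /eta !fctE /ltrans /sigma_projection.
  case: ifP => [|nH].
    rewrite inE => Hzx; have -> : xi x = xi z * sigma (z^-1 * x)%g.
      by rewrite -xih // mulVKg.
    by rewrite subrr eqxx.
  rewrite scaler0 subr0 => /xis[w]; rewrite in_cons => /predU1P[->|ws] Hw.
    by rewrite mem_set in nH.
  by exists w.
exists ((xi z, z) :: s'); split.
  by move=> q; rewrite in_cons => /predU1P[->|/sD'].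
by rewrite big_cons -es' /eta addrCA subrr addr0.
Qed.

Lemma involution_Cc f : Cc D f -> Cc D (involution Delta f).
Proof.
move=> [cf cS f0]; split.
- have cD : continuous (fun x => (Delta x^-1%g)%:C : R[i]^o).
    (* Delta is a homomorphism trivial on the open subgroup H, hence locally constant. *)
    apply: continuous_near_const => x.
    apply: filterS (near_rcoset x sH oH) => y Hy; congr (_ %:C).
    have -> : y^-1%g = (x^-1 * (y * x^-1)^-1)%g by rewrite invgM invgK mulKg.
    rewrite (modular_mul hDelta oH muH).
    by rewrite (modular_on hDelta sH oH muH (subgroupV sH Hy)) mulr1.
  have cfi : continuous (fun x => (Num.conj (f x^-1%g)) : R[i]^o).
    move=> x; have cfV : (f y^-1%g : R[i]^o) @[y --> x] --> (f x^-1%g : R[i]^o).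
      exact: (@continuous_comp _ _ _ _ (f : G -> R[i]^o) x (@invg_continuous G x) (cf _)).
    apply/cvgrPdist_lt => e e0; have /cvgrPdist_lt/(_ e e0) := cfV.
    by apply: filterS => y; rewrite -rmorphB norm_conjC.
  move=> x; exact: (@continuousM _ _ (fun x => (Delta x^-1%g)%:C) _ x (cD x) (cfi x)).
- have cSV : compact [set x : G | closure [set x | f x != 0] x^-1%g].
    rewrite (_ : [set x | _] = [set x^-1%g | x in closure [set x | f x != 0]]).
      exact: continuous_compact (continuous_subspaceT (@invg_continuous G)) cS.
    apply/seteqP; split=> [x hx|_ [x hx <-]] /=; last by rewrite invgK.
    by exists x^-1%g; rewrite ?invgK.
  apply: subclosed_compact cSV _; first exact: closed_closure.
  move=> x; apply: closure_inv => y /=; apply: contra_neq => e.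
  by rewrite /involution e conjE conjc0 mulr0.
- move=> x nDx; rewrite /involution f0 ?conjE ?conjc0 ?mulr0 //.
  by rewrite subgroupVE.
Qed.

(** * The module and the Hecke algebra inside the C*-algebra *)

Section Corner.
Variables (A : cstarAlgType R) (iota : (G -> R[i]) -> A).
Hypothesis hiota :
  cstar_completion (Cc D) (convolution mu) (involution Delta) [set: A] iota.
Hypothesis hecke_Cc : hecke_algebra H sigma `<=` Cc D.

Local Notation hecke := (hecke_algebra H sigma).
Local Notation "f \* g" := (convolution mu f g).

Let ihom := ccompl_hom hiota.

Lemma iota_inj f g : Cc D f -> Cc D g -> iota f = iota g -> f = g.
Proof. by move=> cf cg; apply: (ccompl_inj hiota); rewrite inE. Qed.

Lemma iotaM f g : Cc D f -> Cc D g -> iota (f \* g) = cmul (iota f) (iota g).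
Proof. exact: (star_homM ihom). Qed.

Lemma iotaD f g : Cc D f -> Cc D g -> iota (f + g) = iota f + iota g.
Proof. exact: (star_homD ihom). Qed.

Lemma iotaZ a f : Cc D f -> iota (a *: f) = a *: iota f.
Proof. exact: (star_homZ ihom). Qed.

Lemma iotaS f : Cc D f -> iota (involution Delta f) = cstar (iota f).
Proof. exact: (star_homS ihom). Qed.

Lemma twisted_iota xi : twisted xi -> cmul (iota xi) (iota p) = iota xi.
Proof.
move=> txi; rewrite -iotaM ?convolution_p //; apply: twisted_Cc => //.
exact: twisted_p.
Qed.

Lemma cCp : Cc D p. Proof. exact: twisted_Cc twisted_p. Qed.

Lemma twisted_e z : D z -> twisted (ltrans z p).
Proof. by move=> Dz; apply: twisted_ltrans => //; exact: twisted_p. Qed.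

Lemma ltransM x y (phi : G -> R[i]) : ltrans (x * y) phi = ltrans x (ltrans y phi).
Proof. by apply/funext => t; rewrite /ltrans invgM mulgA. Qed.

Lemma ltrans1 (phi : G -> R[i]) : ltrans 1 phi = phi.
Proof. by apply/funext => t; rewrite /ltrans invg1 mul1g. Qed.

Lemma iota_eE z : D z -> cmul (cstar (iota (ltrans z p))) (iota (ltrans z p)) = iota p.
Proof.
move=> Dz; have ce := twisted_Cc (twisted_e Dz).
by rewrite -iotaS // -iotaM ?convolution_involution_p //; exact: involution_Cc.
Qed.

Lemma iota_p_star : cstar (iota p) = iota p.
Proof.
have h := iota_eE (subgroup1 sD); rewrite ltrans1 in h.
by rewrite -h cstarM cstarK.
Qed.

Lemma iota_p_idem : cmul (iota p) (iota p) = iota p.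
Proof. exact/twisted_iota/twisted_p. Qed.

Definition lequiv (phi : G -> R[i]) :=
  forall h x, H h -> phi (h * x)%g = sigma h * phi x.

Lemma heckeE f : hecke f <-> twisted f /\ lequiv f.
Proof.
split=> [hf|[tf lf]].
  have cf := hecke_Cc hf; case: hf => _ hf; split.
    apply: Cc_twisted => // x h hh; have := hf 1%g h x (subgroup1 sH) hh.
    by rewrite mul1g sigma1 mul1r.
  move=> h x hh; have := hf h 1%g x hh (subgroup1 sH).
  by rewrite mulg1 sigma1 mulr1.
split; last by move=> h k x hh hk; rewrite (tf.1 _ _ hk) lf.
by case: (twisted_Cc tf) => ? ? _; split => // x /(_ I).
Qed.

Lemma hecke_twisted f : hecke f -> twisted f. Proof. by move=> /heckeE[]. Qed.
Lemma hecke_lequiv f : hecke f -> lequiv f. Proof. by move=> /heckeE[]. Qed.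

Lemma hecke_p : hecke p.
Proof.
apply/heckeE; split; first exact: twisted_p.
move=> h x hh; rewrite /sigma_projection.
have -> : ((h * x)%g \in H) = (x \in H) by apply: mem_set_eq; exact: subgroupMl.
by case: ifP => [|_]; [rewrite inE => Hx; exact: sigmaM | rewrite mulr0].
Qed.

(* u is the image of the normalised indicator function of z L, for L small
   enough. *)
Lemma ltrans_operator z xi eta : D z -> twisted xi -> twisted eta ->
  exists u : A, [/\ cmul u (iota xi) = iota (ltrans z xi),
    cmul u (iota eta) = iota (ltrans z eta) &
    cmul (cstar (cmul u (iota xi))) (cmul u (iota eta)) =
      cmul (cstar (iota xi)) (iota eta)].
Proof.
move=> Dz txi teta.
have [L1 [sL1 oL1 LH1 h1]] := twisted_linv txi.
have [L2 [sL2 oL2 _ h2]] := twisted_linv teta.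
pose L := L1 `&` L2; have sL : is_subgroup L := subgroupI sL1 sL2.
have oL : open L := openI oL1 oL2; have LH : L `<=` H by move=> l [/LH1].
pose b := bump L (fun=> 1).
have cb w : D w -> Cc D (ltrans w b).
  move=> Dw; apply: (@Cc_supported _ [:: w]).
  - apply: (continuous_rinv sL oL) => x l Ll; rewrite /ltrans /b /bump mulgA.
    have -> : ((w^-1 * x * l)%g \in L) = ((w^-1 * x)%g \in L).
      by apply: mem_set_eq; exact: subgroupMr.
    by [].
  - by move=> y; rewrite inE => /eqP ->.
  - move=> x; rewrite /ltrans /b /bump; case: ifP => [|_]; last by rewrite eqxx.
    by rewrite inE => /LH Hx _; exists w; rewrite ?mem_head.
have cz := cb z Dz; have c1 := cb 1%g (subgroup1 sD).
have bxi w : ltrans w b \* xi = ltrans w xi.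
  apply/funext => y; apply: convolution_bump => // l x [Ll _].
  by rewrite mul1r h1 //; exact: subgroupV.
have beta w : ltrans w b \* eta = ltrans w eta.
  apply/funext => y; apply: convolution_bump => // l x [_ Ll].
  by rewrite mul1r h2 //; exact: subgroupV.
have cxi := twisted_Cc txi; have ceta := twisted_Cc teta.
exists (iota (ltrans z b)); split; [by rewrite -iotaM // bxi | by rewrite -iotaM // beta |].
rewrite cstarM -cmulA; congr cmul; rewrite cmulA -iotaS // -iotaM //; last exact: involution_Cc.
rewrite convolution_involution_bump //; last by move=> l y _ _; rewrite conjE conjc1 mulr1.
by rewrite -/b -(ltrans1 b) -iotaM // beta ltrans1.
Qed.

Lemma ltrans_unitary z xi eta : D z -> twisted xi -> twisted eta ->
  cmul (cstar (iota (ltrans z xi))) (iota (ltrans z eta)) =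
  cmul (cstar (iota xi)) (iota eta).
Proof. by move=> Dz txi teta; have [u [<- <- ->]] := ltrans_operator Dz txi teta. Qed.

(** A single u in A realises the translation on both phi and its convolution with zeta, so this is
    associativity in A. *)
Lemma ltrans_convolution z phi zeta : D z -> twisted phi -> twisted zeta ->
  ltrans z (phi \* zeta) = ltrans z phi \* zeta.
Proof.
move=> Dz tphi tzeta; have cphi := twisted_Cc tphi; have czeta := twisted_Cc tzeta.
have tpz := twisted_convolution cphi tzeta.
have tz := twisted_ltrans Dz tphi.
apply: iota_inj.
- exact/twisted_Cc/twisted_ltrans.
- by apply/twisted_Cc/twisted_convolution => //; exact: twisted_Cc.
have [u [u1 u2 _]] := ltrans_operator Dz tphi tpz.
rewrite -u2 iotaM // cmulA u1 iotaM //; exact: twisted_Cc.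
Qed.

(** Translating p by h^-1 multiplies it by sigma h, and translation passes through the convolution p
    * zeta = zeta. *)
Lemma lequiv_of_p zeta : twisted zeta -> p \* zeta = zeta -> lequiv zeta.
Proof.
move=> tz e h x hh; have hV := subgroupV sH hh.
have Dh : D h^-1%g by exact: HD.
have ep : ltrans h^-1 p = sigma h *: p.
  apply/funext => y; rewrite /ltrans invgK fctE.
  exact: hecke_lequiv hecke_p _ _ hh.
have : ltrans h^-1 zeta = sigma h *: zeta.
  rewrite -{1}e ltrans_convolution // ?ep; last exact: twisted_p.
  apply: iota_inj.
  - rewrite -ep; apply/twisted_Cc/twisted_convolution => //; exact/twisted_Cc/twisted_e.
  - exact/twisted_Cc/twistedZ.
  have cz := twisted_Cc tz.
  rewrite iotaM ?iotaZ //; first by rewrite cmulZl -iotaM ?e //; exact: cCp.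
  - exact: cCp.
  - by rewrite -ep; exact/twisted_Cc/twisted_e.
by move/(congr1 (fun f => f x)); rewrite /ltrans invgK fctE.
Qed.

Definition inner xi eta := involution Delta xi \* eta.

Lemma iota_inner xi eta : twisted xi -> twisted eta ->
  iota (inner xi eta) = cmul (cstar (iota xi)) (iota eta).
Proof.
move=> /twisted_Cc cxi /twisted_Cc ceta; rewrite /inner iotaM ?iotaS //.
exact: involution_Cc.
Qed.

(** Right equivariance comes from eta; on the left, p xi^* = (xi p)^* = xi^*. *)
Lemma hecke_inner xi eta : twisted xi -> twisted eta -> hecke (inner xi eta).
Proof.
move=> txi teta; have ti : twisted (inner xi eta).
  by apply: twisted_convolution => //; exact/involution_Cc/twisted_Cc.
apply/heckeE; split => //; apply: lequiv_of_p => //.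
apply: iota_inj; [|exact: twisted_Cc|].
  by apply/twisted_Cc/twisted_convolution => //; exact: cCp.
rewrite iotaM ?iota_inner //; [|exact: cCp|exact: twisted_Cc].
by rewrite cmulA -{1}iota_p_star -cstarM twisted_iota.
Qed.

Lemma iota_e_lequiv z phi : D z -> twisted phi -> lequiv phi ->
  cmul (iota (ltrans z p)) (iota phi) = iota (ltrans z phi).
Proof.
move=> Dz tphi lphi; rewrite -iotaM ?ltrans_p_convolution //; last exact: twisted_Cc.
exact/twisted_Cc/twisted_e.
Qed.

(* The projection onto the submodule generated by ltrans x p. *)
Definition proj x xi := ltrans x p \* inner (ltrans x p) xi.

Lemma twisted_proj x xi : D x -> twisted xi -> twisted (proj x xi).
Proof.
move=> Dx txi; apply: twisted_convolution; first exact/twisted_Cc/twisted_e.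
by apply/hecke_twisted/hecke_inner => //; exact: twisted_e.
Qed.

Lemma iota_proj x xi : D x -> twisted xi ->
  iota (proj x xi) =
  cmul (iota (ltrans x p)) (cmul (cstar (iota (ltrans x p))) (iota xi)).
Proof.
move=> Dx txi; have te := twisted_e Dx; rewrite /proj iotaM ?iota_inner //.
  exact: twisted_Cc.
by apply/twisted_Cc/hecke_twisted/hecke_inner.
Qed.

(** * Commuting projections, from a normal subgroup fixing p *)

Section Normal.
Variable M : set G.
Hypotheses (sM : is_subgroup M) (nM : forall g z, M z -> M (g * z * g^-1)%g).
Hypothesis HM : H `<=` M.
Hypothesis Msigma : forall z h, M z -> H h ->
  H (z * h * z^-1)%g /\ sigma (z * h * z^-1)%g = sigma h.

(** Conjugation by z in M preserves H and sigma, so that z p = p z. *)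
Lemma lequiv_e z : M z -> lequiv (ltrans z p).
Proof.
move=> Mz h x hh; have [] := Msigma (subgroupV sM Mz) hh; rewrite invgK => Hh <-.
rewrite /ltrans -(hecke_lequiv hecke_p _ Hh); congr p.
by rewrite !mulgA mulgK.
Qed.

(** For z in M and D, z p is a unitary of the Hecke algebra, with inverse z^-1 p. *)
Lemma iota_e_star z : M z -> D z -> cstar (iota (ltrans z p)) = iota (ltrans z^-1 p).
Proof.
move=> Mz Dz; have DzV := subgroupV sD Dz; have MzV := subgroupV sM Mz.
have e1 : cmul (iota (ltrans z p)) (iota (ltrans z^-1 p)) = iota p.
  rewrite iota_e_lequiv // -?ltransM ?mulgV ?ltrans1 //; first exact: twisted_e.
  exact: lequiv_e.
have pe w : M w -> D w -> cmul (iota p) (iota (ltrans w p)) = iota (ltrans w p).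
  move=> Mw Dw; have := @iota_e_lequiv 1%g (ltrans w p) (subgroup1 sD).
  by rewrite !ltrans1; apply; [exact: twisted_e | exact: lequiv_e].
rewrite -[in LHS](pe z) // cstarM iota_p_star -e1 cmulA iota_eE //.
exact: pe.
Qed.

(** Since z x = x z' with z' = x^-1 z x in M, z x p = (x p)(z' p): the unitary z' p can be read as
    acting on either factor of (x p)(x p)^*, on the left as z before the projection, on the right as
    z after it. *)
Lemma ltrans_proj z x xi : M z -> D z -> D x -> twisted xi ->
  ltrans z (proj x xi) = proj x (ltrans z xi).
Proof.
move=> Mz Dz Dx txi; have te := twisted_e Dx.
have ti := hecke_twisted (hecke_inner te txi).
have tzxi := twisted_ltrans Dz txi.
apply: iota_inj.
- by apply/twisted_Cc/twisted_ltrans => //; exact: twisted_proj.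
- by apply/twisted_Cc/twisted_proj.
pose z' := (x^-1 * z * x)%g.
have Mz' : M z' by have := nM x^-1%g Mz; rewrite invgK.
have Dz' : D z' by apply: subgroupM => //; apply: subgroupM => //; exact: subgroupV.
have Mz'V := subgroupV sM Mz'; have Dz'V := subgroupV sD Dz'.
have e1 : iota (ltrans (z * x) p) = cmul (iota (ltrans x p)) (iota (ltrans z' p)).
  rewrite iota_e_lequiv //; [|exact: twisted_e|exact: lequiv_e].
  by rewrite -ltransM /z' !mulgA mulgV mul1g.
have e2 : iota (ltrans (z^-1 * x) p) = cmul (iota (ltrans x p)) (iota (ltrans z'^-1 p)).
  rewrite iota_e_lequiv //; [|exact: twisted_e|exact: lequiv_e].
  by rewrite -ltransM /z' !invgM invgK !mulgA mulgV mul1g.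
have DzV := subgroupV sD Dz.
have eL : iota (ltrans z (proj x xi)) =
    cmul (iota (ltrans (z * x) p)) (cmul (cstar (iota (ltrans x p))) (iota xi)).
  rewrite /proj ltrans_convolution // iotaM ?iota_inner // -?ltransM //.
    by apply/twisted_Cc/twisted_e; exact: subgroupM.
  exact: twisted_Cc.
have tzx : twisted (ltrans (z^-1 * x) p) by apply: twisted_e; exact: subgroupM.
(* Translating both arguments by z^-1 turns the inner product of x p and z xi into that of z^-1 x p
   and xi. *)
have eU := ltrans_unitary Dz tzx txi; rewrite -ltransM mulVKg in eU.
apply: (etrans eL); apply: (etrans _ (esym (iota_proj Dx tzxi))).
rewrite eU e1 e2 cstarM (iota_e_star Mz'V Dz'V) invgK.
by rewrite !cmulA.
Qed.

(** The operator [proj y] is convolution with y p y^-1, supported in y H y^-1, and this lies in M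
    because M is normal and contains H. *)
Lemma proj_finite y xi eta : D y -> twisted xi -> twisted eta ->
  exists s : seq (R[i] * G), [/\ forall q, q \in s -> M q.2 /\ D q.2,
    proj y xi = \sum_(q <- s) q.1 *: ltrans q.2 xi &
    proj y eta = \sum_(q <- s) q.1 *: ltrans q.2 eta].
Proof.
move=> Dy txi teta; have te := twisted_e Dy.
have cf : Cc D (involution Delta (ltrans y p)) by exact/involution_Cc/twisted_Cc.
(* The adjoint of y p lives on H y^-1; the further translation by y moves this to y H y^-1. *)
have [|s [hs _ e1 e2]] := convolution_twisted (P := fun z => H (y^-1 * z^-1)%g) cf _ txi teta.
  move=> x; rewrite /involution /ltrans /sigma_projection; case: ifP; first by rewrite inE.
  by rewrite conjE conjc0 mulr0 eqxx.
exists [seq (q.1, y * q.2)%g | q <- s]; split.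
- move=> _ /mapP[q /hs Hq ->] /=.
  have Hq' : H (q.2 * y)%g by rewrite -[(q.2 * y)%g]invgK subgroupVE // invgM.
  have -> : (y * q.2 = y * (q.2 * y) * y^-1)%g by rewrite !mulgA mulgK.
  split; first exact/nM/HM.
  apply: subgroupM => //; last exact: subgroupV.
  by apply: subgroupM => //; exact: HD.
- have hi := hecke_inner te txi.
  rewrite /proj ltrans_p_convolution; last exact: hecke_lequiv.
  rewrite /inner e1 big_map; apply/funext => t; rewrite /ltrans !fct_sumE.
  by apply: eq_bigr => q _; rewrite !fctE /ltrans invgM mulgA.
- have hi := hecke_inner te teta.
  rewrite /proj ltrans_p_convolution; last exact: hecke_lequiv.
  rewrite /inner e2 big_map; apply/funext => t; rewrite /ltrans !fct_sumE.
  by apply: eq_bigr => q _; rewrite !fctE /ltrans invgM mulgA.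
Qed.

Lemma projD x xi eta : D x -> twisted xi -> twisted eta ->
  proj x (xi + eta) = proj x xi + proj x eta.
Proof.
move=> Dx txi teta; have tD := twistedD txi teta.
have [t1 t2] := (twisted_proj Dx txi, twisted_proj Dx teta).
apply: iota_inj; [exact/twisted_Cc/twisted_proj|exact/twisted_Cc/twistedD|].
have [c1 c2] := (twisted_Cc t1, twisted_Cc t2).
have [c3 c4] := (twisted_Cc txi, twisted_Cc teta).
apply: (etrans (iota_proj Dx tD)); apply: (etrans _ (esym (iotaD c1 c2))).
rewrite (iotaD c3 c4) cmulDr cmulDr; congr (_ + _); apply: esym; exact: iota_proj.
Qed.

Lemma projZ x a xi : D x -> twisted xi -> proj x (a *: xi) = a *: proj x xi.
Proof.
move=> Dx txi; have tZ := twistedZ a txi; have t1 := twisted_proj Dx txi.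
apply: iota_inj; [exact/twisted_Cc/twisted_proj|exact/twisted_Cc/twistedZ|].
have [c1 c3] := (twisted_Cc t1, twisted_Cc txi).
apply: (etrans (iota_proj Dx tZ)); apply: (etrans _ (esym (iotaZ _ c1))).
rewrite (iotaZ _ c3) cmulZr cmulZr; congr (_ *: _); apply: esym; exact: iota_proj.
Qed.

(** On xi and [proj x xi], [proj y] is one and the same combination of translations by elements of
    M, each of which commutes with [proj x]. *)
Lemma proj_comm x y xi : D x -> D y -> twisted xi ->
  proj x (proj y xi) = proj y (proj x xi).
Proof.
move=> Dx Dy txi; have [s [hs e1 e2]] := proj_finite Dy txi (twisted_proj Dx txi).
apply: (etrans (congr1 (proj x) e1)); apply: (etrans _ (esym e2)).
apply: (@linear_on_sum _ _ twisted twisted0 twistedD twistedZ G (proj x) (@ltrans R G)).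
- by move=> v w; exact: projD.
- by move=> a v; exact: projZ.
move=> q /hs[Mq Dq]; split; first exact: twisted_ltrans.
by apply: esym; exact: ltrans_proj.
Qed.

Lemma proj_e x : D x -> proj x (ltrans x p) = ltrans x p.
Proof.
move=> Dx; have te := twisted_e Dx.
apply: iota_inj; [exact/twisted_Cc/twisted_proj | exact: twisted_Cc |].
by apply: (etrans (iota_proj Dx te)); rewrite iota_eE // twisted_iota.
Qed.

Lemma killed_twisted xi : twisted xi ->
  exists s, (forall x, x \in s -> D x) /\ killed proj s xi.
Proof.
move=> txi; have [s [hs es]] := twisted_span txi; exists [seq q.2 | q <- s]; split.
  by move=> _ /mapP[q /hs Dq ->].
have h1 x u : D x -> twisted u -> twisted (proj x u) by exact: twisted_proj.
have h2 x u v : D x -> twisted u -> twisted v ->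
  proj x (u + v) = proj x u + proj x v by exact: projD.
have h3 x a u : D x -> twisted u -> proj x (a *: u) = a *: proj x u by exact: projZ.
have h4 x y u : D x -> D y -> twisted u -> proj x (proj y u) = proj y (proj x u).
  exact: proj_comm.
have h5 x : D x -> twisted (ltrans x p) /\ proj x (ltrans x p) = ltrans x p.
  by move=> Dx; split; [exact: twisted_e | exact: proj_e].
have := killed_span twisted0 twistedD twistedZ h1 h2 h3 h4 hs h5.
by rewrite -es.
Qed.

(* The point is that inner (ltrans x p) xi is in the Hecke algebra. *)
Lemma iota_resid_split x xi : D x -> twisted xi ->
  cmul (cstar (iota xi)) (iota xi) =
  cmul (cstar (iota (inner (ltrans x p) xi))) (iota (inner (ltrans x p) xi)) +
  cmul (cstar (iota (resid proj x xi))) (iota (resid proj x xi)).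
Proof.
move=> Dx txi; have te := twisted_e Dx; have tp := twisted_proj Dx txi.
have cp := twisted_Cc tp.
have eR : iota (resid proj x xi) =
    iota xi - cmul (iota (ltrans x p)) (cmul (cstar (iota (ltrans x p))) (iota xi)).
  rewrite -(iota_proj Dx txi) /resid -scaleN1r -[in RHS]scaleN1r -iotaZ // iotaD //.
    exact: twisted_Cc.
  by apply: twisted_Cc; exact: twistedZ.
rewrite eR (iota_inner te txi) {eR}.
move: (iota_eE Dx) (twisted_iota te).
set E := iota (ltrans x p); set X := iota xi => EE EP.
(* W is the inner product of x p and xi. The two cross terms and the square of E W all equal W^* W,
   whence a Pythagorean identity. *)
set W := cmul (cstar E) X.
have WW : cmul (cstar X) (cmul E W) = cmul (cstar W) W.
  by rewrite cmulA /W [in RHS]cstarM cstarK.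
have e2 : cmul (cstar (cmul E W)) X = cmul (cstar W) W.
  by rewrite cstarM -cmulA.
have e3 : cmul (cstar (cmul E W)) (cmul E W) = cmul (cstar W) W.
  have PW : cmul (iota p) W = W by rewrite /W cmulA -{1}iota_p_star -cstarM EP.
  by rewrite cstarM -cmulA [cmul (cstar E) _]cmulA EE PW.
rewrite cstarD cstarN cmulDl !cmulDr !cmulNl !cmulNr WW e2 e3 opprK.
by rewrite addNr addr0 addrCA subrr addr0.
Qed.

Lemma psd_twisted (psd : A -> Prop) :
  (forall f, hecke f -> psd (cmul (cstar (iota f)) (iota f))) ->
  (forall a b, psd a -> psd b -> psd (a + b)) ->
  forall xi, twisted xi -> psd (cmul (cstar (iota xi)) (iota xi)).
Proof.
move=> psd_hecke psdD xi txi; have [s [hs]] := killed_twisted txi.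
elim: s xi txi hs => [|x s IH] xi txi hs /=.
  move=> ->; apply: psd_hecke; apply/heckeE; split; first exact: twisted0.
  by move=> h y _; rewrite /= mulr0.
have Dx := hs x (mem_head _ _) => hk; rewrite (iota_resid_split Dx txi).
apply: psdD; first by apply/psd_hecke/hecke_inner => //; exact: twisted_e.
apply: IH => //.
  apply: (resid_mem twistedD twistedZ (D := D)) => // y u; exact: twisted_proj.
by move=> y ys; apply: hs; rewrite in_cons ys orbT.
Qed.

Lemma hecke0 : hecke 0.
Proof.
apply/heckeE; split; first exact: twisted0.
by move=> h y _; rewrite /= mulr0.
Qed.

Lemma heckeD f g : hecke f -> hecke g -> hecke (f + g).
Proof.
move=> /heckeE[tf lf] /heckeE[tg lg]; apply/heckeE; split; first exact: twistedD.
by move=> h x hh; rewrite !fctE lf // lg // mulrDr.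
Qed.

Lemma heckeZ (a : R[i]) f : hecke f -> hecke (a *: f).
Proof.
move=> /heckeE[tf lf]; apply/heckeE; split; first exact: twistedZ.
by move=> h x hh; rewrite !fctE lf // [RHS]mulrC -scalerAl [f x * _]mulrC.
Qed.

Lemma iota_p_hecke f : hecke f -> cmul (iota p) (iota f) = iota f.
Proof.
move=> /heckeE[tf lf]; have := iota_e_lequiv (subgroup1 sD) tf lf.
by rewrite !ltrans1.
Qed.

Lemma hecke_involution f : hecke f -> hecke (involution Delta f).
Proof.
move=> hf; have tf := hecke_twisted hf.
suff -> : involution Delta f = inner f p by apply: hecke_inner => //; exact: twisted_p.
have ti : twisted (inner f p) by apply/hecke_twisted/hecke_inner => //; exact: twisted_p.
apply: iota_inj; [exact/involution_Cc/twisted_Cc | exact: twisted_Cc |].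
rewrite iotaS; last exact: twisted_Cc.
apply: (etrans _ (esym (iota_inner tf twisted_p))).
by rewrite -iota_p_star -cstarM iota_p_hecke.
Qed.

Lemma hecke_convolution f g : hecke f -> hecke g -> hecke (f \* g).
Proof.
move=> hf hg; have [tf tg] := (hecke_twisted hf, hecke_twisted hg).
have [cf cg] := (twisted_Cc tf, twisted_Cc tg).
have tfg := twisted_convolution cf tg; have cfg := twisted_Cc tfg.
apply/heckeE; split => //; apply: lequiv_of_p => //; apply: iota_inj => //.
  by apply/twisted_Cc/twisted_convolution => //; exact: cCp.
by rewrite (iotaM cCp cfg) (iotaM cf cg) cmulA iota_p_hecke.
Qed.

Lemma iota0 : iota 0 = 0.
Proof.
have c0 := twisted_Cc twisted0; have := iotaZ 0 c0.
by rewrite scale0r => ->; rewrite scale0r.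
Qed.

Lemma iota_p_neq0 : iota p != 0.
Proof.
apply/eqP; rewrite -iota0 => /(iota_inj cCp (twisted_Cc twisted0)) p0.
have := congr1 (fun f => f 1%g) p0; rewrite /sigma_projection.
rewrite mem_set; last exact: subgroup1.
by rewrite sigma1 => /eqP; rewrite oner_eq0.
Qed.

(** * Extending a C*-seminorm from the Hecke algebra to C_c(D) *)

Section Seminorm.
Variable gam : (G -> R[i]) -> R.
Hypothesis hgam : cstar_seminorm hecke (convolution mu) (involution Delta) gam.

Local Notation S := (iota @` hecke).
Local Notation X := (iota @` twisted).

(** The module theory wants a function on A. The preimage is unique on the image of the Hecke
    algebra, [iota] being injective there; elsewhere the value is the default gam 0. *)
Definition gamA (a : A) : R := gam (xget 0 [set f | hecke f /\ iota f = a]).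

Lemma gamAE f : hecke f -> gamA (iota f) = gam f.
Proof.
move=> hf; rewrite /gamA.
have [hg e] := @xgetPex _ 0 [set g | hecke g /\ iota g = iota f] (ex_intro _ f (conj hf erefl)).
by congr gam; apply: iota_inj e; exact: hecke_Cc.
Qed.

Let SD x y : S x -> S y -> S (x + y).
Proof.
move=> [f hf <-] [g hg <-]; exists (f + g); first exact: heckeD.
by rewrite iotaD //; exact: hecke_Cc.
Qed.
Let SZ (a : R[i]) x : S x -> S (a *: x).
Proof.
move=> [f hf <-]; exists (a *: f); first exact: heckeZ.
by rewrite iotaZ //; exact: hecke_Cc.
Qed.
Let SM x y : S x -> S y -> S (cmul x y).
Proof.
move=> [f hf <-] [g hg <-]; exists (f \* g); first exact: hecke_convolution.
by rewrite iotaM //; exact: hecke_Cc.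
Qed.
Let Sstar x : S x -> S (cstar x).
Proof.
move=> [f hf <-]; exists (involution Delta f); first exact: hecke_involution.
by rewrite iotaS //; exact: hecke_Cc.
Qed.
Let S0 : S 0. Proof. by exists 0; [exact: hecke0 | exact: iota0]. Qed.
Let Se : S (iota p). Proof. by exists p => //; exact: hecke_p. Qed.
Let ex x : S x -> cmul (iota p) x = x.
Proof. by move=> [f hf <-]; exact: iota_p_hecke. Qed.
Let xe x : S x -> cmul x (iota p) = x.
Proof. by move=> [f hf <-]; apply/twisted_iota/hecke_twisted. Qed.

Let g_ge0 x : S x -> 0 <= gamA x.
Proof. by move=> [f hf <-]; rewrite gamAE //; exact: csemi_ge0 hgam _ hf. Qed.
Let gD x y : S x -> S y -> gamA (x + y) <= gamA x + gamA y.
Proof.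
move=> [f hf <-] [g hg <-]; have [cf cg] := (hecke_Cc hf, hecke_Cc hg).
rewrite -(iotaD cf cg) (gamAE hf) (gamAE hg) (gamAE (heckeD hf hg)).
exact: csemiD hgam _ _ hf hg.
Qed.
Let gZ (a : R[i]) x : S x -> gamA (a *: x) = cabs a * gamA x.
Proof.
move=> [f hf <-]; have cf := hecke_Cc hf.
rewrite -(iotaZ a cf) (gamAE hf) (gamAE (heckeZ a hf)).
exact: csemiZ hgam _ _ hf.
Qed.
Let gM x y : S x -> S y -> gamA (cmul x y) <= gamA x * gamA y.
Proof.
move=> [f hf <-] [g hg <-]; have [cf cg] := (hecke_Cc hf, hecke_Cc hg).
rewrite -(iotaM cf cg) (gamAE hf) (gamAE hg) (gamAE (hecke_convolution hf hg)).
exact: csemiM hgam _ _ hf hg.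
Qed.
Let g_star x : S x -> gamA (cmul (cstar x) x) = gamA x ^+ 2.
Proof.
move=> [f hf <-]; have cf := hecke_Cc hf; have hi := hecke_involution hf.
have ci := hecke_Cc hi.
rewrite -(iotaS cf) -(iotaM ci cf) (gamAE hf) (gamAE (hecke_convolution hi hf)).
exact: csemi_star hgam _ hf.
Qed.

Let XD x y : X x -> X y -> X (x + y).
Proof.
move=> [f hf <-] [g hg <-]; exists (f + g); first exact: twistedD.
by rewrite iotaD //; exact: twisted_Cc.
Qed.
Let XZ (a : R[i]) x : X x -> X (a *: x).
Proof.
move=> [f hf <-]; exists (a *: f); first exact: twistedZ.
by rewrite iotaZ //; exact: twisted_Cc.
Qed.
Let XS x a : X x -> S a -> X (cmul x a).
Proof.
move=> [f hf <-] [g hg <-]; exists (f \* g).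
  by apply: twisted_convolution; [exact: twisted_Cc | exact: hecke_twisted].
by rewrite iotaM //; [exact: twisted_Cc | exact: hecke_Cc].
Qed.
Let inS x y : X x -> X y -> S (cmul (cstar x) y).
Proof.
move=> [f hf <-] [g hg <-]; exists (inner f g); first exact: hecke_inner.
exact: iota_inner.
Qed.
Let Xe : X (iota p). Proof. by exists p => //; exact: twisted_p. Qed.

Let hpsd := exists_psd S0 SD SZ SM Sstar Se iota_p_neq0 ex xe g_ge0 gD gZ gM g_star.

Lemma nrm_ltrans z xi : D z -> twisted xi ->
  nrm gamA (iota (ltrans z xi)) = nrm gamA (iota xi).
Proof. by move=> Dz txi; rewrite /nrm ltrans_unitary. Qed.

(** The triangle inequality along the finite sum of [convolution_twisted], whose coefficients have
    total modulus at most the L^1-norm, while translations preserve [nrm]. *)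
Lemma bounded_by_iota f : Cc D f -> bounded_by X gamA (iota f) (L1norm mu f).
Proof.
move=> cf; have [psd [psd1 psdD psd_cs]] := hpsd.
have psdX x : X x -> psd (cmul (cstar x) x).
  move=> [xi txi <-]; apply: psd_twisted => // g hg; apply: psd1; by exists g.
split; first exact: L1norm_ge0.
move=> _ [xi txi <-]; have cxi := twisted_Cc txi.
have tfx := twisted_convolution cf txi.
rewrite -(iotaM cf cxi); split; first by exists (f \* xi).
have [|s [hs les e1 _]] := @convolution_twisted D f xi xi cf _ txi txi.
  by move=> x fx; apply: contrapT => nD; case: cf fx => _ _ /(_ _ nD) ->; rewrite eqxx.
apply: le_trans (ler_wpM2r (nrm_ge0 gamA (iota xi)) les); rewrite e1.
elim: s hs {les e1} => [|q s IH] hs.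
  rewrite !big_nil mul0r iota0 /nrm cmul0r.
  have -> : gamA 0 = 0.
    by rewrite -(scale0r (0 : A)) gZ // (cabs_real 0) normr0 mul0r.
  by rewrite sqrtr0.
have hs' r : r \in s -> D r.2 by move=> rs; apply: hs; rewrite in_cons rs orbT.
have Dq := hs q (mem_head _ _).
have t1 := twisted_ltrans Dq txi; have t2 := twistedZ q.1 t1.
have t3 := twisted_sum txi hs'.
have [c1 [c2 c3]] := (twisted_Cc t1, (twisted_Cc t2, twisted_Cc t3)).
rewrite !big_cons mulrDl (iotaD c2 c3).
apply: le_trans (nrmD SD XD XZ XS inS g_ge0 gD psdX psd_cs _ _) _.
- by exists (q.1 *: ltrans q.2 xi).
- by exists (\sum_(q <- s) q.1 *: ltrans q.2 xi).
apply: lerD; last exact: IH.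
rewrite (iotaZ _ c1) (nrmZ inS gZ); last by exists (ltrans q.2 xi).
by rewrite nrm_ltrans.
Qed.

(** An inequality on the Hecke algebra is enough, as the aim is only to dominate gam by the norm of
    A. *)
Lemma exists_extension : exists Gam : (G -> R[i]) -> R,
  [/\ cstar_seminorm (Cc D) (convolution mu) (involution Delta) Gam,
      forall f, Cc D f -> Gam f <= L1norm mu f &
      forall f, hecke f -> gam f <= Gam f].
Proof.
have [psd [psd1 psdD psd_cs]] := hpsd.
have psdX x : X x -> psd (cmul (cstar x) x).
  move=> [xi txi <-]; apply: psd_twisted => // g hg; apply: psd1; by exists g.
exists (fun f => opnorm X gamA (iota f)); split.
- split.
  + by move=> f cf; exact: opnorm_ge0 (bounded_by_iota cf).
  + move=> f g cf cg; rewrite (iotaD cf cg).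
    exact: (opnormD SD XD XZ XS inS g_ge0 gD psdX psd_cs
      (bounded_by_iota cf) (bounded_by_iota cg)).
  + move=> a f cf; rewrite (iotaZ _ cf).
    exact: opnormZ XZ inS gZ _ _ _ (bounded_by_iota cf).
  + move=> f g cf cg; rewrite (iotaM cf cg).
    exact: opnormM (bounded_by_iota cf) (bounded_by_iota cg).
  + move=> f cf; have ci := involution_Cc cf.
    rewrite (iotaM ci cf) (iotaS cf).
    have bi := bounded_by_iota ci; rewrite (iotaS cf) in bi.
    exact: opnorm_star XD XZ XS inS g_ge0 _ psdX psd_cs _ _ _ (bounded_by_iota cf) bi.
- by move=> f cf; exact: opnorm_le (bounded_by_iota cf).
move=> f hf; rewrite -(gamAE hf).
apply: (gam_le_opnorm Se Xe xe ex Sstar g_ge0 g_star) (bounded_by_iota (hecke_Cc hf)).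
by exists f.
Qed.

End Seminorm.

(** * The corner as a completion of the Hecke algebra *)

Lemma corner_fix a : corner (iota p) a -> cmul (iota p) (cmul a (iota p)) = a.
Proof.
move=> [b _ <-]; rewrite !cmulA iota_p_idem -!cmulA iota_p_idem.
by rewrite !cmulA.
Qed.

Lemma cmul_lr_le (b c : A) :
  `|cmul (iota p) (cmul (b - c) (iota p))| <= `|iota p| * `|iota p| * `|b - c|.
Proof.
apply: le_trans (cmul_norm _ _) _; rewrite -mulrA ler_wpM2l //.
by rewrite mulrC; exact: cmul_norm.
Qed.

Lemma cmul_lrB (b c : A) : cmul (iota p) (cmul (b - c) (iota p)) =
  cmul (iota p) (cmul b (iota p)) - cmul (iota p) (cmul c (iota p)).
Proof. by rewrite cmulDl cmulNl cmulDr cmulNr. Qed.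

Lemma cmul_lr_continuous : continuous (fun b : A => cmul (iota p) (cmul b (iota p))).
Proof.
move=> b; apply/cvgrPdist_lt => e e0.
pose C := `|iota p| * `|iota p| + 1; have C0 : 0 < C.
  by rewrite ltr_pwDr ?ltr01 // mulr_ge0.
near=> c; rewrite -cmul_lrB; apply: le_lt_trans (cmul_lr_le _ _) _.
apply: (@le_lt_trans _ _ (C * `|b - c|)).
  by rewrite ler_wpM2r // lerDl ler01.
rewrite mulrC -ltr_pdivlMr //; near: c.
by apply: cvgr_dist_lt; [exact: cvg_id | exact: divr_gt0].
Unshelve. all: by end_near. Qed.

Lemma cstar_subalgebra_corner : cstar_subalgebra (corner (iota p)).
Proof.
split.
(* The corner is the fixed-point set of the continuous compression a -> p a p, hence closed. *)
- move=> a ha; exists a => //.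
  have hcl : closed [set a : A | cmul (iota p) (cmul a (iota p)) - a = 0].
    rewrite (_ : [set a : A | _] =
      (fun a : A => cmul (iota p) (cmul a (iota p)) - a) @^-1` [set 0]) //.
    apply: closed_comp; last first.
      by apply: accessible_closed_set1; apply: hausdorff_accessible; exact: norm_hausdorff.
    by move=> x _; exact: cvgB (@cmul_lr_continuous x) cvg_id.
  apply/eqP; rewrite -subr_eq0; apply/eqP; apply: hcl.
  apply: closureS ha => b hb /=; by rewrite corner_fix // subrr.
- by exists 0 => //; rewrite cmul0l cmul0r.
- by move=> _ _ [a _ <-] [b _ <-]; exists (a + b) => //; rewrite cmulDl cmulDr.
- by move=> c _ [a _ <-]; exists (c *: a) => //; rewrite cmulZl cmulZr.
- move=> x y /corner_fix hx /corner_fix hy; exists (cmul x y) => //.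
  rewrite -{1}hx -{1}hy -!cmulA iota_p_idem [cmul (iota p) (cmul (iota p) _)]cmulA iota_p_idem.
  by rewrite hy [X in cmul _ X]cmulA cmulA [cmul (iota p) _]cmulA -[cmul (cmul (iota p) x) _]cmulA hx.
- move=> _ [a _ <-]; exists (cstar a) => //.
  by rewrite !cstarM iota_p_star cmulA.
Qed.

Lemma enveloping_corner :
  (forall gam, cstar_seminorm (Cc D) (convolution mu) (involution Delta) gam ->
     (forall f, Cc D f -> gam f <= L1norm mu f) ->
     forall f, Cc D f -> (gam f)%:C <= `|iota f|) ->
  enveloping_cstar hecke (convolution mu) (involution Delta) (corner (iota p)) iota.
Proof.
move=> hmax; split; last first.
  move=> gam hgam f hf; have [Gam [sG leG gG]] := exists_extension hgam.
  apply: le_trans (hmax _ sG leG _ (hecke_Cc hf)).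
  by rewrite lecR; exact: gG.
split.
- exact: cstar_subalgebra_corner.
- split.
  + by move=> f g /hecke_Cc cf /hecke_Cc cg; exact: iotaD.
  + by move=> a f /hecke_Cc cf; exact: iotaZ.
  + by move=> f g /hecke_Cc cf /hecke_Cc cg; exact: iotaM.
  + by move=> f /hecke_Cc cf; exact: iotaS.
- move=> f g /set_mem/hecke_Cc cf /set_mem/hecke_Cc cg; exact: iota_inj.
- move=> _ [f hf <-]; exists (iota f) => //.
  by rewrite twisted_iota ?iota_p_hecke //; exact: hecke_twisted.
(* If f approximates b, then p f p approximates p b p, and p f p is in the Hecke algebra as the
   inner product of p and f p. *)
move=> _ [b _ <-] U hU.
have /(_ b I) hb := ccompl_dense hiota.
have [_ [[f cf <-] Uf]] := hb _ (cmul_lr_continuous hU).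
exists (cmul (iota p) (cmul (iota f) (iota p))); split => //.
have tf := twisted_convolution cf twisted_p.
exists (inner p (f \* p)); first by apply: hecke_inner => //; exact: twisted_p.
by rewrite (iota_inner twisted_p tf) iota_p_star (iotaM cf cCp).
Qed.

End Normal.
End Corner.
End TwistedFunctions.

(** * Supports of functions in the Hecke algebra *)

Section HeckeSupport.
Variables (R : realType) (G : groupType) (H : set G) (sigma : G -> R[i]).
Hypothesis hH : hecke_triple H sigma.
Variables (Gs : topGroupType) (j : G -> Gs) (Hs : set Gs) (sigmas : Gs -> R[i]).
Hypothesis hGs : schlichting_completion H sigma j Hs sigmas.

Lemma sub_B_set : H `<=` B_set H sigma.
Proof.
have sH : is_subgroup H by case: hH => -[].
move=> h hh k [hk _]; have hi := subgroupV sH hh.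
rewrite (htriple_mul hH (subgroupM sH hi hk) hh) (htriple_mul hH hi hk).
rewrite mulrAC -(htriple_mul hH hi hh) mulVg (htriple1 hH) mul1r.
by [].
Qed.

(** If f x is nonzero, density gives points j g of x Ks arbitrarily close to x, with f (j g) = f x.
    When h and g^-1 h g are both in H, writing h g = g (g^-1 h g) and using equivariance on either
    side gives sigma h = sigma (g^-1 h g), so g is in B. *)
Lemma hecke_algebra_B f : hecke_algebra Hs sigmas f ->
  Cc (closure (j @` B_set H sigma)) f.
Proof.
move=> [[cf cS _] hf]; split => // x nBx; apply/eqP; apply: contrapT => /negP fx.
apply: nBx => U hU.
have sKs := schl_kernel_subgroup hH hGs; have oKs := schl_kernel_open hH hGs.
have K1 := subgroup1 sKs; have sHs := schl_subgroup hH hGs.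
have s1 : sigmas 1%g = 1 := sigmas_kernel hH hGs K1.
have [||g [/interior_subset Ug Kg]] := compl_meets hGs
    (U := U° `&` [set y | closure (j @` char_kernel H sigma) (x^-1 * y)%g]).
- by apply: openI; [exact: open_interior | exact: open_preml].
- by exists x; split => //=; rewrite mulVg.
exists (j g); split => //; exists g => // h [hh]; rewrite conj_setE => hh'.
have fg : f (j g) = f x.
  have := hf 1%g (x^-1 * j g)%g x (subgroup1 sHs) (schl_kernel_sub hGs Kg).
  by rewrite mul1g mulVKg s1 mul1r (sigmas_kernel hH hGs Kg) mulr1.
have jM := hcompl_morph (schl_group hGs).
have e1 := hf (j h) 1%g (j g) (schl_mem hGs hh) (subgroup1 sHs).
have e2 := hf 1%g (j (g^-1 * h * g)%g) (j g) (subgroup1 sHs) (schl_mem hGs hh').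
move: e1 e2; rewrite mulg1 mul1g s1 mulr1 mul1r -!jM !mulgA mulgV mul1g => -> e2.
rewrite !(schl_extends hGs) // in e2.
have n0 : f (j g) != 0 by rewrite fg.
by apply: (mulIf n0); rewrite e2 mulrC.
Qed.

End HeckeSupport.

Theorem corollary6p6 (R : realType) (G : groupType)
    (H N : set G) (sigma : G -> R[i])
    (hH : reduced_hecke_triple H sigma)
    (hN : normal_subgroup N) (hHN : normal_in H N)
    (hsigma : forall n h, N n -> H h -> sigma (n * h * n^-1)%g = sigma h)
    (Gs : topGroupType) (j : G -> Gs) (Hs : set Gs) (sigmas : Gs -> R[i])
    (hGs : schlichting_completion H sigma j Hs sigmas)
    (mu : {measure set (g_sigma_algebraType (@open Gs)) -> \bar R})
    (hmu : haar_measure mu) (hmu1 : mu Hs = 1%E)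
    (Delta : Gs -> R) (hDelta : modular_function mu Delta) :
  (forall (A : cstarAlgType R) (iota : (Gs -> R[i]) -> A),
     group_cstar mu Delta [set: Gs] iota ->
     enveloping_cstar (hecke_algebra Hs sigmas)
       (convolution mu) (involution Delta)
       (corner (iota (sigma_projection Hs sigmas))) iota)
  /\
  (is_subgroup (B_set H sigma) ->
   forall (A : cstarAlgType R) (iota : (Gs -> R[i]) -> A),
     group_cstar mu Delta (closure (j @` B_set H sigma)) iota ->
     enveloping_cstar (hecke_algebra Hs sigmas)
       (convolution mu) (involution Delta)
       (corner (iota (sigma_projection Hs sigmas))) iota).
Proof.
have hT := hH.1; have sH : is_subgroup H by case: hT => -[].
have [sN nN] := hN; have [_ HN nHN] := hHN.
have KH : char_kernel H sigma `<=` H by move=> h [].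
have KN : char_kernel H sigma `<=` N by exact: subset_trans HN.
(* Both assertions are this one, for D the whole group or the closure of B; the closure of N serves
   as M in either case. *)
have key (D : set Gs) (A : cstarAlgType R) (iota : (Gs -> R[i]) -> A) :
    is_subgroup D -> Hs `<=` D -> hecke_algebra Hs sigmas `<=` Cc D ->
    group_cstar mu Delta D iota ->
    enveloping_cstar (hecke_algebra Hs sigmas) (convolution mu)
      (involution Delta) (corner (iota (sigma_projection Hs sigmas))) iota.
  move=> sD HD heckeD [hcompl _ hmax].
  apply: (enveloping_corner hmu hDelta (schl_subgroup hT hGs) (schl_open hT hGs)
    (@schl_compact _ _ _ _ hT _ _ _ _ hGs) hmu1 (schl_kernel_subgroup hT hGs)
    (schl_kernel_open hT hGs) (@schl_kernel_sub _ _ _ _ _ _ _ _ hGs) sD HD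
    (@sigmas_mul _ _ _ _ hT _ _ _ _ hGs) (@sigmas_unitary _ _ _ _ hT _ _ _ _ hGs)
    (@sigmas_kernel _ _ _ _ hT _ _ _ _ hGs) hcompl heckeD
    (M := closure (j @` N))) => //.
  - exact: (subgroup_closure_image hGs sN).
  - by move=> g z; apply: (normal_closure_image hT hGs hN KN).
  - rewrite (schl_closure hGs); apply: closureS => _ [h hh <-].
    by exists h => //; exact: HN.
  - by move=> z h; apply: (schl_normal_in hT hGs hHN hsigma).
split=> [A iota|sB A iota]; apply: key => //.
- by apply/subgroupP; split.
- by move=> f [].
- exact: (subgroup_closure_image hGs sB).
- rewrite (schl_closure hGs); apply: closureS => _ [h hh <-].
  by exists h => //; exact: sub_B_set.
- by move=> f; exact: hecke_algebra_B.
Qed.
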